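(* Let $n$ be a positive integer. Let $p$ be a prime number. Let $M$ be a $2n$-dimensional $p$-adic analytic manifold. Let $\omega_0$ and $\omega_1$ be two $p$-adic analytic symplectic forms on $M$. Let $m\in M$. Then there exist open neighborhoods $U_0,U_1$ of $m$ and a ($p$-adic analytic) diffeomorphism $\psi:U_0\to U_1$ such that $\psi^*(\omega_1|_{U_1})=\omega_0|_{U_0}$.
   Context: A function between open subsets of $(\mathbb{Q}_p)^{\ell_1}$ and $(\mathbb{Q}_p)^{\ell_2}$ is $p$-adic analytic if its domain is a union of balls on each of which it is given by a convergent $p$-adic power series. An $\ell$-dimensional $p$-adic analytic manifold is a Hausdorff topological space with an atlas of charts (homeomorphisms from open subsets onto open subsets of $(\mathbb{Q}_p)^\ell$) whose changes of charts are bi-analytic. A $p$-adic analytic symplectic form on $M$ is a closed $p$-adic analytic $2$-form $\omega$ that is non-degenerate: for all $m\in M$ and $0\neq u\in\mathrm{T}_mM$ there is $v\in\mathrm{T}_mM$ with $\omega(u,v)\neq0$. A $p$-adic analytic diffeomorphism is a bi-analytic bijection. *)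

(* Defs.v *)
From HB Require Import structures.
From mathcomp Require Import all_boot all_order all_algebra finmap.
From mathcomp Require Import generic_quotient ring_quotient.
From mathcomp Require Import all_classical.
From mathcomp Require Import reals topology normedtype summability.

Set Implicit Arguments.
Unset Strict Implicit.
Unset Printing Implicit Defensive.

Import Order.TTheory GRing.Theory Num.Theory.

Local Open Scope classical_set_scope.
Local Open Scope ring_scope.

(* |x|_p = p ^ (- v_p(x)) *)
Definition padic_abs (p : nat) (x : rat) : rat :=
  if x == 0 then 0
  else p%:Q ^ ((logn p `|denq x|)%:Z - (logn p `|numq x|)%:Z).

Section PadicAbs.
Variables (p : nat) (pP : prime p).
Local Notation abs := (padic_abs p).

Let p_gt0 : 0 < p%:Q :> rat.
Proof. by rewrite ltr0z ltz_nat prime_gt0. Qed.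

Let p_ge1 : 1 <= p%:Q :> rat.
Proof. by rewrite ler1z lez_nat prime_gt0. Qed.

Lemma padic_abs0 : abs 0 = 0.
Proof. by rewrite /padic_abs eqxx. Qed.

Lemma padic_abs_gt0 x : (0 < abs x) = (x != 0).
Proof.
rewrite /padic_abs; case: eqVneq => //= _.
exact: exprz_gt0.
Qed.

Lemma padic_abs_ge0 x : 0 <= abs x.
Proof.
have [->|x0] := eqVneq x 0; first by rewrite padic_abs0.
by rewrite ltW // padic_abs_gt0.
Qed.

Lemma padic_abs_frac (a b : int) : a != 0 -> b != 0 ->
  abs (a%:Q / b%:Q) = p%:Q ^ ((logn p `|b|)%:Z - (logn p `|a|)%:Z).
Proof.
move=> a0 b0; set x := _ / _.
have x0 : x != 0 by rewrite mulf_neq0 ?invr_eq0 ?intr_eq0.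
rewrite /padic_abs (negbTE x0); congr (_ ^ _).
have : (numq x * b = a * denq x)%R.
  apply: (@intr_inj rat); rewrite !intrM.
  rewrite numqE /x mulrAC divfK ?intr_eq0 //.
move=> /(congr1 absz); rewrite !abszM => /(congr1 (logn p)).
rewrite !lognM ?absz_gt0 ?numq_eq0 ?denq_eq0 // => E.
by apply/eqP; rewrite subr_eq addrAC eq_sym subr_eq -!PoszD addnC E addnC.
Qed.

Lemma padic_absM x y : abs (x * y) = abs x * abs y.
Proof.
have [->|x0] := eqVneq x 0; first by rewrite mul0r padic_abs0 mul0r.
have [->|y0] := eqVneq y 0; first by rewrite mulr0 padic_abs0 mulr0.
rewrite -{1}[x]divq_num_den -{1}[y]divq_num_den mulf_div -!intrM.
rewrite padic_abs_frac ?mulf_neq0 ?numq_eq0 ?denq_eq0 //.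
rewrite /padic_abs (negbTE x0) (negbTE y0) -expfzDr ?gt_eqF //.
rewrite !abszM !lognM ?absz_gt0 ?numq_eq0 ?denq_eq0 // !PoszD.
by rewrite opprD addrACA.
Qed.

Lemma padic_absN x : abs (- x) = abs x.
Proof.
by rewrite /padic_abs oppr_eq0 numqN denqN abszN.
Qed.

Lemma padic_abs1 : abs 1 = 1.
Proof. by rewrite /padic_abs oner_eq0 /= logn1 subrr expr0z. Qed.

Lemma padic_absV x : abs x^-1 = (abs x)^-1.
Proof.
have [->|x0] := eqVneq x 0; first by rewrite padic_abs0 invr0 padic_abs0.
have ax : abs x != 0 by rewrite gt_eqF // padic_abs_gt0.
by apply: (mulfI ax); rewrite -padic_absM !divff ?padic_abs1.
Qed.

Lemma padic_absD x y : abs (x + y) <= Num.max (abs x) (abs y).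
Proof.
have [->|x0] := eqVneq x 0; first by rewrite add0r le_max lexx orbT.
have [->|y0] := eqVneq y 0; first by rewrite addr0 le_max lexx.
have [->|xy0] := eqVneq (x + y) 0.
  by rewrite padic_abs0 le_max padic_abs_ge0.
set d := denq x * denq y.
have d0 : d != 0 by rewrite mulf_neq0 ?denq_eq0.
have dx : denq x != 0 by rewrite denq_eq0.
have dy : denq y != 0 by rewrite denq_eq0.
have xE : x = (numq x * denq y)%:Q / d%:Q.
  by rewrite -{1}[x]divq_num_den /d !intrM -mulf_div divff ?mulr1 ?intr_eq0.
have yE : y = (numq y * denq x)%:Q / d%:Q.
  rewrite -{1}[y]divq_num_den /d [denq x * denq y]mulrC !intrM -mulf_div.
  by rewrite divff ?mulr1 ?intr_eq0.
move: xE yE; set a := numq x * _; set b := numq y * _ => xE yE.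
have xyE : x + y = (a + b)%:Q / d%:Q by rewrite xE yE intrD mulrDl.
have a0 : a != 0 by rewrite mulf_neq0 ?numq_eq0.
have b0 : b != 0 by rewrite mulf_neq0 ?numq_eq0.
have ab0 : a + b != 0.
  by apply: contra_neq xy0 => E; rewrite xyE E mul0r.
rewrite xyE [in X in _ <= X]xE [in X in _ <= X]yE !padic_abs_frac //.
have : (minn (logn p `|a|) (logn p `|b|) <= logn p `|(a + b)%R|)%N.
  rewrite -pfactor_dvdn ?absz_gt0 //; set k := minn _ _.
  have: ((p ^ k)%N%:Z %| a + b)%Z.
    apply: rpredD; rewrite /in_mem /= /dvdz absz_nat pfactor_dvdn ?absz_gt0 //.
      exact: geq_minl.
    exact: geq_minr.
  by rewrite /dvdz absz_nat.
rewrite le_max geq_min => /orP[] H; apply/orP; [left|right];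
  by apply: ler_weXz2l => //; rewrite lerD2l lerN2 lez_nat.
Qed.

Lemma padic_absB x y : abs (x - y) = abs (y - x).
Proof. by rewrite -padic_absN opprB. Qed.

Lemma padic_abs_triangle y x z :
  abs (x - z) <= Num.max (abs (x - y)) (abs (y - z)).
Proof. by have := padic_absD (x - y) (y - z); rewrite addrA subrK. Qed.

Lemma padic_abs_eq x y : abs (x - y) < abs y -> abs x = abs y.
Proof.
move=> h; apply/eqP; rewrite eq_le; apply/andP; split.
  have := padic_absD (x - y) y; rewrite subrK => /le_trans; apply.
  by rewrite ge_max lexx andbT ltW.
have := padic_absD (y - x) x; rewrite subrK le_max padic_absB => /orP[|//].
by rewrite leNgt h.
Qed.

Lemma padic_abs_dist x y : `|abs x - abs y| <= abs (x - y).
Proof.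
have le_abs a b : abs a - abs b <= abs (a - b).
  rewrite lerBlDr; have := padic_absD (a - b) b; rewrite subrK => /le_trans.
  by apply; rewrite ge_max lerDl lerDr !padic_abs_ge0.
by rewrite ler_norml lerNl opprB le_abs padic_absB le_abs.
Qed.

End PadicAbs.

Definition padic_cauchy (p : nat) (u : nat -> rat) : Prop :=
  forall e : rat, 0 < e -> exists N, forall i j, (N <= i)%N -> (N <= j)%N ->
    padic_abs p (u i - u j) < e.

Definition padic_null (p : nat) (u : nat -> rat) : Prop :=
  forall e : rat, 0 < e -> exists N, forall i, (N <= i)%N ->
    padic_abs p (u i) < e.

Section PadicCauchy.
Variables (p : nat) (pP : prime p).
Local Notation abs := (padic_abs p).

Lemma padic_cauchy_bounded u : padic_cauchy p u ->
  exists2 b, 0 < b & forall i, abs (u i) <= b.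
Proof.
move=> /(_ 1 ltr01)[N uN].
exists (1 + \sum_(i < N.+1) abs (u i)).
  by rewrite ltr_wpDr // sumr_ge0 // => i _; exact: padic_abs_ge0.
have le_sum (i : 'I_N.+1) : abs (u i) <= \sum_(i < N.+1) abs (u i).
  rewrite (bigD1 i) //= lerDl sumr_ge0 // => k _; exact: padic_abs_ge0.
move=> i; have [iN|iN] := ltnP i N.+1.
  by rewrite (le_trans (le_sum (Ordinal iN))) // lerDr.
have := padic_absD pP (u i - u N) (u N); rewrite subrK => /le_trans; apply.
rewrite ge_max; apply/andP; split.
  rewrite (le_trans (ltW (uN _ _ (ltnW iN) (leqnn _)))) // lerDl.
  by rewrite sumr_ge0 // => k _; exact: padic_abs_ge0.
by rewrite (le_trans (le_sum ord_max)) // lerDr.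
Qed.

Lemma padic_cauchy_away u : padic_cauchy p u -> ~ padic_null p u ->
  exists N c, 0 < c /\ forall i, (N <= i)%N -> abs (u i) = c.
Proof.
move=> uC; rewrite /padic_null => /existsNP[e] /not_implyP[e0 /forallNP ue].
have [N uN] := uC _ e0.
have [k /not_implyP[kN /negP]] : exists k, ~ ((N <= k)%N -> abs (u k) < e).
  by apply/existsNP; exact: ue.
rewrite -leNgt => ek; exists N, (abs (u k)); split; first exact: lt_le_trans ek.
by move=> i iN; apply: padic_abs_eq => //; exact: lt_le_trans (uN _ _ iN kN) ek.
Qed.

(* The primality proof is an argument so that HB can infer the structures. *)
Definition cauchy_pred of prime p : {pred nat -> rat} :=
  fun u => `[< padic_cauchy p u >].

Lemma cauchy_subring : subring_closed (cauchy_pred pP).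
Proof.
split=> [|u v /asboolP uC /asboolP vC|u v /asboolP uC /asboolP vC]; apply/asboolP.
- by move=> e e0; exists 0%N => i j _ _; rewrite subrr padic_abs0.
- move=> e e0; have [N uN] := uC _ e0; have [N' vN] := vC _ e0.
  exists (maxn N N') => i j; rewrite !geq_max => /andP[i1 i2] /andP[j1 j2].
  have -> : (u - v) i - (u - v) j = (u i - u j) - (v i - v j).
    rewrite [(u - v) i]/= [(u - v) j]/= !opprB [v j - u j]addrC.
    by rewrite addrACA [- v i + _]addrC.
  rewrite (le_lt_trans (padic_absD pP _ _)) // gt_max uN //=.
  by rewrite padic_absN vN.
- have [b b0 ub] := padic_cauchy_bounded uC.
  have [c c0 vc] := padic_cauchy_bounded vC.
  move=> e e0; have [N uN] := uC _ (divr_gt0 e0 c0).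
  have [N' vN] := vC _ (divr_gt0 e0 b0).
  exists (maxn N N') => i j; rewrite !geq_max => /andP[i1 i2] /andP[j1 j2].
  have -> : (u * v) i - (u * v) j = (u i - u j) * v i + u j * (v i - v j).
    by rewrite mulrBl mulrBr addrA subrK.
  rewrite (le_lt_trans (padic_absD pP _ _)) // gt_max !padic_absM //.
  apply/andP; split.
    apply: le_lt_trans (ler_wpM2l (padic_abs_ge0 pP _) (vc _)) _.
    by rewrite -ltr_pdivlMr // uN.
  apply: le_lt_trans (ler_wpM2r (padic_abs_ge0 pP _) (ub _)) _.
  by rewrite mulrC -ltr_pdivlMr // vN.
Qed.

HB.instance Definition _ :=
  GRing.isSubringClosed.Build (nat -> rat) (cauchy_pred pP) cauchy_subring.

End PadicCauchy.

Section Qp.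
Variables (p : nat) (pP : prime p).
Local Notation abs := (padic_abs p).

Record cauchy_seq := CauchySeq {
  cauchy_val :> nat -> rat; _ : cauchy_val \in cauchy_pred pP }.

HB.instance Definition _ := [isSub for cauchy_val].
HB.instance Definition _ := [Choice of cauchy_seq by <:].
HB.instance Definition _ := [SubChoice_isSubComNzRing of cauchy_seq by <:].

Lemma cauchy_seqP (u : cauchy_seq) : padic_cauchy p u.
Proof. exact/asboolP/(valP u). Qed.

Definition null_pred : {pred cauchy_seq} := fun u => `[< padic_null p u >].

Lemma null_idealr : idealr_closed null_pred.
Proof.
split.
- by apply/asboolP => e e0; exists 0%N => i _; rewrite padic_abs0.
- apply/asboolP => /(_ 1 ltr01)[N] /(_ N (leqnn N)).
  by rewrite (_ : val 1 N = 1) // padic_abs1 ltxx.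
- move=> a u v /asboolP u0 /asboolP v0; apply/asboolP => e e0.
  have [b b0 ab] := padic_cauchy_bounded pP (cauchy_seqP a).
  have [N uN] := u0 _ (divr_gt0 e0 b0); have [N' vN] := v0 _ e0.
  exists (maxn N N') => i; rewrite geq_max => /andP[i1 i2].
  rewrite (_ : (a * u + v : cauchy_seq) i = a i * u i + v i) //.
  rewrite (le_lt_trans (padic_absD pP _ _)) // gt_max vN // andbT padic_absM //.
  apply: le_lt_trans (ler_wpM2r (padic_abs_ge0 pP _) (ab _)) _.
  by rewrite mulrC -ltr_pdivlMr // uN.
Qed.

HB.instance Definition _ := isIdealr.Build cauchy_seq null_pred null_idealr.

(* The completion of Q: Cauchy sequences modulo null sequences for |.|_p.     *)
Definition Qp := {ideal_quot null_pred}.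

HB.instance Definition _ := GRing.ComNzRing.on Qp.
HB.instance Definition _ := EqQuotient.on Qp.

Local Open Scope quotient_scope.

Implicit Types x y z : Qp.

Lemma Qp_repr0 x : (x == 0) = `[< padic_null p (repr x) >].
Proof.
have -> : (x == 0) = (repr x - 0 \in null_pred).
  by rewrite Quotient.idealrBE reprK rmorph0.
by rewrite subr0.
Qed.

Lemma Qp_unit (x : Qp) : x != 0 -> exists y : Qp, y * x = 1.
Proof.
rewrite Qp_repr0 => /asboolPn u0.
have [N [c [c0 uN]]] := padic_cauchy_away pP (cauchy_seqP (repr x)) u0.
set u : cauchy_seq := repr x in uN *.
have uV0 i : (N <= i)%N -> u i != 0.
  by move=> iN; rewrite -(padic_abs_gt0 pP) uN.
have vC : (fun i => (u i)^-1) \in cauchy_pred pP.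
  apply/asboolP => e e0.
  have [N' uN'] := cauchy_seqP u (mulr_gt0 e0 (mulr_gt0 c0 c0)).
  exists (maxn N N') => i j; rewrite !geq_max => /andP[i1 i2] /andP[j1 j2].
  have -> : (u i)^-1 - (u j)^-1 = (u j - u i) / (u i * u j).
    rewrite invfM mulrBl mulrCA divff ?uV0 // mulr1 mulrA divff ?uV0 //.
    by rewrite mul1r.
  by rewrite padic_absM // padic_absV // padic_absM // !uN // ltr_pdivrMr
    ?mulr_gt0 // uN'.
exists (\pi_Qp (CauchySeq vC)); rewrite -{1}[x]reprK -rmorphM -(rmorph1 \pi_Qp).
apply/eqP; rewrite -Quotient.idealrBE; apply/asboolP => e e0.
exists N => i iN; rewrite [X in padic_abs _ X](_ : _ = (u i)^-1 * u i - 1) //.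
by rewrite mulVf ?uV0 // subrr padic_abs0.
Qed.

Definition Qp_inv (x : Qp) : Qp := xget 0 [set y | y * x = 1].

Lemma Qp_mulVf x : x != 0 -> Qp_inv x * x = 1.
Proof. by move=> /Qp_unit[y yx]; exact: (@xgetPex _ 0 [set z | z * x = 1] (ex_intro _ y yx)). Qed.

Lemma Qp_inv0 : Qp_inv 0 = 0.
Proof.
by apply: xgetPN => y /= /eqP; rewrite mulr0 eq_sym oner_eq0.
Qed.

HB.instance Definition _ :=
  GRing.ComNzRing_isField.Build Qp Qp_mulVf Qp_inv0.

(* The absolute value of the class of (u_n) is the limit of |u_n|_p; it takes *)
(* its values in {0} U p^Z, hence in rat.                                     *)
Definition Qp_abs (x : Qp) : rat :=
  xget 0 [set r | forall e, 0 < e ->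
    exists N, forall i, (N <= i)%N -> `|abs (repr x i) - r| < e].

Lemma Qp_absP x e : 0 < e ->
  exists N, forall i, (N <= i)%N -> `|abs (repr x i) - Qp_abs x| < e.
Proof.
apply: (@xgetPex _ 0 [set r | forall e, 0 < e ->
  exists N, forall i, (N <= i)%N -> `|abs (repr x i) - r| < e]) e.
have [u0|u0] := pselect (padic_null p (repr x)).
  exists 0 => e /u0[N uN]; exists N => i iN.
  by rewrite subr0 ger0_norm ?padic_abs_ge0 // uN.
have [N [c [c0 uN]]] := padic_cauchy_away pP (cauchy_seqP (repr x)) u0.
by exists c => e e0; exists N => i iN; rewrite uN // subrr normr0.
Qed.

Lemma Qp_abs_pi (u : cauchy_seq) e : 0 < e ->
  exists N, forall i, (N <= i)%N -> `|abs (u i) - Qp_abs (\pi_Qp u)| < e.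
Proof.
move=> e0; have e2 : 0 < e / 2 by rewrite divr_gt0.
have [N1 H1] := Qp_absP (\pi_Qp u) e2.
have : (u - repr (\pi_Qp u)) \in null_pred by rewrite Quotient.idealrBE reprK.
move=> /asboolP/(_ _ e2)[N2 H2].
exists (maxn N1 N2) => i; rewrite geq_max => /andP[i1 i2].
rewrite [e]splitr (le_lt_trans (ler_distD (abs (repr (\pi_Qp u) i)) _ _)) //.
by rewrite ltrD ?H1 // (le_lt_trans (padic_abs_dist pP _ _)) // H2.
Qed.

Lemma Qp_abs0 : Qp_abs 0 = 0.
Proof.
apply/eqP; rewrite -normr_le0; apply/ler_addgt0Pl => e e0.
have := Qp_abs_pi 0 e0; rewrite rmorph0 => -[N /(_ N (leqnn N))].
by rewrite padic_abs0 sub0r normrN addr0 => /ltW.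
Qed.

Lemma Qp_abs_ge0 x : 0 <= Qp_abs x.
Proof.
apply/ler_addgt0Pl => e e0; have [N /(_ N (leqnn N))] := Qp_absP x e0.
rewrite ltr_norml => /andP[_]; rewrite ltrBlDr => /ltW; apply: le_trans.
exact: padic_abs_ge0.
Qed.

Lemma Qp_abs_eq0 x : Qp_abs x = 0 -> x = 0.
Proof.
move=> x0; apply/eqP; rewrite Qp_repr0; apply/asboolP => e e0.
have [N xN] := Qp_absP x e0; exists N => i /xN.
by rewrite x0 subr0 ger0_norm ?padic_abs_ge0.
Qed.

Lemma Qp_absN x : Qp_abs (- x) = Qp_abs x.
Proof.
apply/eqP; rewrite -subr_eq0 -normr_le0; apply/ler_addgt0Pl => e e0.
rewrite addr0; have e2 : 0 < e / 2 by rewrite divr_gt0.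
have [N1 H1] := Qp_absP x e2; have [N2] := Qp_abs_pi (- repr x) e2.
rewrite rmorphN /= reprK => H2.
have := H1 _ (leq_maxl N1 N2); have := H2 _ (leq_maxr N1 N2).
set i := maxn _ _; rewrite [X in padic_abs _ X](_ : _ = - repr x i) //.
rewrite padic_absN distrC => h2 h1; rewrite ltW // [e]splitr.
by rewrite (le_lt_trans (ler_distD (abs (repr x i)) _ _)) // ltrD.
Qed.

Lemma Qp_absD x y : Qp_abs (x + y) <= Num.max (Qp_abs x) (Qp_abs y).
Proof.
apply/ler_addgt0Pl => e e0; have e2 : 0 < e / 2 by rewrite divr_gt0.
have [N1 H1] := Qp_absP x e2; have [N2 H2] := Qp_absP y e2.
have [N3] := Qp_abs_pi (repr x + repr y) e2.
rewrite rmorphD /= !reprK => H3; set i := maxn N1 (maxn N2 N3).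
have i1 : (N1 <= i)%N by rewrite leq_maxl.
have i2 : (N2 <= i)%N by rewrite leq_max leq_max leqnn orbT.
have i3 : (N3 <= i)%N by rewrite !leq_max leqnn !orbT.
move: (H1 _ i1) (H2 _ i2) (H3 _ i3).
rewrite [X in padic_abs _ X - Qp_abs (x + y)](_ : _ = repr x i + repr y i) //.
have := padic_absD pP (repr x i) (repr y i).
set a := abs (repr x i); set b := abs (repr y i); set c := abs (_ + _).
rewrite !ltr_norml => ab /andP[_ a1] /andP[_ b1] /andP[c1 _].
have -> : e + Num.max (Qp_abs x) (Qp_abs y) =
  e / 2 + Num.max (e / 2 + Qp_abs x) (e / 2 + Qp_abs y).
  by rewrite -addr_maxr addrA -splitr.
rewrite ltrNl opprB ltrBlDr in c1.
rewrite ltrBlDr in a1; rewrite ltrBlDr in b1.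
rewrite (le_trans (ltW c1)) // lerD2l (le_trans ab) // ge_max !le_max.
by rewrite (ltW a1) (ltW b1) orbT.
Qed.

Definition Qp_dist (x y : Qp) := Qp_abs (x - y).

Lemma Qp_distxx x : Qp_dist x x = 0.
Proof. by rewrite /Qp_dist subrr Qp_abs0. Qed.

Lemma Qp_dist_eq0 x y : Qp_dist x y = 0 -> x = y.
Proof. by move=> /Qp_abs_eq0/eqP; rewrite subr_eq0 => /eqP. Qed.

Lemma Qp_dist_sym x y : Qp_dist x y = Qp_dist y x.
Proof. by rewrite /Qp_dist -Qp_absN opprB. Qed.

Lemma Qp_dist_triangle y x z : Qp_dist x z <= Qp_dist x y + Qp_dist y z.
Proof.
rewrite /Qp_dist -(subrK y x) -addrA addrK; apply: le_trans (Qp_absD _ _) _.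
by rewrite ge_max lerDl lerDr !Qp_abs_ge0.
Qed.

HB.instance Definition _ := isMetric.Build rat Qp
  Qp_distxx Qp_dist_eq0 Qp_dist_sym Qp_dist_triangle.

HB.instance Definition _ := isPointed.Build Qp 0.

End Qp.

Section Analytic.
Variables (p : nat) (pP : prime p).
Local Notation K := (Qp pP).

Definition monomial l (a : {ffun 'I_l -> nat}) (h : 'rV[K]_l) : K :=
  \prod_i h 0 i ^+ a i.

(* Maps with values in matrices cover both K^l2 = 'rV[K]_l2 and the           *)
(* coefficient matrices of 2-forms. Balls are those of the sup norm.          *)
Definition analytic_on l a b (U : set 'rV[K]_l) (f : 'rV[K]_l -> 'M[K]_(a, b)) :
    Prop :=
  forall x, U x -> exists (x0 : 'rV[K]_l) (r : rat),
    [/\ ball x0 r x, ball x0 r `<=` U &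
      exists c : {ffun 'I_l -> nat} -> 'M[K]_(a, b), forall y, ball x0 r y ->
        partial_sum (fun k => monomial k (y - x0) *: c k) @ totally --> f y].

Definition partial l a b (i : 'I_l) (f : 'rV[K]_l -> 'M[K]_(a, b))
    (x : 'rV[K]_l) : 'M[K]_(a, b) :=
  lim ((fun t : K => t^-1 *: (f (x + t *: delta_mx 0 i) - f x)) @ 0^').

(* Transposed Jacobian: the differential of f at x is v |-> v *m jacobian f x *)
Definition jacobian l1 l2 (f : 'rV[K]_l1 -> 'rV[K]_l2) (x : 'rV[K]_l1) :
    'M[K]_(l1, l2) := \matrix_(i, j) partial i f x 0 j.

Record chart (l : nat) (M : topologicalType) := Chart {
  dom : set M;
  cod : set 'rV[K]_l;
  coord :> M -> 'rV[K]_l;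
  coord_inv : 'rV[K]_l -> M;
  dom_open : open dom;
  cod_open : open cod;
  coord_fun : set_fun dom cod coord;
  coord_inv_fun : set_fun cod dom coord_inv;
  coordK : {in dom, cancel coord coord_inv};
  coord_invK : {in cod, cancel coord_inv coord};
  coord_cts : {within dom, continuous coord};
  coord_inv_cts : {within cod, continuous coord_inv} }.

Record manifold (l : nat) := Manifold {
  carrier :> topologicalType;
  atlas : set (chart l carrier);
  manifold_hausdorff : hausdorff_space carrier;
  atlas_cover : forall m : carrier, exists2 phi, atlas phi & dom phi m;
  atlas_compat : forall phi chi, atlas phi -> atlas chi ->
    analytic_on (phi @` (dom phi `&` dom chi)) (chi \o coord_inv phi) }.

Definition chart_at l (M : manifold l) (m : M) : chart l M :=
  s2val (cid2 (atlas_cover m)).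

(* A tangent vector at m is a class of pairs (chart at m, vector) modulo the  *)
(* differentials of the changes of charts; it is represented by its           *)
(* coordinates in the chart chart_at m.                                       *)
Definition tangent l (M : manifold l) (m : M) : Type := 'rV[K]_l.
HB.instance Definition _ l (M : manifold l) (m : M) :=
  GRing.Lmodule.on (tangent m).

(* The tangent vector at coord_inv phi x with coordinates v in the chart phi. *)
Definition tangent_of_chart l (M : manifold l) (phi : chart l M)
    (x v : 'rV[K]_l) : tangent (coord_inv phi x) :=
  v *m jacobian (chart_at (coord_inv phi x) \o coord_inv phi) x.

(* Continuity on U is implied: analytic_on forces its domain, here a chart     *)
(* image of a preimage, to be open.                                           *)
Definition analytic_map l1 l2 (M : manifold l1) (N : manifold l2) (U : set M)
    (f : M -> N) : Prop :=
  open U /\ forall phi chi, atlas phi -> atlas chi ->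
    analytic_on (phi @` (dom phi `&` U `&` f @^-1` dom chi))
                (chi \o f \o coord_inv phi).

(* By set_bij, g restricted to V is the inverse of f : U -> V.                *)
Definition analytic_diffeo l1 l2 (M : manifold l1) (N : manifold l2)
    (U : set M) (V : set N) (f : M -> N) : Prop :=
  [/\ set_bij U V f, analytic_map U f &
    exists g : N -> M, {in U, cancel f g} /\ analytic_map V g].

Definition tangent_map l1 l2 (M : manifold l1) (N : manifold l2) (f : M -> N)
    (m : M) (u : tangent m) : tangent (f m) :=
  u *m jacobian (chart_at (f m) \o f \o coord_inv (chart_at m)) (chart_at m m).

Record two_form l (M : manifold l) := TwoForm {
  form :> forall m : M, tangent m -> tangent m -> K;
  form_linearl : forall m (v : tangent m), scalar (fun u : tangent m => form u v);
  form_linearr : forall m (u : tangent m), scalar (form u);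
  form_alt : forall m (u : tangent m), form u u = 0 }.
Arguments form {l M} w m u v : rename.

Definition form_mx l (M : manifold l) (w : two_form M) (phi : chart l M)
    (x : 'rV[K]_l) : 'M[K]_l :=
  \matrix_(i, j) w (coord_inv phi x) (tangent_of_chart phi x (delta_mx 0 i))
                                     (tangent_of_chart phi x (delta_mx 0 j)).

Definition analytic_form l (M : manifold l) (w : two_form M) : Prop :=
  forall phi, atlas phi -> analytic_on (cod phi) (form_mx w phi).

(* The coefficient of dx_i /\ dx_j /\ dx_k in dw. *)
Definition dform_coef l (M : manifold l) (w : two_form M) (phi : chart l M)
    (x : 'rV[K]_l) (i j k : 'I_l) : K :=
  partial i (form_mx w phi) x j k + partial j (form_mx w phi) x k i
    + partial k (form_mx w phi) x i j.

Definition closed_form l (M : manifold l) (w : two_form M) : Prop :=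
  forall phi, atlas phi -> forall x, cod phi x ->
    forall i j k, dform_coef w phi x i j k = 0.

Definition nondegenerate l (M : manifold l) (w : two_form M) : Prop :=
  forall (m : M) (u : tangent m), u <> 0 -> exists v : tangent m, w m u v <> 0.

Definition symplectic l (M : manifold l) (w : two_form M) : Prop :=
  [/\ analytic_form w, closed_form w & nondegenerate w].

Definition pullback l1 l2 (M : manifold l1) (N : manifold l2) (f : M -> N)
    (w : forall m : N, tangent m -> tangent m -> K)
    (m : M) (u v : tangent m) : K :=
  w (f m) (tangent_map f u) (tangent_map f v).

End Analytic.

(* Main.v *)
(* In a chart, linear changes of coordinates bring both forms to the same
   standard matrix at the given point, and a homothety makes all their
   derivatives at that point integral. Germs with integral derivatives are
   closed under products, composition, differentiation and integration in one
   variable, and they converge because |1/n!| grows at most geometrically.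
   Hence Moser's method can be run degree by degree without flows: if f pulls
   w1 back to w0 up to an error of order d, the error is closed, so it is d(al)
   with al integral of order d + 1; composing f with id + xi, where the
   contraction of the constant form with xi is -al, improves the order of the
   error to d + 1. Taylor coefficients stabilize, so the iteration has an
   integral limit, whose error vanishes to all orders and is therefore zero.
   The inverse germ is obtained in the same way from the iteration
   g -> id - (f - id) o g. *)

Require Import Defs.
From HB Require Import structures.
From mathcomp Require Import all_boot all_order all_algebra.
From mathcomp Require Import finmap fingroup perm generic_quotient ring_quotient.
From mathcomp Require Import all_classical.
From mathcomp Require Import reals topology normedtype summability.
From mathcomp Require Import ring lra zify.

Set Implicit Arguments.
Unset Strict Implicit.
Unset Printing Implicit Defensive.

Import Order.TTheory GRing.Theory Num.Theory.

Local Open Scope fset_scope.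
Local Open Scope ring_scope.

(** * Ultrametric fields and unconditional sums *)

(** Integration forces the use of derivatives at 0: the primitive of x^n is x^(n+1)/(n+1), whose
    denominators ruin every uniform bound on coefficients, whereas on derivatives integration in one
    variable only shifts the index. The error is not shown to be closed by differentiating the
    pull-back of a closed 2-form. Both forms receive a potential once; the error is then d of one
    pulled back potential minus the other potential, so that only the compatibility of d with
    pull-backs of 1-forms is used. The primitive found in this way is neither integral nor of high
    order, so the Poincare lemma is applied afresh to the error at every step. Solving for xi must
    not create denominators either: the constant form is normalized to a matrix whose inverse has
    entries 0, 1 and -1, which needs no square roots. The germ arguments hold over any field with an
    [ultranorm]; the p-adic numbers enter through one instance and through the translation between
    topological limits and the sums used here. *)

(* [uabs_fact] makes 1/n! grow at most geometrically, so that a power series all *)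
(* of whose derivatives at 0 are integral converges; it forces characteristic 0. *)
Record ultranorm (K : fieldType) := Ultranorm {
  uabs :> K -> rat;
  uabs_ge0 : forall x, 0 <= uabs x;
  uabs_eq0 : forall x, (uabs x == 0) = (x == 0);
  uabsM : forall x y, uabs (x * y) = uabs x * uabs y;
  uabsD : forall x y, uabs (x + y) <= Num.max (uabs x) (uabs y);
  uabs_complete : forall u : nat -> K,
    (forall e, 0 < e -> exists N, forall i j, (N <= i)%N -> (N <= j)%N ->
      uabs (u i - u j) < e) ->
    exists s, forall e, 0 < e -> exists N, forall i, (N <= i)%N ->
      uabs (s - u i) < e;
  uabs_small : forall e, 0 < e -> exists2 t, t != 0 & uabs t < e;
  uabs_fact : exists B, forall n, 1 <= B ^+ n * uabs n`!%:R }.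

(** Bernoulli's inequality for [q^-1 = 1 + h] makes [q^-1 ^+ n] grow at least linearly, and the
    archimedean property of the rationals gives [N]. *)
Lemma expr_vanish (q e : rat) : 0 <= q < 1 -> 0 < e ->
  exists N, forall n, (N <= n)%N -> q ^+ n < e.
Proof.
move=> /andP[q0 q1] e0.
have [->|qn0] := eqVneq q 0.
  by exists 1%N => -[|n] // _; rewrite exprS mul0r.
have {}q0 : 0 < q by rewrite lt_def qn0.
pose h := q^-1 - 1; have h0 : 0 < h by rewrite subr_gt0 invf_gt1.
have bern n : 1 + n%:R * h <= q^-1 ^+ n.
  elim: n => [|n IH]; first by rewrite mul0r addr0 expr0.
  rewrite exprS; apply: (@le_trans _ _ (q^-1 * (1 + n%:R * h))).
    have -> : q^-1 = 1 + h by rewrite /h; ring.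
    have : 0 <= n%:R * h * h by rewrite !mulr_ge0 ?ler0n // ltW.
    rewrite -natr1; lra.
  by rewrite ler_wpM2l // invr_ge0 ltW.
have [N hN] : exists N : nat, e^-1 / h < N%:R.
  exists (Num.bound (e^-1 / h)).
  by rewrite archi_boundP // divr_ge0 ?invr_ge0 ?ltW.
exists N => n Nn.
have e1 : e^-1 < q^-1 ^+ n.
  apply: lt_le_trans (bern n); rewrite ltr_pdivrMr // in hN.
  have : N%:R * h <= n%:R * h by rewrite ler_wpM2r ?ler_nat // ltW.
  lra.
by move: e1; rewrite exprVn ltf_pV2 ?qualifE /= ?exprn_gt0.
Qed.

Section Ultranorm.
Context (K : fieldType) (v : ultranorm K).
Implicit Types x y z : K.

Lemma uabs0 : v 0 = 0.
Proof. by apply/eqP; rewrite uabs_eq0. Qed.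

Lemma uabs_gt0 x : (0 < v x) = (x != 0).
Proof. by rewrite lt_def uabs_ge0 andbT uabs_eq0. Qed.

Lemma uabs1 : v 1 = 1.
Proof.
have v1 : v 1 != 0 by rewrite uabs_eq0 oner_neq0.
by apply: (mulfI v1); rewrite -uabsM !mulr1.
Qed.

Lemma uabsN x : v (- x) = v x.
Proof.
suff v1 : v (-1) = 1 by rewrite -mulN1r uabsM v1 mul1r.
have: v (-1) ^+ 2 = 1 by rewrite expr2 -uabsM mulrNN mulr1 uabs1.
by move/eqP; rewrite sqrp_eq1 ?uabs_ge0 // => /eqP.
Qed.

Lemma uabsBC x y : v (x - y) = v (y - x).
Proof. by rewrite -uabsN opprB. Qed.

Lemma uabsX x n : v (x ^+ n) = v x ^+ n.
Proof. by elim: n => [|n IH]; rewrite ?expr0 ?uabs1 // !exprS uabsM IH. Qed.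

Lemma uabsV x : v x^-1 = (v x)^-1.
Proof.
have [->|x0] := eqVneq x 0; first by rewrite invr0 uabs0 invr0.
have vx : v x != 0 by rewrite uabs_eq0.
by apply: (mulfI vx); rewrite -uabsM !divff // uabs1.
Qed.

Lemma uabsD_le x y (e : rat) : v x <= e -> v y <= e -> v (x + y) <= e.
Proof. by move=> xe ye; rewrite (le_trans (uabsD v _ _)) // ge_max xe. Qed.

Lemma uabsD_lt x y (e : rat) : v x < e -> v y < e -> v (x + y) < e.
Proof. by move=> xe ye; rewrite (le_lt_trans (uabsD v _ _)) // gt_max xe. Qed.

Lemma uabsB_le x y (e : rat) : v x <= e -> v y <= e -> v (x - y) <= e.
Proof. by move=> xe ye; rewrite uabsD_le // uabsN. Qed.

Lemma uabsB_lt x y (e : rat) : v x < e -> v y < e -> v (x - y) < e.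
Proof. by move=> xe ye; rewrite uabsD_lt // uabsN. Qed.

Lemma uabs_sum_le (I : Type) (r : seq I) (P : pred I) (F : I -> K) (e : rat) :
  0 <= e -> (forall i, P i -> v (F i) <= e) -> v (\sum_(i <- r | P i) F i) <= e.
Proof.
move=> e0 Fe; elim/big_ind: _ => //; first by rewrite uabs0.
by move=> *; apply: uabsD_le.
Qed.

Lemma uabs_sum_lt (I : eqType) (r : seq I) (F : I -> K) (e : rat) :
  0 < e -> (forall i, i \in r -> v (F i) < e) -> v (\sum_(i <- r) F i) < e.
Proof.
move=> e0 Fe; rewrite big_seq; elim/big_ind: _ => //; first by rewrite uabs0.
by move=> *; apply: uabsD_lt.
Qed.

Lemma uabs_nat n : v n%:R <= 1.
Proof.
elim: n => [|n IH]; first by rewrite uabs0.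
by rewrite -natr1 uabsD_le ?uabs1.
Qed.

Lemma fact_neq0 n : n`!%:R != 0 :> K.
Proof.
have [B /(_ n) HB] := uabs_fact v.
by apply: contraTneq HB => ->; rewrite uabs0 mulr0 -ltNge.
Qed.

Lemma natS_neq0 n : n.+1%:R != 0 :> K.
Proof. by have := fact_neq0 n.+1; rewrite factS natrM mulf_eq0 negb_or => /andP[]. Qed.

(* In the ultrametric setting smallness of the terms off a finite set already *)
(* controls every larger partial sum.                                         *)
Definition usum (I : choiceType) (u : I -> K) (s : K) : Prop :=
  forall e, 0 < e -> exists A : {fset I},
    (forall i, i \notin A -> v (u i) < e) /\ v (s - \sum_(i <- A) u i) < e.

Definition vanishing (I : choiceType) (w : I -> rat) : Prop :=
  forall e, 0 < e -> exists A : {fset I}, forall i, i \notin A -> w i < e.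

Section Sums.
Context (I J : choiceType).
Implicit Types u : I -> K.

Lemma sum_fset_diff u (A B : {fset I}) (e : rat) : 0 < e -> A `<=` B ->
  (forall i, i \notin A -> v (u i) < e) ->
  v (\sum_(i <- B) u i - \sum_(i <- A) u i) < e.
Proof.
move=> e0 AB uA; rewrite (big_fsetID _ (mem A)) /=.
have -> : [fset x | x in B & x \in A] = A.
  by apply/fsetP => x; rewrite !inE /= andbC andb_idr // => /(fsubsetP AB).
rewrite addrC addrK; apply: uabs_sum_lt => // i.
by rewrite !inE /= => /andP[_ iA]; exact: uA.
Qed.

Lemma usum_sup u s (e : rat) : usum u s -> 0 < e -> exists A : {fset I},
  (forall i, i \notin A -> v (u i) < e) /\
  forall B, A `<=` B -> v (s - \sum_(i <- B) u i) < e.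
Proof.
move=> us e0; have [A [uA sA]] := us e e0; exists A; split=> // B AB.
rewrite -(subrK (\sum_(i <- A) u i) s) -addrA; apply: uabsD_lt => //.
by rewrite uabsBC sum_fset_diff.
Qed.

Lemma usum_van u s : usum u s -> vanishing (fun i => v (u i)).
Proof. by move=> us e /us[A [uA _]]; exists A. Qed.

(** In a complete ultrametric field, terms tending to zero are summable: outside the finite set
    [A k] they are below 1/(k+1), so the partial sums over [A i] and [A j] are both close to the one
    over the union. *)
Lemma usum_ex u : vanishing (fun i => v (u i)) -> exists s, usum u s.
Proof.
move=> u0; pose e k : rat := k.+1%:R^-1.
have e0 k : 0 < e k by rewrite invr_gt0 ltr0Sn.
have [A uA] := choice (fun k => u0 _ (e0 k)).
pose S k := \sum_(i <- A k) u i.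
have van (d : rat) : 0 < d -> exists N, forall k, (N <= k)%N -> e k < d.
  move=> d0; exists (Num.bound d^-1) => k Nk.
  have dN : d^-1 < (Num.bound d^-1)%:R by rewrite archi_boundP // invr_ge0 ltW.
  rewrite /e invf_plt ?posrE //; apply: lt_le_trans dN _.
  by rewrite ler_nat (leq_trans Nk).
have SAB : forall (m : nat) (d : rat) (B : {fset I}), 0 < d -> e m < d -> A m `<=` B ->
    v (\sum_(i <- B) u i - S m) < d.
  by move=> m d B d0 kd AB; apply: sum_fset_diff => // i /uA /lt_trans; apply.
have [s Ss] : exists s, forall d, 0 < d -> exists N, forall i, (N <= i)%N ->
    v (s - S i) < d.
  apply: uabs_complete => d d0; have [N HN] := van d d0; exists N => i j iN jN.
  have -> : S i - S j = (\sum_(k <- A i `|` A j) u k - S j)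
     - (\sum_(k <- A i `|` A j) u k - S i) by ring.
  by apply: uabsB_lt; apply: SAB; rewrite ?fsubsetUl ?fsubsetUr ?HN.
exists s => d d0; have [N HN] := van d d0; have [N' HN'] := Ss d d0.
have kN : (N <= maxn N N')%N by rewrite leq_maxl.
exists (A (maxn N N')); split; last by rewrite HN' // leq_maxr.
by move=> i /uA /lt_trans; apply; exact: HN.
Qed.

Lemma usum_unique u s t : usum u s -> usum u t -> s = t.
Proof.
move=> us ut; apply/eqP; rewrite -subr_eq0 -(uabs_eq0 v) eq_le uabs_ge0 andbT.
apply/ler_addgt0Pr => e e0; rewrite add0r; have [A [_ sA]] := usum_sup us e0.
have [B [_ tB]] := usum_sup ut e0.
have -> : s - t = (s - \sum_(i <- A `|` B) u i) - (t - \sum_(i <- A `|` B) u i).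
  by ring.
by rewrite ltW // uabsB_lt // ?sA ?tB // ?fsubsetUl ?fsubsetUr.
Qed.

Lemma eq_usum u w s : u =1 w -> usum u s -> usum w s.
Proof. by move/funext->. Qed.

Lemma usumD u w s t : usum u s -> usum w t -> usum (fun i => u i + w i) (s + t).
Proof.
move=> us wt e e0; have [A [uA sA]] := usum_sup us e0.
have [B [wB tB]] := usum_sup wt e0; exists (A `|` B); split=> [i|].
  by rewrite !inE negb_or => /andP[iA iB]; rewrite uabsD_lt ?uA ?wB.
rewrite big_split /= opprD addrACA.
by rewrite uabsD_lt // ?sA ?tB // ?fsubsetUl ?fsubsetUr.
Qed.

Lemma usumZ u k s : usum u s -> usum (fun i => k * u i) (k * s).
Proof.
move=> us e e0; have k1 : 0 < 1 + v k by rewrite ltr_pwDl ?uabs_ge0.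
have [A [uA sA]] := us (e / (1 + v k)) (divr_gt0 e0 k1).
have le x : v x < e / (1 + v k) -> v (k * x) < e.
  rewrite ltr_pdivlMr // uabsM => xe; apply: le_lt_trans xe.
  by rewrite mulrC ler_wpM2l ?uabs_ge0 // lerDr.
exists A; split=> [i /uA/le//|]; rewrite -big_distrr -mulrBr; exact: le.
Qed.

Lemma usumB u w s t : usum u s -> usum w t -> usum (fun i => u i - w i) (s - t).
Proof.
move=> us /(usumZ (-1)) wt; rewrite -mulN1r.
by apply: eq_usum (usumD us wt) => i; rewrite mulN1r.
Qed.

Lemma usum_le u s (e : rat) : usum u s -> 0 <= e -> (forall i, v (u i) <= e) -> v s <= e.
Proof.
move=> us e0 ue; apply/ler_addgt0Pr => d d0.
have [A [_ sA]] := us d d0; rewrite -(subrK (\sum_(i <- A) u i) s).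
apply: uabsD_le; first by rewrite (le_trans (ltW sA)) // lerDr.
by apply: (@le_trans _ _ e); [exact: uabs_sum_le|rewrite lerDl ltW].
Qed.

Lemma usum_fin u (A : {fset I}) : (forall i, i \notin A -> u i = 0) ->
  usum u (\sum_(i <- A) u i).
Proof.
by move=> uA e e0; exists A; split=> [i /uA->|]; rewrite ?subrr uabs0.
Qed.

Lemma usum1 u i0 : (forall i, i != i0 -> u i = 0) -> usum u (u i0).
Proof.
move=> u0; have := @usum_fin u [fset i0]; rewrite big_seq_fset1; apply=> i.
by rewrite !inE; exact: u0.
Qed.

Lemma usum_inj (h : I -> J) (u : J -> K) s : injective h ->
  (forall j, (forall i, h i != j) -> u j = 0) ->
  usum (u \o h) s -> usum u s.
Proof.
move=> hi u0 us e e0; have [A [uA sA]] := us e e0.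
exists [fset h i | i in A]; split=> [j jA|].
  have [[i hij]|nj] := pselect (exists i, h i = j).
    by rewrite -hij uA //; apply: contraNN jA => iA; rewrite -hij in_imfset.
  by rewrite u0 ?uabs0 // => i; apply/eqP => hij; apply: nj; exists i.
by rewrite big_imfset //= => i j _ _; exact: hi.
Qed.
End Sums.

(** Smallness off a finite rectangle makes both iterated sums agree, up to [e], with one finite
    double sum. Summability of the column totals is part of the conclusion. *)
Lemma usum_fubini (I J : choiceType) (u : I -> J -> K) (s : I -> K) (t : J -> K)
    (S : K) :
  (forall e, 0 < e -> exists (A : {fset I}) (B : {fset J}), forall i j,
    (i \notin A) || (j \notin B) -> v (u i j) < e) ->
  (forall i, usum (u i) (s i)) -> (forall j, usum (u^~ j) (t j)) ->
  usum s S -> usum t S.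
Proof.
move=> u0 us ut sS e e0; have [A0 [B uAB]] := u0 e e0.
have [A1 [_ SA]] := usum_sup sS e0; pose A := A0 `|` A1.
have {}uAB i j : (i \notin A) || (j \notin B) -> v (u i j) < e.
  case/orP => ij; apply: uAB; last by rewrite ij orbT.
  by apply/orP; left; apply: contraNN ij; rewrite inE => ->.
have {}SA : v (S - \sum_(i <- A) s i) < e by rewrite SA ?fsubsetUr.
(* Stated for arbitrary index types because it is applied once to rows and once to columns. *)
have part (I' J' : choiceType) (w : I' -> J' -> K) (x : I' -> K) (A' : {fset I'})
    (B' : {fset J'}) : (forall i j, (j \notin B') -> v (w i j) < e) ->
    (forall i, usum (w i) (x i)) ->
    v (\sum_(i <- A') x i - \sum_(i <- A') \sum_(j <- B') w i j) < e.
  move=> wB wx; rewrite -sumrB; apply: uabs_sum_lt => // i _.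
  have [C [_ xC]] := usum_sup (wx i) e0.
  rewrite -(subrK (\sum_(j <- B' `|` C) w i j) (x i)) -addrA uabsD_lt //.
    by rewrite xC ?fsubsetUr.
  by apply: sum_fset_diff; rewrite ?fsubsetUl // => j; exact: wB.
have H1 := part I J u s A B (fun i j jB => uAB i j (introT orP (or_intror jB))) us.
have H2 := part J I (fun j i => u i j) t B A
  (fun j i iA => uAB i j (introT orP (or_introl iA))) ut.
exists B; split.
  move=> j jB; have [C [_ tC]] := usum_sup (ut j) e0.
  rewrite -(subrK (\sum_(i <- C) u i j) (t j)) uabsD_lt ?tC //.
  by apply: uabs_sum_lt => // i _; rewrite uAB // jB orbT.
rewrite exchange_big in H2.
set X := \sum_(i <- A) s i in H1 SA; set Y := \sum_(i <- A) _ in H1.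
have -> : S - \sum_(i <- B) t i = (S - X) + (X - Y) - (\sum_(i <- B) t i - Y).
  by ring.
by rewrite uabsB_lt // uabsD_lt.
Qed.

End Ultranorm.

(** * Convergent power series *)

Notation mindex l := {ffun 'I_l -> nat}.

Section MultiIndex.
Context (l : nat).
Implicit Types a b : mindex l.

Definition mdeg a : nat := (\sum_i a i)%N.
Definition madd a b : mindex l := [ffun i => (a i + b i)%N].
Definition munit (i : 'I_l) : mindex l := [ffun j => (j == i : nat)].
Definition mzero : mindex l := [ffun=> 0%N].

Lemma mdegD a b : mdeg (madd a b) = (mdeg a + mdeg b)%N.
Proof. by rewrite /mdeg -big_split; apply: eq_bigr => i _; rewrite ffunE. Qed.

Lemma mdeg_unit i : mdeg (munit i) = 1%N.
Proof.
rewrite /mdeg (bigD1 i) //= ffunE eqxx big1 ?addn0 // => j ji.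
by rewrite ffunE (negbTE ji).
Qed.

Lemma mdeg0 : mdeg mzero = 0%N.
Proof. by rewrite /mdeg big1 // => i _; rewrite ffunE. Qed.

Lemma mdeg_eq0 a : mdeg a = 0%N -> a = mzero.
Proof.
move=> /eqP; rewrite sum_nat_eq0 => /forallP a0.
by apply/ffunP => i; rewrite ffunE; apply/eqP; exact: a0.
Qed.

Lemma maddA a b c : madd a (madd b c) = madd (madd a b) c.
Proof. by apply/ffunP => i; rewrite !ffunE addnA. Qed.

Lemma maddC a b : madd a b = madd b a.
Proof. by apply/ffunP => i; rewrite !ffunE addnC. Qed.

Lemma madd_inj b : injective (madd^~ b).
Proof.
move=> a a' /ffunP E; apply/ffunP => i; move: (E i).
by rewrite !ffunE => /addIn.
Qed.

(** Inductions on the order of a derivative peel off one differentiation through this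
    decomposition. *)
Lemma mdegSP a n : mdeg a = n.+1 ->
  exists i b, a = madd b (munit i) /\ mdeg b = n.
Proof.
move=> an; have [i ai] : exists i, (0 < a i)%N.
  apply/existsP; apply: contraT; rewrite negb_exists => /forallP a0.
  suff : mdeg a = 0%N by rewrite an.
  by rewrite /mdeg big1 // => i _; apply/eqP; rewrite -leqn0 leqNgt a0.
pose b : mindex l := [ffun j => (a j - (j == i))%N].
have ab : a = madd b (munit i).
  apply/ffunP => j; rewrite !ffunE subnK //; by case: eqP => // ->.
by exists i, b; split=> //; move: an; rewrite ab mdegD mdeg_unit addn1 => -[].
Qed.

(** Converts decay in the degree into [vanishing], which speaks of finite sets of indices. *)
Lemma mdeg_fin N : exists A : {fset mindex l}, forall a, a \notin A -> (N < mdeg a)%N.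
Proof.
pose h (g : {ffun 'I_l -> 'I_N.+1}) : mindex l := [ffun i => g i : nat].
exists [fset a in map h (enum {: {ffun 'I_l -> 'I_N.+1}})] => a.
rewrite inE /= ltnNge; apply: contraNN => aN.
apply/mapP; exists [ffun i => inord (a i)]; first by rewrite mem_enum.
apply/ffunP => i; rewrite !ffunE inordK // ltnS (leq_trans _ aN) //.
by rewrite /mdeg (bigD1 i) //= leq_addr.
Qed.

End MultiIndex.

Section Analytic.
Context (K : fieldType) (v : ultranorm K).

Definition mono l (a : mindex l) (x : 'rV[K]_l) : K := \prod_i x 0 i ^+ a i.

Definition disc l (r : rat) (x : 'rV[K]_l) : Prop := forall i, v (x 0 i) <= r.

Lemma monoD l (a b : mindex l) x : mono (madd a b) x = mono a x * mono b x.
Proof.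
by rewrite /mono -big_split; apply: eq_bigr => i _; rewrite ffunE exprD.
Qed.

Lemma mono_unit l (i : 'I_l) x : mono (munit i) x = x 0 i.
Proof.
rewrite /mono (bigD1 i) //= ffunE eqxx big1 ?mulr1 ?expr1 // => j ji.
by rewrite ffunE (negbTE ji).
Qed.

Lemma mono0 l x : mono (mzero l) x = 1.
Proof. by rewrite /mono big1 // => i _; rewrite ffunE. Qed.

Lemma uabs_prod (I : Type) (s : seq I) (F : I -> K) :
  v (\prod_(i <- s) F i) = \prod_(i <- s) v (F i).
Proof. exact: (big_morph v (uabsM v) (uabs1 v)). Qed.

Lemma uabs_mono l (a : mindex l) x r : disc r x -> v (mono a x) <= r ^+ mdeg a.
Proof.
move=> xr; rewrite /mono uabs_prod /mdeg expr_sum.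
apply: ler_prod => i _; rewrite uabs_ge0 uabsX /=.
by rewrite lerXn2r ?qualifE /= ?uabs_ge0 // (le_trans _ (xr i)) ?uabs_ge0.
Qed.

Lemma disc_le l (r r' : rat) (x : 'rV[K]_l) : r <= r' -> disc r x -> disc r' x.
Proof. by move=> rr xr i; exact: le_trans (xr i) rr. Qed.

Lemma disc0 l (r : rat) : 0 <= r -> disc r (0 : 'rV[K]_l).
Proof. by move=> r0 i; rewrite mxE uabs0. Qed.

Lemma discD l (r : rat) (x y : 'rV[K]_l) : disc r x -> disc r y -> disc r (x + y).
Proof. by move=> xr yr i; rewrite mxE uabsD_le. Qed.

(** [C] bounds the Gauss norm for radius [r]; the second clause is convergence on the closed
    polydisc, boundary included. *)
Definition ser l (r C : rat) (c : mindex l -> K) : Prop :=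
  (forall a, v (c a) * r ^+ mdeg a <= C) /\
  vanishing (fun a => v (c a) * r ^+ mdeg a).

Definition expands l (r : rat) (c : mindex l -> K) (f : 'rV[K]_l -> K) : Prop :=
  forall x, disc r x -> usum v (fun a => c a * mono a x) (f x).

Definition an l (r C : rat) (f : 'rV[K]_l -> K) : Prop :=
  exists2 c, ser r C c & expands r c f.

Lemma ser_geom l (r C R : rat) (c : mindex l -> K) : 0 <= C -> 0 <= R -> 0 <= r ->
  R * r < 1 -> (forall a, v (c a) <= C * R ^+ mdeg a) -> ser r C c.
Proof.
move=> C0 R0 r0 Rr cC.
have cr a : v (c a) * r ^+ mdeg a <= C * (R * r) ^+ mdeg a.
  by rewrite exprMn mulrA ler_wpM2r ?exprn_ge0.
have Rr0 : 0 <= R * r by rewrite mulr_ge0.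
split=> [a|e e0].
  by rewrite (le_trans (cr a)) // ler_piMr // exprn_ile1 // ltW.
have C1 : 0 < 1 + C by rewrite ltr_pwDl.
have [N HN] := @expr_vanish (R * r) _ (introT andP (conj Rr0 Rr)) (divr_gt0 e0 C1).
have [A HA] := mdeg_fin l N; exists A => a /HA /ltnW /HN.
rewrite ltr_pdivlMr // => lt; apply: le_lt_trans (cr a) _; apply: le_lt_trans lt.
by rewrite mulrC ler_wpM2l ?exprn_ge0 // lerDr.
Qed.

Lemma ser_restrict l (r r' C : rat) (c : mindex l -> K) : 0 <= r' <= r -> ser r C c ->
  ser r' C c.
Proof.
move=> /andP[r0 rr] [cC c0].
have le a : v (c a) * r' ^+ mdeg a <= v (c a) * r ^+ mdeg a.
  by rewrite ler_wpM2l ?uabs_ge0 // lerXn2r ?qualifE //= (le_trans r0).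
split=> [a|e /c0[A HA]]; first exact: le_trans (le a) (cC a).
by exists A => a /HA; exact: le_lt_trans.
Qed.

Lemma an_restrict l (r r' C : rat) (f : 'rV[K]_l -> K) : 0 <= r' <= r -> an r C f ->
  an r' C f.
Proof.
move=> rr [c cs cf]; exists c; first exact: ser_restrict cs.
by move=> x xr; apply: cf; apply: disc_le xr; case/andP: rr.
Qed.

Lemma an_le l (r C C' : rat) (f : 'rV[K]_l -> K) : C <= C' -> an r C f -> an r C' f.
Proof.
by move=> CC [c [cC c0] cf]; exists c => //; split=> // a; exact: le_trans (cC a) CC.
Qed.

Lemma eq_an l (r C : rat) (f g : 'rV[K]_l -> K) : (forall x, disc r x -> f x = g x) ->
  an r C f -> an r C g.
Proof. by move=> fg [c cs cf]; exists c => // x xr; rewrite -fg //; exact: cf. Qed.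

Lemma ser_term l (r C : rat) (c : mindex l -> K) x a : ser r C c -> disc r x ->
  v (c a * mono a x) <= v (c a) * r ^+ mdeg a.
Proof. by move=> _ xr; rewrite uabsM ler_wpM2l ?uabs_ge0 // uabs_mono. Qed.

Lemma ser_ge0 l (r C : rat) (c : mindex l -> K) : ser r C c -> 0 <= C.
Proof.
move=> [/(_ (mzero l)) c0 _]; apply: le_trans c0.
by rewrite mdeg0 mulr1 uabs_ge0.
Qed.

Lemma ser_usum l (r C : rat) (c : mindex l -> K) x : ser r C c -> disc r x ->
  exists s, usum v (fun a => c a * mono a x) s.
Proof.
move=> cs xr; apply: usum_ex => e /cs.2[A HA]; exists A => a /HA.
by apply: le_lt_trans; exact: ser_term cs xr.
Qed.

Lemma an_bound l (r C : rat) (f : 'rV[K]_l -> K) x : an r C f -> disc r x -> v (f x) <= C.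
Proof.
move=> [c cs cf] xr; apply: usum_le (cf x xr) (ser_ge0 cs) _ => a.
exact: le_trans (ser_term a cs xr) (cs.1 a).
Qed.

Lemma an_ge0 l (r C : rat) (f : 'rV[K]_l -> K) : an r C f -> 0 <= C.
Proof. by case=> c /ser_ge0. Qed.

(* Products and composites of power series are special cases. *)
Lemma an_usum (I : choiceType) l (r C : rat) (w : I -> rat) (F : I -> 'rV[K]_l -> K) f :
  0 < r -> 0 <= C -> vanishing w -> (forall i, w i <= C) ->
  (forall i, an r (w i) (F i)) ->
  (forall x, disc r x -> usum v (F^~ x) (f x)) -> an r C f.
Proof.
move=> r0 C0 w0 wC anF Ff.
have /choice[c cP] : forall i, exists c, ser r (w i) c /\ expands r c (F i).
  by move=> i; have [c ? ?] := anF i; exists c.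
have rn n : 0 < r ^+ n by rewrite exprn_gt0.
have le i a : v (c i a) <= w i / r ^+ mdeg a.
  by rewrite ler_pdivlMr //; exact: (cP i).1.1.
(* The coefficient of [a] in the total is the sum over [i] of the coefficients of [a] in the
   [F i]. *)
have /choice[t tP] : forall a, exists t, usum v (c^~ a) t.
  move=> a; apply: usum_ex => e e0.
  have [A HA] := w0 _ (mulr_gt0 e0 (rn (mdeg a))); exists A => i /HA wi.
  by apply: le_lt_trans (le i a) _; rewrite ltr_pdivrMr.
(* Off [A] the bounds [w i] are small; each of the finitely many [i] in [A] contributes the finite
   set given by the decay of its own series. *)
have joint e : 0 < e -> exists (A : {fset I}) (B : {fset mindex l}), forall i a,
    (i \notin A) || (a \notin B) -> v (c i a) * r ^+ mdeg a < e.
  move=> e0; have [A HA] := w0 _ e0.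
  have /choice[B HB] := fun i => (cP i).1.2 e e0.
  exists A, (\bigcup_(i <- A) B i) => i a; case: (boolP (i \in A)) => [iA /= aB|iA _].
    apply: HB; apply: contraNN aB => aB.
    by apply/bigfcupP; exists i; rewrite ?iA.
  by apply: le_lt_trans (HA i iA); exact: (cP i).1.1.
exists t; first split=> [a|e e0].
- rewrite -ler_pdivlMr //; apply: usum_le (tP a) _ _; first by rewrite divr_ge0 // ltW.
  by move=> i; apply: le_trans (le i a) _; rewrite ler_wpM2r // invr_ge0 ltW.
(* [usum_le] yields a weak inequality only, hence e/2 to reach a strict one. *)
- have [A [B AB]] := joint (e / 2) (divr_gt0 e0 (ltr0Sn _ 1)); exists B => a aB.
  apply: (@le_lt_trans _ _ (e / 2)); last by rewrite ltr_pdivrMr // ltr_pMr // ltr1n.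
  rewrite -ler_pdivlMr //; apply: usum_le (tP a) _ _.
    by rewrite divr_ge0 ?ltW // divr_gt0.
  by move=> i; rewrite ler_pdivlMr // ltW // AB // aB orbT.
move=> x xr; apply: (@usum_fubini _ _ I _ (fun i a => c i a * mono a x) (F^~ x)).
- move=> e /joint[A [B AB]]; exists A, B => i a /AB; apply: le_lt_trans.
  exact: ser_term (cP i).1 xr.
- by move=> i; exact: (cP i).2.
- move=> a; have := usumZ (mono a x) (tP a); rewrite mulrC.
  by apply: eq_usum => i; rewrite mulrC.
- exact: Ff.
Qed.

Lemma an_monoM l (r C : rat) (f : 'rV[K]_l -> K) b : 0 <= r -> an r C f ->
  an r (r ^+ mdeg b * C) (fun x => mono b x * f x).
Proof.
move=> r0 [c cs cf].
(* The coefficients shifted by [b]; the test excludes the indices not above [b], where truncated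
   subtraction would give a wrong value. *)
pose d (a : mindex l) := if `[< exists a', madd a' b = a >]
  then c [ffun i => (a i - b i)%N] else 0.
have dE a : d (madd a b) = c a.
  rewrite /d; case: asboolP => [_|[]]; last by exists a.
  by congr c; apply/ffunP => i; rewrite !ffunE addnK.
have d0 a : (forall a', madd a' b != a) -> d a = 0.
  by move=> na; rewrite /d; case: asboolP => // -[a' /eqP]; rewrite (negbTE (na a')).
have rb : 0 <= r ^+ mdeg b by rewrite exprn_ge0.
exists d; first split=> [a|e e0].
- rewrite /d; case: asboolP => [[a' <-]|_].
    rewrite (_ : [ffun i => _] = a'); last first.
      by apply/ffunP => i; rewrite !ffunE addnK.
    by rewrite mdegD exprD mulrA mulrC ler_wpM2l //; exact: cs.1.
  by rewrite uabs0 mul0r mulr_ge0 // (ser_ge0 cs).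
- have e1 : 0 < e / (1 + r ^+ mdeg b) by rewrite divr_gt0 // ltr_pwDl.
  have [A HA] := cs.2 _ e1; exists [fset madd a b | a in A] => a aA.
  have [[a' aE]|na] := pselect (exists a', madd a' b = a); last first.
    rewrite d0 ?uabs0 ?mul0r // => a'; apply/eqP => E; apply: na; by exists a'.
  rewrite -aE dE mdegD exprD mulrA.
  have: v (c a') * r ^+ mdeg a' < e / (1 + r ^+ mdeg b).
    by apply: HA; apply: contraNN aA => a'A; apply/imfsetP; exists a'.
  rewrite ltr_pdivlMr ?ltr_pwDl //; apply: le_lt_trans.
  by rewrite ler_wpM2l ?lerDr // mulr_ge0 ?uabs_ge0 ?exprn_ge0.
move=> x xr; apply: (usum_inj (@madd_inj _ b)).
  by move=> a na; rewrite d0 ?mul0r.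
have := usumZ (mono b x) (cf x xr); apply: eq_usum => a /=.
by rewrite dE monoD; ring.
Qed.

Lemma an1 l (r : rat) : 0 <= r -> @an l r 1 (fun=> 1).
Proof.
move=> r0; exists (fun a => (a == mzero l)%:R); first split=> [a|e e0].
- by case: eqP => [->|_]; rewrite ?mdeg0 ?mulr1 ?uabs1 ?uabs0 ?mul0r.
- exists [fset mzero l] => a; rewrite inE => /negbTE->.
  by rewrite uabs0 mul0r.
move=> x _; have := @usum1 _ v _ (fun a => (a == mzero l)%:R * mono a x) (mzero l).
by rewrite eqxx mono0 mulr1; apply=> a /negbTE->; rewrite mul0r.
Qed.

Lemma an_mono l (r : rat) b : 0 <= r -> @an l r (r ^+ mdeg b) (mono b).
Proof.
move=> r0; have := an_monoM b r0 (an1 l r0); rewrite mulr1.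
by apply: eq_an => x _; rewrite mulr1.
Qed.

Lemma an_coord l (r : rat) (i : 'I_l) : 0 <= r -> an r r (fun x => x 0 i).
Proof.
move=> r0; have := an_mono (munit i) r0; rewrite mdeg_unit expr1.
by apply: eq_an => x _; rewrite mono_unit.
Qed.

Lemma anZ l (r C : rat) k (f : 'rV[K]_l -> K) : 0 <= r -> an r C f ->
  an r (v k * C) (fun x => k * f x).
Proof.
move=> r0 [c cs cf]; exists (fun a => k * c a); first split=> [a|e e0].
- by rewrite uabsM -mulrA ler_wpM2l ?uabs_ge0 //; exact: cs.1.
- have k1 : 0 < 1 + v k by rewrite ltr_pwDl ?uabs_ge0.
  have [A HA] := cs.2 _ (divr_gt0 e0 k1); exists A => a /HA.
  rewrite ltr_pdivlMr //; apply: le_lt_trans; rewrite uabsM -mulrA mulrC.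
  by rewrite ler_wpM2l ?lerDr // mulr_ge0 ?uabs_ge0 ?exprn_ge0.
by move=> x /cf /(usumZ k); apply: eq_usum => a; rewrite mulrA.
Qed.

Lemma anD l (r C : rat) (f g : 'rV[K]_l -> K) : an r C f -> an r C g ->
  an r C (fun x => f x + g x).
Proof.
move=> [c cs cf] [d ds dg]; exists (fun a => c a + d a).
  split=> [a|e e0].
    have [r0|/ltW r0] := lerP 0 (r ^+ mdeg a).
      apply: le_trans (ler_wpM2r r0 (uabsD v _ _)) _.
      by rewrite maxr_pMl // ge_max cs.1 ds.1.
    apply: le_trans (ser_ge0 cs); by rewrite mulr_ge0_le0 ?uabs_ge0.
  have [A HA] := cs.2 _ e0; have [B HB] := ds.2 _ e0.
  exists (A `|` B) => a; rewrite inE negb_or => /andP[/HA ca /HB da].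
  have [r0|r0] := lerP 0 (r ^+ mdeg a).
    apply: le_lt_trans (ler_wpM2r r0 (uabsD v _ _)) _.
    by rewrite maxr_pMl // gt_max ca.
  by apply: le_lt_trans e0; rewrite mulr_ge0_le0 ?uabs_ge0 // ltW.
move=> x xr; apply: eq_usum (usumD (cf x xr) (dg x xr)) => a.
by rewrite mulrDl.
Qed.

Lemma anM l (r C D : rat) (f g : 'rV[K]_l -> K) : 0 < r -> an r C f -> an r D g ->
  an r (C * D) (fun x => f x * g x).
Proof.
move=> r0 anf [d ds dg]; have C0 := an_ge0 anf; have D0 := ser_ge0 ds.
have r0' := ltW r0.
apply: (@an_usum _ _ _ _ (fun b => v (d b) * (r ^+ mdeg b * C))
  (fun b x => d b * (mono b x * f x))) => //.
- exact: mulr_ge0.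
- move=> e e0; have C1 : 0 < 1 + C by rewrite ltr_pwDl.
  have [A HA] := ds.2 _ (divr_gt0 e0 C1); exists A => a /HA.
  rewrite ltr_pdivlMr // mulrA; apply: le_lt_trans.
  by rewrite ler_wpM2l ?lerDr // mulr_ge0 ?uabs_ge0 ?exprn_ge0.
- by move=> b; rewrite mulrA [C * D]mulrC ler_wpM2r //; exact: ds.1.
- by move=> b; apply: anZ => //; exact: an_monoM.
move=> x /dg /(usumZ (f x)); apply: eq_usum => b /=; ring.
Qed.

Lemma an_monoc l m (r R : rat) (f : 'rV[K]_l -> 'rV[K]_m) b : 0 < r -> 0 <= R ->
  (forall j, an r R (fun x => f x 0 j)) ->
  an r (R ^+ mdeg b) (fun x => mono b (f x)).
Proof.
move=> r0 R0 anf; rewrite /mono /mdeg expr_sum.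
have anX j n : an r (R ^+ n) (fun x => f x 0 j ^+ n).
  elim: n => [|n IH]; first by apply: eq_an (an1 l (ltW r0)) => x _; rewrite expr0.
  rewrite exprS; apply: eq_an (anM r0 (anf j) IH) => x _; by rewrite exprS.
elim: (index_enum _) => [|i s IH].
  by rewrite big_nil; apply: eq_an (an1 l (ltW r0)) => x _; rewrite big_nil.
rewrite big_cons; apply: eq_an (anM r0 (anX i (b i)) IH) => x _.
by rewrite big_cons.
Qed.

Lemma an_comp l m (r R C : rat) (f : 'rV[K]_l -> 'rV[K]_m) (g : 'rV[K]_m -> K) :
  0 < r -> 0 <= R -> (forall j, an r R (fun x => f x 0 j)) -> an R C g ->
  an r C (g \o f).
Proof.
move=> r0 R0 anf [d ds dg].
apply: (@an_usum _ _ _ _ (fun b => v (d b) * R ^+ mdeg b)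
  (fun b x => d b * mono b (f x))) => //.
- exact: ser_ge0 ds.
- exact: ds.2.
- exact: ds.1.
- by move=> b; apply: anZ; [exact: ltW|exact: an_monoc].
by move=> x xr /=; apply: dg => j; exact: an_bound (anf j) xr.
Qed.

Lemma an_cst l (r : rat) k : 0 <= r -> @an l r (v k) (fun=> k).
Proof.
move=> r0; have := anZ k r0 (an1 l r0); rewrite mulr1.
by apply: eq_an => x _; rewrite mulr1.
Qed.

(** Every point of an ultrametric disc is a centre of it, so neither the radius nor the bound
    changes. *)
Lemma an_recenter l (r C : rat) (f : 'rV[K]_l -> K) x : 0 < r -> disc r x -> an r C f ->
  an r C (fun h => f (x + h)).
Proof.
move=> r0 xr anf.
apply: (@an_comp _ _ _ _ _ (fun h => x + h) f r0 (ltW r0) _ anf) => j.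
apply: (@eq_an _ _ _ (fun h : 'rV[K]_l => x 0 j + h 0 j)) => [h _|].
  by rewrite mxE.
apply: anD; last exact: an_coord (ltW r0).
exact: an_le (xr j) (an_cst _ _ (ltW r0)).
Qed.

End Analytic.

(** * Partial derivatives *)

Section Derivatives.
Context (K : fieldType) (v : ultranorm K).
Local Notation disc := (disc v).
Local Notation an := (an v).
Local Notation ser := (ser v).
Local Notation expands := (expands v).

Lemma usum_sum (I : choiceType) (J : Type) (s : seq J) (u : J -> I -> K) (t : J -> K) :
  (forall j, usum v (u j) (t j)) ->
  usum v (fun i => \sum_(j <- s) u j i) (\sum_(j <- s) t j).
Proof.
move=> ut; elim: s => [|j s IH].
  rewrite big_nil => e e0; exists fset0.
  by split=> [i _|]; rewrite ?big_nil ?subrr uabs0.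
by rewrite big_cons; apply: eq_usum (usumD (ut j) IH) => i; rewrite big_cons.
Qed.

Definition axis l (i : 'I_l) : 'rV[K]_l := delta_mx 0 i.

Lemma axisE l (i j : 'I_l) : axis i 0 j = (j == i)%:R.
Proof. by rewrite mxE eqxx. Qed.

Lemma disc_axis l (i : 'I_l) t (r : rat) : 0 <= r -> v t <= r -> disc r (t *: axis i).
Proof.
move=> r0 tr j; rewrite mxE axisE; case: eqP; rewrite ?mulr1 // mulr0 uabs0 //.
Qed.

(* A quadratic remainder is imposed: it makes the algebra of derivatives *)
(* immediate, and analytic functions satisfy it.                         *)
Definition has_pd l (i : 'I_l) (f : 'rV[K]_l -> K) x d : Prop :=
  exists C r : rat, 0 < r /\ forall t, v t <= r ->
    v (f (x + t *: axis i) - f x - t * d) <= C * v t ^+ 2.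

(** Made total by choice, with default value 0 where no derivative exists. *)
Definition pd l (i : 'I_l) (f : 'rV[K]_l -> K) x : K :=
  if pselect (exists d, has_pd i f x d) is left p then projT1 (cid p) else 0.

(** Both remainders are quadratic in [t] while [t * (d - d')] is linear, and [uabs_small] supplies
    arbitrarily small nonzero [t]. *)
Lemma has_pd_unique l (i : 'I_l) f x d d' :
  has_pd i f x d -> has_pd i f x d' -> d = d'.
Proof.
move=> [C [r [r0 H]]] [C' [r' [r'0 H']]]; apply/eqP; rewrite -subr_eq0.
rewrite -(uabs_eq0 v) eq_le uabs_ge0 andbT; apply/ler_addgt0Pr => e e0; rewrite add0r.
(* The constants in [has_pd] may have any sign; [D] is positive and dominates both. *)
pose D := 1 + `|C| + `|C'|.
have D0 : 0 < D by rewrite /D; have := normr_ge0 C; have := normr_ge0 C'; lra.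
have [t t0] : exists2 t, t != 0 & v t < Num.min (Num.min r r') (e / D).
  by apply: uabs_small; rewrite !lt_min r0 r'0 divr_gt0.
rewrite !lt_min => /andP[/andP[/ltW tr /ltW tr']]; rewrite ltr_pdivlMr // => te.
have vt : 0 < v t by rewrite uabs_gt0.
have CD : C <= D by rewrite /D; have := ler_norm C; have := normr_ge0 C'; lra.
have CD' : C' <= D by rewrite /D; have := ler_norm C'; have := normr_ge0 C; lra.
apply: le_trans (ltW te); rewrite -(ler_pM2l vt) -uabsM.
have -> : t * (d - d') = (f (x + t *: axis i) - f x - t * d')
  - (f (x + t *: axis i) - f x - t * d) by ring.
have -> : v t * (v t * D) = D * v t ^+ 2 by ring.
apply: uabsB_le.
  by apply: le_trans (H' t tr') _; rewrite ler_wpM2r // exprn_ge0 // ltW.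
by apply: le_trans (H t tr) _; rewrite ler_wpM2r // exprn_ge0 // ltW.
Qed.

Lemma has_pdP l (i : 'I_l) f x d : has_pd i f x d -> pd i f x = d.
Proof.
move=> fd; rewrite /pd; case: pselect => [p|[]]; last by exists d.
exact: has_pd_unique (projT2 (cid p)) fd.
Qed.

(** Coefficients of the formal derivative in the variable [i]. *)
Definition dser l (i : 'I_l) (c : mindex l -> K) (a : mindex l) : K :=
  (a i).+1%:R * c (madd a (munit i)).

(** Cauchy's estimate: integers have absolute value at most 1, so only the shift of the degree by
    one costs a factor 1/r. *)
Lemma ser_dser l (i : 'I_l) r C c : 0 < r -> ser r C c -> ser r (C / r) (dser i c).
Proof.
move=> r0 [cC c0].
have le a : v (dser i c a) * r ^+ mdeg a <=
    v (c (madd a (munit i))) * r ^+ mdeg (madd a (munit i)) / r.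
  rewrite mdegD mdeg_unit addn1 exprSr !mulrA mulfK ?gt_eqF //.
  rewrite ler_wpM2r ?exprn_ge0 ?(ltW r0) //; rewrite /dser uabsM.
  by rewrite ler_piMl ?uabs_ge0 // uabs_nat.
split=> [a|e e0].
  by apply: le_trans (le a) _; rewrite ler_wpM2r ?invr_ge0 ?(ltW r0).
have [A HA] := c0 _ (mulr_gt0 e0 r0).
have [N HN] : exists N, forall a, (N < mdeg a)%N -> a \notin A.
  exists (\max_(a <- A) mdeg a)%N => a; apply: contraTN => aA.
  by rewrite -leqNgt leq_bigmax_seq.
have [B HB] := mdeg_fin l N; exists B => a /HB aN.
apply: le_lt_trans (le a) _; rewrite ltr_pdivrMr // HA // HN //.
by rewrite mdegD mdeg_unit addn1 ltnW.
Qed.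

(** The second order remainder of x^n is at most |t|^2 r^(n-2); multiplying by r^2 avoids negative
    exponents for n < 2. *)
Lemma power_remainder (r : rat) (x t : K) n : 0 <= r -> v x <= r -> v t <= r ->
  v ((x + t) ^+ n - x ^+ n - n%:R * x ^+ n.-1 * t) * r ^+ 2 <= v t ^+ 2 * r ^+ n.
Proof.
move=> r0 xr tr; elim: n => [|n IH].
  by rewrite !expr0 subrr !mul0r subr0 uabs0 mul0r mulr_ge0 ?exprn_ge0 ?uabs_ge0.
set E := _ - _ - _ in IH *.
(* The remainder for n + 1 is x + t times the one for n, plus n x^(n-1) t^2; for n = 0 the truncated
   exponent is harmless, its coefficient being 0. *)
have -> : (x + t) ^+ n.+1 - x ^+ n.+1 - n.+1%:R * x ^+ n * t =
    (x + t) * E + n%:R * x ^+ n.-1 * t ^+ 2.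
  rewrite /E; case: (n) => [|m]; rewrite /= -!natr1 !exprS ?expr0; ring.
apply: le_trans (ler_wpM2r (exprn_ge0 2 r0) (uabsD v _ _)) _.
rewrite maxr_pMl ?exprn_ge0 // ge_max; apply/andP; split.
  have -> : v t ^+ 2 * r ^+ n.+1 = r * (v t ^+ 2 * r ^+ n) by rewrite [r ^+ n.+1]exprS; ring.
  rewrite uabsM -mulrA.
  apply: ler_pM => //; [exact: uabs_ge0| |exact: uabsD_le].
  by rewrite mulr_ge0 ?exprn_ge0 ?uabs_ge0.
rewrite !uabsM !uabsX; case: n {IH E} => [|n].
  by rewrite uabs0 !mul0r mulr_ge0 ?exprn_ge0 ?uabs_ge0.
rewrite /= [_ * v t ^+ 2]mulrC -mulrA ler_wpM2l ?exprn_ge0 ?uabs_ge0 //.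
rewrite (_ : r ^+ n.+2 = r ^+ n * r ^+ 2); last by rewrite -exprD addn2.
rewrite ler_wpM2r ?exprn_ge0 //.
apply: (@le_trans _ _ (1 * v x ^+ n)).
  by rewrite ler_wpM2r ?exprn_ge0 ?uabs_ge0 // uabs_nat.
by rewrite mul1r lerXn2r ?qualifE /= ?uabs_ge0.
Qed.

(** The derivative is described through [b] with [a = madd b (munit i)], the form in which [dser]
    reindexes the sum, and as 0 on the remaining indices. *)
Lemma mono_remainder l (r : rat) (a : mindex l) (i : 'I_l) x t :
  0 <= r -> disc r x -> v t <= r -> exists d,
   [/\ v (mono a (x + t *: axis i) - mono a x - t * d) * r ^+ 2
         <= v t ^+ 2 * r ^+ mdeg a,
       a i = 0%N -> d = 0 &
       forall b, a = madd b (munit i) -> d = (b i).+1%:R * mono b x].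
Proof.
move=> r0 xr tr; pose rest := \prod_(j | j != i) x 0 j ^+ a j.
have mE (y : 'rV[K]_l) : (forall j, j != i -> y 0 j = x 0 j) -> mono a y = y 0 i ^+ a i * rest.
  move=> yx; rewrite /mono (bigD1 i) //=; congr (_ * _).
  by apply: eq_bigr => j ji; rewrite yx.
exists ((a i)%:R * x 0 i ^+ (a i).-1 * rest); split.
- rewrite !mE //; last first.
    by move=> j ji; rewrite !mxE eqxx (negbTE ji) mulr0 addr0.
  rewrite !mxE !eqxx mulr1.
  set E := (x 0 i + t) ^+ a i - x 0 i ^+ a i - (a i)%:R * x 0 i ^+ (a i).-1 * t.
  rewrite [X in v X](_ : _ = E * rest); last by rewrite /E; ring.
  have Er := @power_remainder r (x 0 i) t (a i) r0 (xr i) tr.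
  have -> : mdeg a = (a i + \sum_(j | j != i) a j)%N by rewrite /mdeg (bigD1 i).
  rewrite uabsM mulrAC exprD mulrA ler_pM ?mulr_ge0 ?exprn_ge0 ?uabs_ge0 //.
  rewrite (big_morph v (uabsM v) (uabs1 v)) expr_sum; apply: ler_prod => j _.
  by rewrite uabs_ge0 uabsX lerXn2r ?qualifE /= ?uabs_ge0.
- by move=> ->; rewrite !mul0r.
- move=> b ab; have ai : a i = (b i).+1 by rewrite ab !ffunE eqxx addn1.
  rewrite ai /= -mulrA; congr (_ * _); rewrite /mono (bigD1 i) //=; congr (_ * _).
  by apply: eq_bigr => j ji; rewrite ab !ffunE (negbTE ji) addn0.
Qed.

(** Termwise differentiation: the remainder of each term is at most |c_a| r^|a| |t|^2 / r^2, and
    |c_a| r^|a| is at most [C] for all [a] at once. *)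
Lemma expands_has_pd l (i : 'I_l) r C c f x s : 0 < r -> ser r C c ->
  expands r c f -> disc r x ->
  usum v (fun a => dser i c a * mono a x) s -> has_pd i f x s.
Proof.
move=> r0 cs cf xr us; exists (C / r ^+ 2), r; split=> // t tr.
have r0' := ltW r0.
have /choice[d dP] := fun a => mono_remainder a i r0' xr tr.
(* Rewrites the sum over derived monomials as one over all monomials; those with a i = 0 contribute
   nothing. *)
have {}us : usum v (fun a => c a * d a) s.
  apply: (usum_inj (@madd_inj _ (munit i))).
  - move=> a na; case: (dP a) => _ d0 _; rewrite d0 ?mulr0 //.
    case ai: (a i) => [//|n].
    suff E : madd [ffun j => (a j - (j == i))%N] (munit i) = a.
      by have := na [ffun j => (a j - (j == i))%N]; rewrite E eqxx.
    by apply/ffunP => j; rewrite !ffunE subnK //; case: eqP => // ->; rewrite ai.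
  - apply: eq_usum us => a /=; case: (dP (madd a (munit i))) => _ _ dE.
    by rewrite (dE a) // /dser; ring.
have xt : disc r (x + t *: axis i) by apply: discD => //; exact: disc_axis.
have := usumB (usumB (cf _ xt) (cf x xr)) (usumZ t us).
move=> U; have C0 := ser_ge0 cs.
apply: (usum_le U) => [|a].
  by rewrite mulr_ge0 ?exprn_ge0 ?uabs_ge0 // divr_ge0 ?exprn_ge0.
case: (dP a) => le _ _.
have -> : c a * mono a (x + t *: axis i) - c a * mono a x - t * (c a * d a) =
   c a * (mono a (x + t *: axis i) - mono a x - t * d a) by ring.
rewrite uabsM mulrAC ler_pdivlMr ?exprn_gt0 // -mulrA.
apply: le_trans (ler_wpM2l (uabs_ge0 v _) le) _.
rewrite mulrCA mulrC ler_wpM2r ?exprn_ge0 ?uabs_ge0 //; exact: cs.1.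
Qed.

Lemma expands_pd l (i : 'I_l) r C c f : 0 < r -> ser r C c ->
  expands r c f -> expands r (dser i c) (pd i f).
Proof.
move=> r0 cs cf x xr; have [s us] := ser_usum (ser_dser i r0 cs) xr.
by rewrite (has_pdP (expands_has_pd r0 cs cf xr us)).
Qed.

Lemma an_pd l (i : 'I_l) r C f : 0 < r -> an r C f -> an r (C / r) (pd i f).
Proof.
move=> r0 [c cs cf]; exists (dser i c); first exact: ser_dser.
exact: expands_pd cs cf.
Qed.

Lemma an_has_pd l (i : 'I_l) r C f x : 0 < r -> an r C f -> disc r x ->
  has_pd i f x (pd i f x).
Proof.
move=> r0 [c cs cf] xr; have [s us] := ser_usum (ser_dser i r0 cs) xr.
by rewrite (has_pdP (expands_has_pd r0 cs cf xr us)); exact: expands_has_pd r0 cs cf xr us.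
Qed.

Lemma expands0 l (r : rat) c (f : 'rV[K]_l -> K) : 0 <= r -> expands r c f ->
  f 0 = c (mzero l).
Proof.
move=> r0 cf; apply: usum_unique (cf 0 (disc0 v r0)) _.
have := @usum1 _ v _ (fun a => c a * mono a 0) (mzero l).
rewrite mono0 mulr1; apply=> a a0.
case E: (mdeg a) => [|n]; first by rewrite (mdeg_eq0 E) eqxx in a0.
have [i [b [-> _]]] := mdegSP E.
by rewrite monoD mono_unit mxE !mulr0.
Qed.

(** Taylor's formula of order one in all variables at once; the chain rule needs it because the
    displacement of [f] is not parallel to an axis. *)
Lemma an_diff l (r C : rat) f (h : 'rV[K]_l) s : 0 < r -> 0 <= s <= r -> an r C f ->
  disc s h ->
  v (f h - f 0 - \sum_i h 0 i * pd i f 0) * r ^+ 2 <= C * s ^+ 2.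
Proof.
move=> r0 /andP[s0 sr] [c cs cf] hs; have C0 := ser_ge0 cs.
have hr := disc_le sr hs.
have pdE i : pd i f 0 = c (munit i).
  rewrite (expands0 (ltW r0) (expands_pd i r0 cs cf)) /dser ffunE mul1r.
  by congr c; apply/ffunP => j; rewrite !ffunE.
(* The constant and linear parts are written as sums over all indices, so that subtracting termwise
   leaves exactly the degrees at least 2. *)
have U1 i : usum v (fun a => (a == munit i)%:R * (c a * mono a h)) (h 0 i * pd i f 0).
  have := @usum1 _ v _ (fun a => (a == munit i)%:R * (c a * mono a h)) (munit i).
  by rewrite eqxx mul1r mono_unit pdE mulrC; apply=> a /negbTE->; rewrite mul0r.
have U0 : usum v (fun a => (a == mzero l)%:R * (c a * mono a h)) (f 0).
  have := @usum1 _ v _ (fun a => (a == mzero l)%:R * (c a * mono a h)) (mzero l).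
  rewrite eqxx mul1r mono0 mulr1 -(expands0 (ltW r0) cf).
  by apply=> a /negbTE->; rewrite mul0r.
have := usumB (usumB (cf h hr) U0) (usum_sum (index_enum _) U1).
rewrite -ler_pdivlMr ?exprn_gt0 // => U; apply: (usum_le U).
  by rewrite divr_ge0 ?mulr_ge0 ?exprn_ge0 // ltW.
move=> a; rewrite ler_pdivlMr ?exprn_gt0 //.
have Cs : 0 <= C * s ^+ 2 by rewrite mulr_ge0 ?exprn_ge0.
case E: (mdeg a) => [|[|n]].
- rewrite (mdeg_eq0 E) eqxx mul1r subrr sub0r uabsN big1 ?uabs0 ?mul0r // => i _.
  case: eqP => [/(congr1 (@mdeg l))|]; first by rewrite mdeg0 mdeg_unit.
  by rewrite mul0r.
- have [i [b [ab /mdeg_eq0 b0]]] := mdegSP E.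
  have {ab b0} -> : a = munit i.
    by rewrite ab b0; apply/ffunP => j; rewrite !ffunE.
  case: eqP => [/(congr1 (@mdeg l))|_]; first by rewrite mdeg0 mdeg_unit.
  rewrite mul0r subr0 (bigD1 i) //= eqxx mul1r big1 ?addr0 ?subrr ?uabs0 ?mul0r //.
  move=> j ji; case: eqP => [/ffunP/(_ j)|]; rewrite ?mul0r // !ffunE eqxx.
  by rewrite (negbTE ji).
- case: eqP => [a0|_]; first by rewrite a0 mdeg0 in E.
  rewrite big1 => [|i _]; last first.
    by case: eqP => [ai|]; rewrite ?mul0r //; rewrite ai mdeg_unit in E.
  rewrite mul0r !subr0 uabsM -mulrA.
  apply: (@le_trans _ _ (v (c a) * (s ^+ mdeg a * r ^+ 2))).
    by rewrite ler_wpM2l ?uabs_ge0 // ler_wpM2r ?exprn_ge0 ?(ltW r0) ?uabs_mono.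
  apply: (@le_trans _ _ (v (c a) * (r ^+ mdeg a * s ^+ 2))).
    rewrite ler_wpM2l ?uabs_ge0 // E.
    have E2 (q : rat) : q ^+ n.+2 = q ^+ n * q ^+ 2 by rewrite -exprD addn2.
    rewrite !E2 mulrAC.
    rewrite ler_wpM2r ?exprn_ge0 // ler_wpM2r ?exprn_ge0 ?(ltW r0) //.
    by rewrite lerXn2r ?qualifE //= (le_trans s0).
  by rewrite mulrA ler_wpM2r ?exprn_ge0 //; exact: cs.1.
Qed.

(** Schwarz's lemma: without constant term, every monomial gains at least one factor r'/r. *)
Lemma an_shrink l (r r' C : rat) (f : 'rV[K]_l -> K) : 0 < r' <= r -> an r C f -> f 0 = 0 ->
  an r' (C * r' / r) f.
Proof.
move=> /andP[r'0 rr] [c cs cf] f0; have r0 := lt_le_trans r'0 rr.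
have cs' := ser_restrict (introT andP (conj (ltW r'0) rr)) cs.
exists c; last by move=> x xr; apply: cf; exact: disc_le xr.
split=> [a|]; last exact: cs'.2.
case E: (mdeg a) => [|n].
  rewrite (mdeg_eq0 E) -(expands0 (ltW r0) cf) f0 uabs0 mul0r.
  by rewrite divr_ge0 ?mulr_ge0 ?(ser_ge0 cs) ?ltW.
rewrite exprS ler_pdivlMr // -[C * r']mulrC mulrCA -!mulrA ler_pM2l //.
apply: le_trans (cs.1 a); rewrite E exprSr ler_wpM2l ?uabs_ge0 // ler_wpM2r ?(ltW r0) //.
by rewrite lerXn2r ?qualifE //= ltW.
Qed.

End Derivatives.

(** * Analytic functions near a point *)

Section Local.
Context (K : fieldType) (v : ultranorm K).
Local Notation disc := (disc v).
Local Notation an := (an v).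
Local Notation pd := (pd v).
Local Notation has_pd := (has_pd v).

Definition nearby l (x : 'rV[K]_l) (P : 'rV[K]_l -> Prop) : Prop :=
  exists2 r : rat, 0 < r & forall h, disc r h -> P (x + h).

Definition an_at l (f : 'rV[K]_l -> K) x : Prop :=
  exists (r C : rat), 0 < r /\ an r C (fun h => f (x + h)).

Lemma nearbyT l (x : 'rV[K]_l) (P : 'rV[K]_l -> Prop) : (forall y, P y) -> nearby x P.
Proof. by move=> H; exists 1. Qed.

Lemma nearby_and l (x : 'rV[K]_l) (P Q : 'rV[K]_l -> Prop) :
  nearby x P -> nearby x Q -> nearby x (fun y => P y /\ Q y).
Proof.
move=> [r r0 HP] [s s0 HQ]; exists (Num.min r s); first by rewrite lt_min r0.
by move=> h hrs; split; [apply: HP|apply: HQ] => i;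
  apply: le_trans (hrs i) _; rewrite ge_min lexx ?orbT.
Qed.

Lemma nearby_imp l (x : 'rV[K]_l) (P Q : 'rV[K]_l -> Prop) :
  (forall y, P y -> Q y) -> nearby x P -> nearby x Q.
Proof. by move=> PQ [r r0 HP]; exists r => // h /HP /PQ. Qed.

Lemma nearby_self l (x : 'rV[K]_l) (P : 'rV[K]_l -> Prop) : nearby x P -> P x.
Proof. by move=> [r r0 /(_ 0 (disc0 v (ltW r0)))]; rewrite addr0. Qed.

Lemma nearby_near l (x : 'rV[K]_l) (P : 'rV[K]_l -> Prop) :
  nearby x P -> nearby x (fun y => nearby y P).
Proof.
move=> [r r0 HP]; exists r => // h hr; exists r => // k kr.
by rewrite -addrA; apply: HP; exact: discD.
Qed.

Lemma nearby_all l (m : nat) (x : 'rV[K]_l) (P : 'I_m -> 'rV[K]_l -> Prop) :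
  (forall i, nearby x (P i)) -> nearby x (fun y => forall i, P i y).
Proof.
move=> H; suff: nearby x (fun y => forall i, i \in enum 'I_m -> P i y).
  by apply: nearby_imp => y Hy i; apply: Hy; rewrite mem_enum.
elim: (enum _) => [|i s IH]; first exact: nearbyT.
apply: nearby_imp (nearby_and (H i) IH) => y [Pi Ps] j.
by rewrite inE => /orP[/eqP->|/Ps].
Qed.

Lemma finite_min (I : finType) (r : I -> rat) : (forall i, 0 < r i) ->
  exists2 s, 0 < s & forall i, s <= r i.
Proof.
move=> r0; suff [s s0 sr] : exists2 s, 0 < s & forall i, i \in enum I -> s <= r i.
  by exists s => // i; apply: sr; rewrite mem_enum.
elim: (enum _) => [|i e [s s0 IH]]; first by exists 1.
exists (Num.min s (r i)); first by rewrite lt_min s0 r0.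
move=> j; rewrite inE ge_min => /orP[/eqP->|/IH->//]; by rewrite lexx orbT.
Qed.

Lemma finite_max (I : finType) (r : I -> rat) :
  exists2 s, 0 < s & forall i, r i <= s.
Proof.
exists (1 + \sum_i `|r i|); first by rewrite ltr_pwDl // sumr_ge0.
move=> i; rewrite (bigD1 i) //= addrCA (le_trans (ler_norm _)) // lerDl.
by rewrite addr_ge0 // sumr_ge0.
Qed.

Lemma an_at_all l m (f : 'I_m -> 'rV[K]_l -> K) x : (forall j, an_at (f j) x) ->
  exists r C, 0 < r /\ forall j, an r C (fun h => f j (x + h)).
Proof.
move=> /choice[r /choice[C H]].
have [r' r'0 r'r] := finite_min (fun j => (H j).1).
have [C' C'0 CC'] := finite_max C.
exists r', C'; split=> // j; apply: an_le (CC' j) _.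
by apply: an_restrict (H j).2; rewrite (ltW r'0) r'r.
Qed.

Lemma an_at_nearby l (f : 'rV[K]_l -> K) x : an_at f x -> nearby x (an_at f).
Proof.
move=> [r [C [r0 anf]]]; exists r => // h hr; exists r, C; split=> //.
apply: eq_an (an_recenter r0 hr anf) => k _; by rewrite addrA.
Qed.

Lemma has_pd_shift l i (f : 'rV[K]_l -> K) x h d :
  has_pd i (fun h => f (x + h)) h d <-> has_pd i f (x + h) d.
Proof.
by split=> -[C [r [r0 H]]]; exists C, r; split=> // t /H; rewrite addrA.
Qed.

(** The equivalence covers the default value as well: the two functions must also fail to be
    differentiable together. *)
Lemma pd_ext l i (f g : 'rV[K]_l -> K) x y :
  (forall d, has_pd i f x d <-> has_pd i g y d) -> pd i f x = pd i g y.
Proof.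
move=> E; rewrite {1}/pd; case: pselect => [p|np].
  exact: esym (has_pdP ((E _).1 (projT2 (cid p)))).
rewrite /pd; case: pselect => // q; case: np.
by case: q => d gd; exists d; apply/E.
Qed.

Lemma pd_shift l i (f : 'rV[K]_l -> K) x h :
  pd i (fun h => f (x + h)) h = pd i f (x + h).
Proof. by apply: pd_ext => d; exact: has_pd_shift. Qed.

Lemma has_pd_near l i (f g : 'rV[K]_l -> K) x d :
  nearby x (fun y => f y = g y) -> has_pd i f x d -> has_pd i g x d.
Proof.
move=> [r r0 fg] [C [s [s0 H]]]; exists C, (Num.min r s).
rewrite lt_min r0 s0; split=> // t; rewrite le_min => /andP[tr ts].
have fg0 := fg 0 (disc0 v (ltW r0)); rewrite addr0 in fg0.
by rewrite -fg0 -fg ?H //; exact: disc_axis (ltW r0) tr.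
Qed.

Lemma nearby_sym l (f g : 'rV[K]_l -> K) x :
  nearby x (fun y => f y = g y) -> nearby x (fun y => g y = f y).
Proof. by apply: nearby_imp => y ->. Qed.

Lemma pd_near l i (f g : 'rV[K]_l -> K) x :
  nearby x (fun y => f y = g y) -> pd i f x = pd i g x.
Proof.
by move=> fg; apply: pd_ext => d; split; apply: has_pd_near => //; exact: nearby_sym.
Qed.

Lemma an_at_near l (f g : 'rV[K]_l -> K) x :
  nearby x (fun y => f y = g y) -> an_at f x -> an_at g x.
Proof.
move=> [r r0 fg] [s [C [s0 anf]]].
have m0 : 0 < Num.min r s by rewrite lt_min r0.
exists (Num.min r s), C; split=> //.
have ms : 0 <= Num.min r s <= s by rewrite (ltW m0) ge_min lexx orbT.
apply: eq_an (an_restrict ms anf) => h hr; apply: fg; apply: disc_le hr.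
by rewrite ge_min lexx.
Qed.

Lemma an_at_has_pd l i (f : 'rV[K]_l -> K) x : an_at f x -> has_pd i f x (pd i f x).
Proof.
move=> [r [C [r0 anf]]]; have := an_has_pd i r0 anf (disc0 v (ltW r0)).
by rewrite pd_shift => /has_pd_shift; rewrite addr0.
Qed.

Lemma an_at_pd l i (f : 'rV[K]_l -> K) x : an_at f x -> an_at (pd i f) x.
Proof.
move=> [r [C [r0 anf]]]; exists r, (C / r); split=> //.
apply: eq_an (an_pd i r0 anf) => h _; exact: pd_shift.
Qed.

Lemma an_at_cst l k x : an_at (fun _ : 'rV[K]_l => k) x.
Proof. by exists 1, (v k); split=> //; exact: an_cst. Qed.

Lemma an_at_common l (f g : 'rV[K]_l -> K) x : an_at f x -> an_at g x ->
  exists r C, [/\ 0 < r, 0 < C, an r C (fun h => f (x + h)) & an r C (fun h => g (x + h))].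
Proof.
move=> [r [C [r0 anf]]] [s [D [s0 ang]]].
have C0 := an_ge0 anf; have D0 := an_ge0 ang.
have m0 : 0 < Num.min r s by rewrite lt_min r0.
exists (Num.min r s), (1 + C + D); split=> //; first lra.
  have mr : 0 <= Num.min r s <= r by rewrite (ltW m0) ge_min lexx.
  apply: an_le (an_restrict mr anf); lra.
have ms : 0 <= Num.min r s <= s by rewrite (ltW m0) ge_min lexx orbT.
apply: an_le (an_restrict ms ang); lra.
Qed.

Lemma an_atD l (f g : 'rV[K]_l -> K) x : an_at f x -> an_at g x ->
  an_at (fun y => f y + g y) x.
Proof.
move=> anf ang; have [r [C [r0 C0 {}anf {}ang]]] := an_at_common anf ang.
by exists r, C; split=> //; exact: anD.
Qed.

Lemma an_atM l (f g : 'rV[K]_l -> K) x : an_at f x -> an_at g x ->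
  an_at (fun y => f y * g y) x.
Proof.
move=> anf ang; have [r [C [r0 C0 {}anf {}ang]]] := an_at_common anf ang.
by exists r, (C * C); split=> //; exact: anM.
Qed.

Lemma an_atZ l k (f : 'rV[K]_l -> K) x : an_at f x -> an_at (fun y => k * f y) x.
Proof. by apply: an_atM; exact: an_at_cst. Qed.

Lemma an_atB l (f g : 'rV[K]_l -> K) x : an_at f x -> an_at g x ->
  an_at (fun y => f y - g y) x.
Proof.
move=> anf /(an_atZ (-1)) ang; apply: an_at_near (an_atD anf ang).
by apply: nearbyT => y; rewrite mulN1r.
Qed.

Lemma an_at_sum l (I : Type) (s : seq I) (f : I -> 'rV[K]_l -> K) x :
  (forall i, an_at (f i) x) -> an_at (fun y => \sum_(i <- s) f i y) x.
Proof.
move=> anf; elim: s => [|i s IH].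
  by apply: an_at_near (an_at_cst 0 x); apply: nearbyT => y; rewrite big_nil.
apply: an_at_near (an_atD (anf i) IH).
by apply: nearbyT => y; rewrite big_cons.
Qed.

Lemma an_at_coord l (i : 'I_l) x : an_at (fun y => y 0 i) x.
Proof.
exists 1, (Num.max (v (x 0 i)) 1); split=> //.
apply: (@eq_an _ _ _ _ _ (fun h : 'rV[K]_l => x 0 i + h 0 i)) => [h _|].
  by rewrite mxE.
apply: anD; first by apply: an_le (an_cst _ _ _ ler01); rewrite le_max lexx.
by apply: an_le (an_coord _ _ ler01); rewrite le_max lexx orbT.
Qed.

Lemma an_at_increment l (r C s : rat) (f : 'rV[K]_l -> K) (x : 'rV[K]_l) : 0 < s <= r ->
  an r C (fun h => f (x + h)) -> an s (C * s / r) (fun h => f (x + h) - f x).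
Proof.
move=> sr anf; have [s0 rs] := andP sr; have r0 := lt_le_trans s0 rs.
have fx : v (- f x) <= C.
  by rewrite uabsN; have := an_bound anf (disc0 v (ltW r0)); rewrite addr0.
apply: an_shrink => //; last by rewrite addr0 subrr.
by apply: anD => //; apply: an_le fx (an_cst _ _ _ (ltW r0)).
Qed.

Lemma an_at_comp l m (f : 'rV[K]_l -> 'rV[K]_m) (g : 'rV[K]_m -> K) x :
  (forall j, an_at (fun y => f y 0 j) x) -> an_at g (f x) -> an_at (g \o f) x.
Proof.
move=> /an_at_all[r [C [r0 anf]]] [R [D [R0 ang]]].
have C0 : 0 < 1 + `|C| by rewrite ltr_pwDl.
(* On radius [s] the increments of [f] are at most C s / r, hence stay within the disc of radius [R]
   where [g] has its expansion. *)
pose s := Num.min r (R * r / (1 + `|C|)).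
have s0 : 0 < s by rewrite lt_min r0 divr_gt0 ?mulr_gt0.
have sr : 0 < s <= r by rewrite s0 ge_min lexx.
exists s, D; split=> //.
have anfx j : an s R (fun h => (f (x + h) - f x) 0 j); last first.
  apply: eq_an (an_comp s0 (ltW R0) anfx ang) => h _ /=.
  by rewrite addrC subrK.
apply: (@eq_an _ _ _ _ _ (fun h => f (x + h) 0 j - f x 0 j)) => [h _|].
  by rewrite !mxE.
apply: an_le (an_at_increment (f := fun y => f y 0 j) sr (anf j)).
rewrite ler_pdivrMr //; apply: (@le_trans _ _ ((1 + `|C|) * s)).
  by rewrite ler_wpM2r ?(ltW s0) // (le_trans (ler_norm C)) // lerDr.
by rewrite mulrC -ler_pdivlMr // ge_min lexx orbT.
Qed.

Lemma an_at_cts l (f : 'rV[K]_l -> K) x e : an_at f x -> 0 < e ->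
  nearby x (fun y => v (f y - f x) <= e).
Proof.
move=> [r [C [r0 anf]]] e0; have C0 : 0 < 1 + C by rewrite ltr_pwDl ?(an_ge0 anf).
pose s := Num.min r (e * r / (1 + C)).
have s0 : 0 < s by rewrite lt_min r0 divr_gt0 ?mulr_gt0.
have sr : 0 < s <= r by rewrite s0 ge_min lexx.
exists s => // h hs; apply: le_trans (an_bound (an_at_increment sr anf) hs) _.
rewrite ler_pdivrMr //; apply: (@le_trans _ _ ((1 + C) * s)).
  by rewrite ler_wpM2r ?(ltW s0) // lerDr.
by rewrite mulrC -ler_pdivlMr // ge_min lexx orbT.
Qed.

Lemma nearby_comp l m (f : 'rV[K]_l -> 'rV[K]_m) x (P : 'rV[K]_m -> Prop) :
  (forall j, an_at (fun y => f y 0 j) x) -> nearby (f x) P ->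
  nearby x (fun y => P (f y)).
Proof.
move=> anf [r r0 HP].
have := nearby_all (fun j => an_at_cts (anf j) r0); apply: nearby_imp => y fy.
by rewrite -(subrK (f x) (f y)) addrC; apply: HP => j; rewrite !mxE.
Qed.

Lemma has_pd_cst l i k x : has_pd i (fun _ : 'rV[K]_l => k) x 0.
Proof. by exists 0, 1; split=> // t _; rewrite subrr mulr0 subrr uabs0 mul0r. Qed.

Lemma has_pd_coord l (i j : 'I_l) x : has_pd i (fun y => y 0 j) x (j == i)%:R.
Proof.
exists 0, 1; split=> // t _; rewrite !mxE eqxx /= [x 0 j + _]addrC addrK.
by rewrite subrr uabs0 mul0r.
Qed.

Lemma quad_le (C t b : rat) : 0 <= t -> C <= b -> C * t ^+ 2 <= b * t ^+ 2.
Proof. by move=> t0 Cb; rewrite ler_wpM2r ?exprn_ge0. Qed.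

Lemma has_pdD l i (f g : 'rV[K]_l -> K) x d e : has_pd i f x d -> has_pd i g x e ->
  has_pd i (fun y => f y + g y) x (d + e).
Proof.
move=> [C [r [r0 H]]] [D [s [s0 G]]].
exists (Num.max C D), (Num.min r s); rewrite lt_min r0 s0; split=> // t.
rewrite le_min => /andP[tr ts].
set a := x + _.
have -> : f a + g a - (f x + g x) - t * (d + e) =
  (f a - f x - t * d) + (g a - g x - t * e) by ring.
apply: uabsD_le; [apply: le_trans (H t tr) _|apply: le_trans (G t ts) _];
  by rewrite quad_le ?uabs_ge0 // le_max lexx ?orbT.
Qed.

Lemma has_pdM l i (f g : 'rV[K]_l -> K) x d e : has_pd i f x d -> has_pd i g x e ->
  has_pd i (fun y => f y * g y) x (d * g x + f x * e).
Proof.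
move=> [C [r [r0 H]]] [D [s [s0 G]]].
(* The cap 1 gives |t|^2 <= |t|, which turns the quadratic remainders into linear bounds on the
   increments. *)
pose R := Num.min 1 (Num.min r s).
have R0 : 0 < R by rewrite !lt_min r0 s0.
pose B := Num.max (`|D|) (v e).
exists (Num.max (v (g x) * C) (Num.max (v (f x) * D) (Num.max (`|C|) (v d) * B))), R.
split=> // t; rewrite !le_min => /and3P[t1 tr ts].
set a := x + _; have t0 := uabs_ge0 v t.
have bound u k M : v (u - t * k) <= M * v t ^+ 2 -> v u <= Num.max (`|M|) (v k) * v t.
  move=> uM; rewrite -(subrK (t * k) u); apply: uabsD_le.
    apply: le_trans uM _; apply: le_trans (quad_le t0 (ler_norm M)) _.
    apply: (@le_trans _ _ (`|M| * v t)); first by rewrite expr2 mulrA ler_piMr ?mulr_ge0.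
    by rewrite ler_wpM2r // le_max lexx.
  by rewrite uabsM mulrC ler_wpM2r // le_max lexx orbT.
(* Two first order remainders and a product of two increments, the latter quadratic by [bound]. *)
have -> : f a * g a - f x * g x - t * (d * g x + f x * e) =
  g x * (f a - f x - t * d) + (f x * (g a - g x - t * e) +
  (f a - f x) * (g a - g x)) by ring.
apply: uabsD_le.
  apply: le_trans (@quad_le (v (g x) * C) _ _ t0 _); last by rewrite le_max lexx.
  by rewrite uabsM -mulrA ler_wpM2l ?uabs_ge0 // H.
apply: uabsD_le.
  apply: le_trans (@quad_le (v (f x) * D) _ _ t0 _); last first.
    by rewrite !le_max lexx orbT.
  by rewrite uabsM -mulrA ler_wpM2l ?uabs_ge0 // G.
apply: le_trans (@quad_le (Num.max (`|C|) (v d) * B) _ _ t0 _); last first.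
  by rewrite !le_max lexx !orbT.
rewrite uabsM expr2 mulrACA; apply: ler_pM; rewrite ?uabs_ge0 //.
  exact: bound (H t tr).
exact: bound (G t ts).
Qed.

Lemma has_pdZ l i k (f : 'rV[K]_l -> K) x d : has_pd i f x d ->
  has_pd i (fun y => k * f y) x (k * d).
Proof.
by move=> fd; have := has_pdM (has_pd_cst i k x) fd; rewrite mul0r add0r.
Qed.

Lemma has_pd_sum l i (I : Type) (s : seq I) (f : I -> 'rV[K]_l -> K) x d :
  (forall j, has_pd i (f j) x (d j)) ->
  has_pd i (fun y => \sum_(j <- s) f j y) x (\sum_(j <- s) d j).
Proof.
move=> fd; elim: s => [|j s IH].
  rewrite big_nil; apply: has_pd_near (has_pd_cst i 0 x).
  by apply: nearbyT => y; rewrite big_nil.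
rewrite big_cons; apply: has_pd_near (has_pdD (fd j) IH).
by apply: nearbyT => y; rewrite big_cons.
Qed.

Lemma has_pd_comp l m i (f : 'rV[K]_l -> 'rV[K]_m) (g : 'rV[K]_m -> K) x d :
  (forall j, has_pd i (fun y => f y 0 j) x (d j)) -> an_at g (f x) ->
  has_pd i (g \o f) x (\sum_j d j * pd j g (f x)).
Proof.
move=> /choice[C /choice[r H]] [R [D [R0 ang]]].
have [r' r'0 r'r] := finite_min (fun j => (H j).1).
have [C' C'0 CC'] := finite_max C.
have [B B0 dB] := finite_max (fun j => v (d j)).
have [G G0 gG] := finite_max (fun j => v (pd j g (f x))).
have D0 := an_ge0 ang.
pose M := Num.max C' B; have M0 : 0 < M by rewrite lt_max C'0.
(* R/M keeps the displacement [h], of size at most M |t|, inside the disc on which [g] expands. *)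
pose s := Num.min 1 (Num.min r' (R / M)).
have s0 : 0 < s by rewrite !lt_min r'0 divr_gt0.
exists (Num.max (D * M ^+ 2 / R ^+ 2) (C' * G)), s; split=> // t.
rewrite !le_min => /and3P[t1 tr tM]; have t0 := uabs_ge0 v t.
set a := x + _; pose h := f a - f x.
have hd j : v (h 0 j - t * d j) <= C' * v t ^+ 2.
  rewrite !mxE; apply: le_trans ((H j).2 t _) _; first exact: le_trans (r'r j).
  exact: quad_le.
have hM : disc (M * v t) h.
  move=> j; rewrite -(subrK (t * d j) (h 0 j)); apply: uabsD_le.
    apply: le_trans (hd j) _; apply: (@le_trans _ _ (C' * v t)).
      by rewrite expr2 mulrA ler_piMr // mulr_ge0 // ltW.
    by rewrite ler_wpM2r // /M le_max lexx.
  by rewrite uabsM mulrC ler_wpM2r // (le_trans (dB j)) // le_max lexx orbT.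
have hR : 0 <= M * v t <= R.
  by rewrite mulr_ge0 ?(ltW M0) //= mulrC -ler_pdivlMr.
have := an_diff R0 hR ang hM; rewrite /= addr0 -ler_pdivlMr ?exprn_gt0 // => E.
(* The remainder of [g] for the displacement [h], plus the remainders of the components of [f]
   weighted by the gradient of [g]. *)
have -> : (g \o f) a - (g \o f) x - t * (\sum_j d j * pd j g (f x)) =
  (g (f x + h) - g (f x) - \sum_i0 h 0 i0 * pd i0 (fun h => g (f x + h)) 0) +
  \sum_j (h 0 j - t * d j) * pd j g (f x).
  have fh : f x + h = f a by rewrite /h addrC subrK.
  rewrite /= fh.
  have -> : \sum_i0 h 0 i0 * pd i0 (fun h => g (f x + h)) 0 =
     \sum_i0 h 0 i0 * pd i0 g (f x).
    by apply: eq_bigr => j _; rewrite pd_shift addr0.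
  have -> : \sum_j (h 0 j - t * d j) * pd j g (f x) =
    \sum_j h 0 j * pd j g (f x) - t * \sum_j d j * pd j g (f x).
    by rewrite mulr_sumr -sumrB; apply: eq_bigr => j _; ring.
  ring.
apply: uabsD_le.
  apply: le_trans E _; apply: (@le_trans _ _ (D * M ^+ 2 / R ^+ 2 * v t ^+ 2)).
    by rewrite exprMn mulrA mulrAC.
  by rewrite quad_le // le_max lexx.
apply: uabs_sum_le => [|j _].
  by rewrite mulr_ge0 ?exprn_ge0 // le_max (mulr_ge0 (ltW C'0) (ltW G0)) orbT.
apply: le_trans (@quad_le (C' * G) _ _ t0 _); last by rewrite le_max lexx orbT.
by rewrite uabsM mulrAC; apply: ler_pM; rewrite ?uabs_ge0.
Qed.

Lemma dserC l (i j : 'I_l) (c : mindex l -> K) a : dser i (dser j c) a = dser j (dser i c) a.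
Proof.
rewrite /dser -!maddA [madd (munit i) _]maddC !mulrA; congr (_ * _).
rewrite !ffunE; case: eqP => [->|ij]; first by rewrite eqxx.
by case: eqP => [ji|_]; [case: ij|rewrite !addn0 mulrC].
Qed.

(** After recentring at [x], both mixed derivatives are constant terms of twice derived series,
    which agree by [dserC]. *)
Lemma pdC l (i j : 'I_l) (f : 'rV[K]_l -> K) x : an_at f x ->
  pd i (pd j f) x = pd j (pd i f) x.
Proof.
move=> [r [C [r0 [c cs cf]]]].
have E k k' := expands_pd k r0 (ser_dser k' r0 cs) (expands_pd k' r0 cs cf).
have sh k k' : pd k (pd k' f) x = pd k (pd k' (fun h => f (x + h))) 0.
  rewrite -[in LHS](addr0 x) -pd_shift; congr (pd k _ 0).
  by apply/funext => h; rewrite pd_shift.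
by rewrite !sh (expands0 (ltW r0) (E i j)) (expands0 (ltW r0) (E j i)) dserC.
Qed.

End Local.

(** * Derivatives at the origin *)

Section Hurwitz.
Context (K : fieldType) (v : ultranorm K).
Local Notation an_at := (an_at v).
Local Notation pd := (pd v).
Local Notation has_pd := (has_pd v).
Local Notation nearby := (nearby v).
Local Notation near0 f g := (nearby 0 (fun y => f y = g y)).

Definition mfact l (a : mindex l) : nat := (\prod_i (a i)`!)%N.

Lemma mfactS l (a : mindex l) i : mfact (madd a (munit i)) = ((a i).+1 * mfact a)%N.
Proof.
rewrite /mfact (bigD1 i) //= [in RHS](bigD1 i) //= !ffunE eqxx addn1 factS mulnA.
by congr (_ * _)%N; apply: eq_bigr => j ji; rewrite !ffunE (negbTE ji) addn0.
Qed.

Lemma mfact_neq0 l (a : mindex l) : (mfact a)%:R != 0 :> K.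
Proof.
rewrite /mfact natr_prod; apply/prodf_neq0 => i _; exact: (fact_neq0 v).
Qed.

(* [D a] is the derivative of order [a] at 0, i.e. [a!] times a Taylor coefficient. *)
Definition hz l (f : 'rV[K]_l -> K) (D : mindex l -> K) : Prop :=
  exists (r C : rat) c, [/\ 0 < r, ser v r C c, expands v r c f &
    forall a, D a = (mfact a)%:R * c a].

Lemma hz_ex l (f : 'rV[K]_l -> K) : an_at f 0 -> exists D, hz f D.
Proof.
move=> [r [C [r0 [c cs cf]]]]; exists (fun a => (mfact a)%:R * c a), r, C, c.
by split=> // x xr; have := cf x xr; rewrite add0r.
Qed.

Lemma hz_an l (f : 'rV[K]_l -> K) D : hz f D -> an_at f 0.
Proof.
move=> [r [C [c [r0 cs cf _]]]]; exists r, C; split=> //; exists c => // x xr.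
by rewrite add0r; exact: cf.
Qed.

Lemma hz_val l (f : 'rV[K]_l -> K) D : hz f D -> f 0 = D (mzero l).
Proof.
move=> [r [C [c [r0 cs cf ->]]]]; rewrite (expands0 (ltW r0) cf).
by rewrite /mfact big1 ?mul1r // => i _; rewrite ffunE.
Qed.

Lemma hz_pd l i (f : 'rV[K]_l -> K) D : hz f D ->
  hz (pd i f) (fun a => D (madd a (munit i))).
Proof.
move=> [r [C [c [r0 cs cf DE]]]]; exists r, (C / r), (dser i c).
split=> //; [exact: ser_dser|exact: expands_pd cs cf|].
by move=> a; rewrite DE mfactS natrM /dser; ring.
Qed.

Lemma hz_near l (f g : 'rV[K]_l -> K) D : near0 f g -> hz f D -> hz g D.
Proof.
move=> [s s0 fg] [r [C [c [r0 cs cf DE]]]].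
have m0 : 0 < Num.min r s by rewrite lt_min r0.
have mr : 0 <= Num.min r s <= r by rewrite (ltW m0) ge_min lexx.
exists (Num.min r s), C, c; split=> //; first exact: ser_restrict cs.
move=> x xr; rewrite -[x]add0r -fg ?add0r.
  by apply: cf; apply: disc_le xr; rewrite ge_min lexx.
by apply: disc_le xr; rewrite ge_min lexx orbT.
Qed.

Lemma hz_inj l (f g : 'rV[K]_l -> K) D : hz f D -> hz g D -> near0 f g.
Proof.
move=> [r [C [c [r0 cs cf cD]]]] [s [C' [d [s0 ds dg dD]]]].
have cd : c = d.
  apply/funext => a; apply: (mulfI (mfact_neq0 a)); by rewrite -cD -dD.
exists (Num.min r s); first by rewrite lt_min r0.
move=> h hm; rewrite add0r; rewrite -cd in dg.
apply: usum_unique (cf h _) (dg h _); apply: disc_le hm;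
  by rewrite ge_min lexx ?orbT.
Qed.

(** Identity theorem by induction on the order: [hz_val] reads off the constant term and [hz_pd]
    passes to the partial derivatives, whence the generalization over the functions. *)
Lemma hz_unique l (f g : 'rV[K]_l -> K) D D' : near0 f g -> hz f D -> hz g D' ->
  D = D'.
Proof.
move=> fg fD gD; apply/funext => a.
elim: {a}(mdeg a) {-2}a (erefl (mdeg a)) f g D D' fg fD gD => [|n IH] a an f g D D' fg fD gD.
  by rewrite (mdeg_eq0 an) -(hz_val fD) -(hz_val gD); exact: nearby_self fg.
have [i [b [-> bn]]] := mdegSP an.
apply: (IH b bn _ _ _ _ _ (hz_pd i fD) (hz_pd i gD)).
by apply: nearby_imp (nearby_near fg) => y; exact: pd_near.
Qed.

Lemma hz_bound l (f : 'rV[K]_l -> K) D : hz f D ->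
  exists C R : rat, [/\ 0 < C, 0 < R & forall a, v (D a) <= C * R ^+ mdeg a].
Proof.
move=> [r [C [c [r0 cs cf cD]]]]; have C0 := ser_ge0 cs.
exists (1 + C), r^-1; split; rewrite ?invr_gt0 // ?ltr_pwDl // => a.
rewrite exprVn ler_pdivlMr ?exprn_gt0 // cD uabsM.
apply: le_trans (_ : C <= _); last by rewrite lerDr.
apply: le_trans (cs.1 a); rewrite ler_wpM2r ?exprn_ge0 ?(ltW r0) //.
by rewrite ler_piMl ?uabs_ge0 ?uabs_nat.
Qed.

(** Every sequence of geometric growth is the sequence of derivatives of a germ: dividing by a!
    multiplies the growth rate by at most [B] from [uabs_fact]. *)
Lemma hz_realize l (D : mindex l -> K) (C R : rat) : 0 <= C -> 0 <= R ->
  (forall a, v (D a) <= C * R ^+ mdeg a) -> exists f, hz f D.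
Proof.
move=> C0 R0 DC; have [B HB] := uabs_fact v.
have B1 : 1 <= B by have := HB 1%N; rewrite uabs1 mulr1.
have B0 : 0 < B by apply: lt_le_trans B1.
pose c a := D a / (mfact a)%:R.
have cC a : v (c a) <= C * (R * B) ^+ mdeg a.
  have mB : 1 <= B ^+ mdeg a * v (mfact a)%:R.
    rewrite /mfact natr_prod (big_morph v (uabsM v) (uabs1 v)) /mdeg expr_sum -big_split /=.
    by elim/big_ind: _ => // x y x1 y1; rewrite mulr_ege1.
  have m0 : 0 < v (mfact a)%:R by rewrite uabs_gt0 mfact_neq0.
  rewrite /c uabsM uabsV ler_pdivrMr // exprMn -!mulrA.
  apply: le_trans (DC a) _; rewrite ler_wpM2l // ler_peMr //.
  exact: exprn_ge0.
pose r := (1 + R * B)^-1; have RB : 0 <= R * B by rewrite mulr_ge0 // ltW.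
have r0 : 0 < r by rewrite invr_gt0 ltr_pwDl.
have cs : ser v r C c.
  by apply: ser_geom cC => //; rewrite ?(ltW r0) // ltr_pdivrMr ?mul1r ?ltrDr ?ltr_pwDl.
(* Outside the disc of convergence the values are irrelevant and set to 0. *)
have /choice[f fP] : forall x, exists y, disc v r x -> usum v (fun a => c a * mono a x) y.
  move=> x; have [xr|nx] := pselect (disc v r x); last by exists 0.
  by have [s us] := ser_usum cs xr; exists s.
exists f, r, C, c; split=> // a; rewrite /c mulrC divfK //; exact: mfact_neq0.
Qed.

Lemma hz0 l : hz (fun _ : 'rV[K]_l => 0) (fun=> 0).
Proof.
exists 1, 0, (fun=> 0); split=> //.
- split=> [a|e e0]; first by rewrite uabs0 mul0r.
  by exists fset0 => a _; rewrite uabs0 mul0r.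
- move=> x _ e e0; exists fset0; split=> [a _|]; first by rewrite mul0r uabs0.
  by rewrite big1 ?subrr ?uabs0 // => a _; rewrite mul0r.
- by move=> a; rewrite mulr0.
Qed.

(** The sum has some derivatives [F]; induction on the order identifies them, so the two expansions
    need not be brought to a common radius. *)
Lemma hzD l (f g : 'rV[K]_l -> K) D E : hz f D -> hz g E ->
  hz (fun x => f x + g x) (fun a => D a + E a).
Proof.
move=> fD gE; have [F FP] := hz_ex (an_atD (hz_an fD) (hz_an gE)).
suff -> : (fun a => D a + E a) = F by [].
apply/funext => a.
elim: {a}(mdeg a) {-2}a (erefl (mdeg a)) f g D E F fD gE FP => [|n IH] a an f g D E F fD gE FP.
  by rewrite (mdeg_eq0 an) -(hz_val fD) -(hz_val gE) -(hz_val FP).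
have [i [b [-> bn]]] := mdegSP an.
apply: (IH b bn (pd i f) (pd i g) (fun a => D (madd a _)) (fun a => E (madd a _))
  (fun a => F (madd a _)) (hz_pd i fD) (hz_pd i gE)).
apply: hz_near (hz_pd i FP).
apply: nearby_imp (nearby_and (an_at_nearby (hz_an fD)) (an_at_nearby (hz_an gE))) => y [fy gy].
by apply: has_pdP; apply: has_pdD; exact: an_at_has_pd.
Qed.

Lemma hzZ l k (f : 'rV[K]_l -> K) D : hz f D ->
  hz (fun x => k * f x) (fun a => k * D a).
Proof.
move=> [r [C [c [r0 cs cf cD]]]]; exists r, (v k * C), (fun a => k * c a).
split=> //.
- split=> [a|e e0].
    by rewrite uabsM -mulrA ler_wpM2l ?uabs_ge0 //; exact: cs.1.
  have k1 : 0 < 1 + v k by rewrite ltr_pwDl ?uabs_ge0.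
  have [A HA] := cs.2 _ (divr_gt0 e0 k1); exists A => a /HA.
  rewrite ltr_pdivlMr //; apply: le_lt_trans; rewrite uabsM -mulrA mulrC.
  by rewrite ler_wpM2l ?lerDr // mulr_ge0 ?uabs_ge0 ?exprn_ge0 ?ltW.
- by move=> x /cf /(usumZ k); apply: eq_usum => a; rewrite mulrA.
- by move=> a; rewrite cD mulrCA.
Qed.

Lemma hzB l (f g : 'rV[K]_l -> K) D E : hz f D -> hz g E ->
  hz (fun x => f x - g x) (fun a => D a - E a).
Proof.
move=> fD /(hzZ (-1)) gE; have := hzD fD gE.
rewrite (_ : (fun a => _) = (fun a => D a - E a)); last first.
  by apply/funext => a; rewrite mulN1r.
by apply: hz_near; apply: nearbyT => y; rewrite mulN1r.
Qed.

(** One notion for all conditions imposed order by order: vanishing to some order, integrality, and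
    integrality up to some order. *)
Definition jet l (Q : nat -> K -> Prop) (f : 'rV[K]_l -> K) : Prop :=
  exists2 D, hz f D & forall a, Q (mdeg a) (D a).

Lemma jet_an l Q (f : 'rV[K]_l -> K) : jet Q f -> an_at f 0.
Proof. by case=> D /hz_an. Qed.

Lemma jet_near l Q (f g : 'rV[K]_l -> K) : near0 f g -> jet Q f -> jet Q g.
Proof. by move=> fg [D fD QD]; exists D => //; exact: hz_near fD. Qed.

Lemma jet_val l Q (f : 'rV[K]_l -> K) : jet Q f -> Q 0%N (f 0).
Proof. by move=> [D fD QD]; rewrite (hz_val fD) -(mdeg0 l). Qed.

Lemma jet_pd l (Q : nat -> K -> Prop) i (f : 'rV[K]_l -> K) :
  jet Q f -> jet (fun n => Q n.+1) (pd i f).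
Proof.
move=> [D fD QD]; exists (fun a => D (madd a (munit i))); first exact: hz_pd.
by move=> a; have := QD (madd a (munit i)); rewrite mdegD mdeg_unit addn1.
Qed.

(** The induction principle for such conditions: product and chain rules express [pd i f] by
    functions already treated at lower order. *)
Lemma jet_rec l (Q : nat -> K -> Prop) (f : 'rV[K]_l -> K) : an_at f 0 -> Q 0%N (f 0) ->
  (forall i, jet (fun n => Q n.+1) (pd i f)) -> jet Q f.
Proof.
move=> anf f0 fi; have [D fD] := hz_ex anf; exists D => // a.
case E: (mdeg a) => [|n]; first by rewrite (mdeg_eq0 E) -(hz_val fD).
have [i [b [-> bn]]] := mdegSP E; have [D' fD' QD'] := fi i.
have := QD' b; rewrite bn; congr (Q _ _).
have -> // : D' = (fun a => D (madd a (munit i))).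
by apply: hz_unique fD' (hz_pd i fD); exact: nearbyT.
Qed.

Lemma jet_imp l (P Q : nat -> K -> Prop) (f : 'rV[K]_l -> K) :
  (forall n x, P n x -> Q n x) -> jet P f -> jet Q f.
Proof. by move=> PQ [D fD PD]; exists D => // a; exact: PQ. Qed.

Lemma jet_hz l Q (f : 'rV[K]_l -> K) D : jet Q f -> hz f D ->
  forall a, Q (mdeg a) (D a).
Proof.
move=> [E fE QE] fD a; suff -> : D = E by [].
by apply: hz_unique fD fE; exact: nearbyT.
Qed.

(* Integrality is asked of the derivatives at 0, not of the coefficients of the *)
(* power series: this is the condition which survives integration.              *)
Definition vord l d : ('rV[K]_l -> K) -> Prop := jet (fun n x => (n < d)%N -> x = 0).
Definition intg_upto l n : ('rV[K]_l -> K) -> Prop :=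
  jet (fun m x => (m <= n)%N -> v x <= 1).
Definition intg l : ('rV[K]_l -> K) -> Prop := jet (fun _ x => v x <= 1).

Lemma vord0 l (f : 'rV[K]_l -> K) : an_at f 0 -> vord 0 f.
Proof. by case/hz_ex => D fD; exists D. Qed.

Lemma vordS l d (f : 'rV[K]_l -> K) : an_at f 0 -> f 0 = 0 ->
  (forall i, vord d (pd i f)) -> vord d.+1 f.
Proof. by move=> anf f0 fi; apply: jet_rec. Qed.

Lemma vord_le l d e (f : 'rV[K]_l -> K) : (d <= e)%N -> vord e f -> vord d f.
Proof. by move=> de; apply: jet_imp => n x H nd; apply: H; exact: leq_trans de. Qed.

Lemma vord_pd l d i (f : 'rV[K]_l -> K) : vord d f -> vord d.-1 (pd i f).
Proof. by move/(jet_pd i); apply: jet_imp => n x H nd; apply: H; case: d nd. Qed.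

Lemma vordD l d (f g : 'rV[K]_l -> K) : vord d f -> vord d g ->
  vord d (fun x => f x + g x).
Proof.
move=> [D fD QD] [E gE QE]; exists (fun a => D a + E a); first exact: hzD.
by move=> a ad; rewrite QD // QE // addr0.
Qed.

Lemma vordB l d (f g : 'rV[K]_l -> K) : vord d f -> vord d g ->
  vord d (fun x => f x - g x).
Proof.
move=> [D fD QD] [E gE QE]; exists (fun a => D a - E a); first exact: hzB.
by move=> a ad; rewrite QD // QE // subr0.
Qed.

Lemma vord_zero l d : vord d (fun _ : 'rV[K]_l => 0).
Proof. by exists (fun=> 0); first exact: hz0. Qed.

Lemma vord_sum l d (I : Type) (s : seq I) (f : I -> 'rV[K]_l -> K) :
  (forall i, vord d (f i)) -> vord d (fun x => \sum_(i <- s) f i x).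
Proof.
move=> fd; elim: s => [|i s IH].
  by apply: jet_near (vord_zero l d); apply: nearbyT => x; rewrite big_nil.
by apply: jet_near (vordD (fd i) IH); apply: nearbyT => x; rewrite big_cons.
Qed.

Lemma pdM_near l i (f g : 'rV[K]_l -> K) : an_at f 0 -> an_at g 0 ->
  near0 (fun y => pd i f y * g y + f y * pd i g y) (pd i (fun y => f y * g y)).
Proof.
move=> anf ang; apply: nearby_imp (nearby_and (an_at_nearby anf) (an_at_nearby ang)).
by move=> y [fy gy]; apply/esym/has_pdP; apply: has_pdM; exact: an_at_has_pd.
Qed.

Lemma vordM l n d e (f g : 'rV[K]_l -> K) : (n <= d + e)%N -> vord d f -> vord e g ->
  vord n (fun x => f x * g x).
Proof.
elim: n d e f g => [|n IH] d e f g nde fd ge.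
  by apply: vord0; apply: an_atM; [exact: jet_an fd|exact: jet_an ge].
have anf := jet_an fd; have ang := jet_an ge.
apply: vordS => [||i]; first exact: an_atM.
  case: d nde fd => [|d] nde fd; last by rewrite (jet_val fd) ?mul0r.
  by case: e nde ge => [|e] // nde ge; rewrite (jet_val ge) ?mulr0.
apply: jet_near (pdM_near i anf ang) _; apply: vordD.
  (* For d = 0 the truncated predecessor is harmless, the hypothesis then being n + 1 <= e. *)
  by apply: (IH d.-1 e) => //; [lia|exact: vord_pd].
by apply: (IH d e.-1) => //; [lia|exact: vord_pd].
Qed.

Lemma vord_eq0 l (f : 'rV[K]_l -> K) : (forall d, vord d f) -> near0 f (fun=> 0).
Proof.
move=> fd; have [D fD] := hz_ex (jet_an (fd 0%N)).
apply: hz_inj (hz0 l); suff <- : D = (fun=> 0) by [].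
by apply/funext => a; apply: (jet_hz (fd (mdeg a).+1) fD).
Qed.

(** Bounded orders allow induction with the first order product and chain rules, so no closed
    formula for higher derivatives occurs. *)
Lemma intg_all l (f : 'rV[K]_l -> K) : intg f <-> forall n, intg_upto n f.
Proof.
split=> [fi n|fi]; first exact: jet_imp fi.
have [D fD] := hz_ex (jet_an (fi 0%N)); exists D => // a.
exact: (jet_hz (fi (mdeg a)) fD).
Qed.

Lemma intgD l (f g : 'rV[K]_l -> K) : intg f -> intg g -> intg (fun x => f x + g x).
Proof.
move=> [D fD QD] [E gE QE]; exists (fun a => D a + E a); first exact: hzD.
by move=> a; rewrite uabsD_le.
Qed.

Lemma intgB l (f g : 'rV[K]_l -> K) : intg f -> intg g -> intg (fun x => f x - g x).
Proof.
move=> [D fD QD] [E gE QE]; exists (fun a => D a - E a); first exact: hzB.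
by move=> a; rewrite uabsB_le.
Qed.

Lemma intg_pd l i (f : 'rV[K]_l -> K) : intg f -> intg (pd i f).
Proof. by move/(jet_pd i). Qed.

Lemma intg_sum l (I : Type) (s : seq I) (f : I -> 'rV[K]_l -> K) :
  (forall i, intg (f i)) -> intg (fun x => \sum_(i <- s) f i x).
Proof.
move=> fd; elim: s => [|i s IH].
  exists (fun=> 0) => [|a]; last by rewrite uabs0.
  by apply: hz_near (hz0 l); apply: nearbyT => x; rewrite big_nil.
by apply: jet_near (intgD (fd i) IH); apply: nearbyT => x; rewrite big_cons.
Qed.

Lemma intg_uptoS l n (f : 'rV[K]_l -> K) : an_at f 0 -> v (f 0) <= 1 ->
  (forall i, intg_upto n (pd i f)) -> intg_upto n.+1 f.
Proof. by move=> anf f0 fi; apply: jet_rec. Qed.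

Lemma intg_upto_pd l n i (f : 'rV[K]_l -> K) : intg_upto n.+1 f -> intg_upto n (pd i f).
Proof. by move/(jet_pd i). Qed.

Lemma intg_upto_le l n m (f : 'rV[K]_l -> K) : (n <= m)%N -> intg_upto m f -> intg_upto n f.
Proof. by move=> nm; apply: jet_imp => k x H kn; apply: H; exact: leq_trans nm. Qed.

Lemma intg_upto0 l (f : 'rV[K]_l -> K) : an_at f 0 -> v (f 0) <= 1 -> intg_upto 0 f.
Proof.
case/hz_ex => D fD f0; exists D => // a; rewrite leqn0 => /eqP/mdeg_eq0 ->.
by rewrite -(hz_val fD).
Qed.

Lemma intg_uptoD l n (f g : 'rV[K]_l -> K) : intg_upto n f -> intg_upto n g ->
  intg_upto n (fun x => f x + g x).
Proof.
move=> [D fD QD] [E gE QE]; exists (fun a => D a + E a); first exact: hzD.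
by move=> a an; rewrite uabsD_le ?QD ?QE.
Qed.

Lemma intg_upto_sum l n (I : Type) (s : seq I) (f : I -> 'rV[K]_l -> K) :
  (forall i, intg_upto n (f i)) -> intg_upto n (fun x => \sum_(i <- s) f i x).
Proof.
move=> fd; elim: s => [|i s IH].
  exists (fun=> 0) => [|a]; last by rewrite uabs0.
  by apply: hz_near (hz0 l); apply: nearbyT => x; rewrite big_nil.
by apply: jet_near (intg_uptoD (fd i) IH); apply: nearbyT => x; rewrite big_cons.
Qed.

Lemma intg_uptoM l n (f g : 'rV[K]_l -> K) : intg_upto n f -> intg_upto n g ->
  intg_upto n (fun x => f x * g x).
Proof.
elim: n f g => [|n IH] f g fn gn; have anf := jet_an fn; have ang := jet_an gn;
  have val : v (f 0 * g 0) <= 1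
    by rewrite uabsM mulr_ile1 ?uabs_ge0 ?(jet_val fn) ?(jet_val gn).
  by apply: intg_upto0 => //; exact: an_atM.
apply: intg_uptoS => // [|i]; first exact: an_atM.
apply: jet_near (pdM_near i anf ang) _; apply: intg_uptoD; apply: IH;
  try exact: intg_upto_pd; exact: intg_upto_le (leqnSn n) _.
Qed.

Lemma intgM l (f g : 'rV[K]_l -> K) : intg f -> intg g -> intg (fun x => f x * g x).
Proof.
by move=> /intg_all fi /intg_all gi; apply/intg_all => n; exact: intg_uptoM.
Qed.

(** * Composition of germs fixing the origin *)

Section Composition.
Context (l m : nat).
Implicit Types (f : 'rV[K]_l -> 'rV[K]_m) (g : 'rV[K]_m -> K).

Lemma pd_comp_near i f g : (forall j, an_at (fun y => f y 0 j) 0) -> f 0 = 0 ->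
  an_at g 0 ->
  near0 (fun y => \sum_j pd i (fun y => f y 0 j) y * pd j g (f y)) (pd i (g \o f)).
Proof.
move=> anf f0 ang.
have ang' : nearby 0 (fun y => an_at g (f y)).
  by apply: nearby_comp => //; rewrite f0; exact: an_at_nearby.
have anf' := nearby_all (fun j => an_at_nearby (anf j)).
apply: nearby_imp (nearby_and anf' ang') => y [fy gy].
by apply/esym/has_pdP; apply: has_pd_comp => // j; exact: an_at_has_pd.
Qed.

Lemma vord_comp d f g : (forall j, an_at (fun y => f y 0 j) 0) -> f 0 = 0 ->
  vord d g -> vord d (g \o f).
Proof.
move=> anf f0; elim: d g => [|d IH] g gd; have ang := jet_an gd;
  have angf : an_at (g \o f) 0 by (apply: an_at_comp => //; rewrite f0).
  exact: vord0.
apply: vordS => //= [|i]; first by rewrite f0 (jet_val gd).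
apply: jet_near (pd_comp_near i anf f0 ang) _; apply: vord_sum => j.
apply: (@vordM _ _ 0 d) => //; first by apply: vord0; exact: an_at_pd.
by apply: (IH (pd j g)); exact: vord_pd gd.
Qed.

(** The chain rule gives products of a derivative of [f] with a composite of a derivative of [g];
    the composite is covered by induction since one order has been used up. *)
Lemma intg_comp f g : (forall j, intg (fun y => f y 0 j)) -> f 0 = 0 ->
  intg g -> intg (g \o f).
Proof.
move=> fi f0 /intg_all gi; apply/intg_all => n; move: gi => /(_ n).
have anf j := jet_an (fi j).
elim: n g => [|n IH] g gd; have ang := jet_an gd;
  have angf : an_at (g \o f) 0 by (apply: an_at_comp => //; rewrite f0).
  by apply: intg_upto0 => //=; rewrite f0 (jet_val gd).
apply: intg_uptoS => //= [|i]; first by rewrite f0 (jet_val gd).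
apply: jet_near (pd_comp_near i anf f0 ang) _; apply: intg_upto_sum => j.
apply: intg_uptoM; first by move: n {IH gd}; apply/intg_all; exact: intg_pd.
by apply: (IH (pd j g)); exact: intg_upto_pd.
Qed.

(** To leading order the difference is f - f' times the gradient of [g], so the orders [d] and [e]
    add up. The gain from [e] drives both the Moser step and the inversion. *)
Lemma vord_comp_diff n d e f f' g :
  (forall j, an_at (fun y => f y 0 j) 0) -> f 0 = 0 ->
  (forall j, an_at (fun y => f' y 0 j) 0) -> f' 0 = 0 -> an_at g 0 ->
  (n <= d + e)%N -> (forall j, vord d (fun y => f y 0 j - f' y 0 j)) ->
  (forall j, vord e (pd j g)) -> vord n (fun y => g (f y) - g (f' y)).
Proof.
move=> anf f0 anf' f'0; elim: n e g => [|n IH] e g ang nde fd ge;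
  have angf : an_at (g \o f) 0 by (apply: an_at_comp => //; rewrite f0).
  apply: vord0; apply: an_atB => //.
  by apply: (an_at_comp anf'); rewrite f'0.
have angf' : an_at (g \o f') 0 by apply: an_at_comp => //; rewrite f'0.
apply: vordS => [||i]; [exact: an_atB|by rewrite f0 f'0 subrr|].
pose F j := (fun y => f y 0 j); pose F' j := (fun y => f' y 0 j).
(* The derivative of the difference is split so that each summand contains one difference, either of
   gradients of [g] or of Jacobians. *)
apply: (@jet_near _ _ (fun y => \sum_j (pd i (F j) y * (pd j g (f y) - pd j g (f' y))
    + (pd i (F j) y - pd i (F' j) y) * pd j g (f' y)))).
  have := nearby_and (nearby_and (pd_comp_near i anf f0 ang) (pd_comp_near i anf' f'0 ang))
    (nearby_and (an_at_nearby angf) (an_at_nearby angf')).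
  apply: nearby_imp => y [[E E'] [gfy gfy']].
  transitivity (pd i (g \o f) y - pd i (g \o f') y).
    by rewrite -E -E' -sumrB; apply: eq_bigr => j _; rewrite /F /F'; ring.
  apply/esym/has_pdP.
  have := has_pdD (an_at_has_pd i gfy) (has_pdZ (-1) (an_at_has_pd i gfy')).
  rewrite mulN1r; apply: has_pd_near; apply: nearbyT => z /=; by rewrite mulN1r.
apply: vord_sum => j; apply: vordD.
  apply: (@vordM _ _ 0 n) => //; first by apply: vord0; exact: an_at_pd (anf j).
  apply: (IH e.-1) => //; [exact: an_at_pd|lia|].
  by move=> k; have := vord_pd k (ge j).
apply: (@vordM _ _ d.-1 e); first lia; last first.
  exact: (vord_comp anf' f'0 (ge j)).
apply: jet_near (vord_pd i (fd j)).
have := nearby_and (an_at_nearby (anf j)) (an_at_nearby (anf' j)).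
apply: nearby_imp => y [fy fy']; apply/has_pdP.
have := has_pdD (an_at_has_pd i fy) (has_pdZ (-1) (an_at_has_pd i fy')).
by rewrite mulN1r; apply: has_pd_near; apply: nearbyT => z /=; rewrite mulN1r.
Qed.

End Composition.

Lemma intg_limit l (F : nat -> 'rV[K]_l -> K) : (forall k, intg (F k)) ->
  (forall k, vord k.+1 (fun x => F k.+1 x - F k x)) ->
  exists2 g, intg g & forall k, vord k.+1 (fun x => g x - F k x).
Proof.
move=> Fi dF.
have /choice[D DP] : forall k, exists D, hz (F k) D /\ forall a, v (D a) <= 1.
  by move=> k; have [D ? ?] := Fi k; exists D.
have step k a : (mdeg a <= k)%N -> D k.+1 a = D k a.
  move=> ak; apply/eqP; rewrite -subr_eq0; apply/eqP.
  exact: (jet_hz (dF k) (hzB (DP k.+1).1 (DP k).1)).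
have stable k a : (mdeg a <= k)%N -> D k a = D (mdeg a) a.
  elim: k => [|k IH]; first by rewrite leqn0 => /eqP->.
  by rewrite leq_eqVlt => /orP[/eqP<-//|]; rewrite ltnS => ak; rewrite step ?IH.
(* Diagonal choice: derivatives of order n no longer change from stage n on, and the bound 1 makes
   the sequence realizable. *)
have [g gD] : exists g, hz g (fun a => D (mdeg a) a).
  apply: (@hz_realize _ _ 1 1) => // a; rewrite expr1n mulr1; exact: (DP _).2.
exists g; first by exists (fun a => D (mdeg a) a) => // a; exact: (DP _).2.
move=> k; exists (fun a => D (mdeg a) a - D k a); first exact: hzB (DP k).1.
by move=> a; rewrite ltnS => ak; rewrite -(stable k) ?subrr.
Qed.

End Hurwitz.

(** * Differential forms and the Poincare lemma *)

Section PoincareCoefficients.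
Context (K : fieldType) (l : nat).
Implicit Types (F : mindex l -> K) (A : 'I_l -> mindex l -> K)
  (D : 'I_l -> 'I_l -> mindex l -> K) (a b : mindex l) (i j k o : 'I_l).
Local Notation "a +m i" := (madd a (munit i)) (at level 50, left associativity).

(** Integration in the variable [o] from 0: a shift of the index without denominators. The value 0
    encodes vanishing on the hyperplane where that variable is 0. *)
Definition mprim o F a : K :=
  if a o is _.+1 then F [ffun j => (a j - (j == o))%N] else 0.

Lemma mpred a o : a o != 0%N -> [ffun j => (a j - (j == o))%N] +m o = a.
Proof.
move=> ao; apply/ffunP => j; rewrite !ffunE; case: eqP => [->|_]; last by rewrite subn0 addn0.
by rewrite subnK // lt0n.
Qed.

Lemma mprimK o F a : mprim o F (a +m o) = F a.
Proof.
rewrite /mprim !ffunE eqxx addn1; congr F.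
by apply/ffunP => j; rewrite !ffunE addnK.
Qed.

Lemma mprim_shift o i F a : i != o ->
  mprim o F (a +m i) = mprim o (fun b => F (b +m i)) a.
Proof.
move=> io; rewrite /mprim !ffunE eq_sym (negbTE io) addn0.
case ao: (a o) => [//|n]; congr F; apply/ffunP => j; rewrite !ffunE.
case: (eqVneq j o) => [->|_]; last by rewrite !subn0.
by rewrite eq_sym (negbTE io) !addn0.
Qed.

Lemma mprim0 o a : mprim o (fun=> 0) a = 0.
Proof. by rewrite /mprim; case: (a o). Qed.

Lemma maddAC a i j : a +m i +m j = a +m j +m i.
Proof. by rewrite -!maddA [madd (munit i) _]maddC. Qed.

(** At each order an additive subgroup. In the ultrametric setting a bound |x| <= c is one, so
    growth, integrality and vanishing are treated alike. *)
Definition additive_family (Q : nat -> K -> Prop) : Prop :=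
  forall n, Q n 0 /\ forall x y, Q n x -> Q n y -> Q n (x - y).

(** What a primitive inherits: it vanishes at 0, and its derivatives of order n + 1 satisfy the
    condition of order n. *)
Definition raise (Q : nat -> K -> Prop) n (x : K) : Prop :=
  if n is n'.+1 then Q n' x else x = 0.

Lemma raise_additive Q : additive_family Q -> additive_family (raise Q).
Proof.
move=> addQ [|n]; last exact: addQ.
by split=> // x y -> ->; rewrite subr0.
Qed.

Lemma raise_mprim Q o F a : (forall b, Q (mdeg b) (F b)) -> additive_family Q ->
  raise Q (mdeg a) (mprim o F a).
Proof.
move=> QF addQ; have [r0 _] := raise_additive addQ (mdeg a).
rewrite /mprim; case ao: (a o) => [//|n].
set b := finfun _; have <- : b +m o = a by rewrite mpred ?ao.
by rewrite mdegD mdeg_unit addn1 /=.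
Qed.

Lemma additiveD Q n x y : additive_family Q -> Q n x -> Q n y -> Q n (x + y).
Proof.
move=> addQ Qx Qy; have [Q0 QB] := addQ n.
by rewrite -[y]opprK; apply: (QB) => //; rewrite -[- y]add0r; exact: QB.
Qed.

(* Coordinatewise integration has integer coefficients on derivatives, so it *)
(* preserves every additive constraint; radial integration does not.         *)
Lemma poincare_coef D :
  (forall i j a, D i j a = - D j i a) -> (forall i a, D i i a = 0) ->
  (forall i j k a, D j k (a +m i) + D k i (a +m j) + D i j (a +m k) = 0) ->
  exists A, (forall i j a, D i j a = A j (a +m i) - A i (a +m j)) /\
    forall Q, additive_family Q -> (forall i j a, Q (mdeg a) (D i j a)) ->
      forall j a, raise Q (mdeg a) (A j a).
Proof.
(* Induction on the number [m] of variables involved: no differential and no dependence from the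
   variables of index at least [m]. *)
suff H m : forall D,
  (forall i j a, D i j a = - D j i a) -> (forall i a, D i i a = 0) ->
  (forall i j k a, D j k (a +m i) + D k i (a +m j) + D i j (a +m k) = 0) ->
  (forall i j a, (m <= i)%N -> D i j a = 0) ->
  (forall i j k a, (m <= k)%N -> D i j (a +m k) = 0) ->
  exists A, (forall i j a, D i j a = A j (a +m i) - A i (a +m j)) /\
    forall Q, additive_family Q -> (forall i j a, Q (mdeg a) (D i j a)) ->
      forall j a, raise Q (mdeg a) (A j a).
  move=> aD D0 cD; apply: (H l) => //.
    by move=> i j a; rewrite leqNgt ltn_ord.
  by move=> i j k a; rewrite leqNgt ltn_ord.
elim: m => [|m IH] {}D aD D0 cD suppD constD.
  exists (fun _ _ => 0); split=> [i j a|Q addQ _ j a]; first by rewrite suppD ?subr0.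
  by case: (raise_additive addQ (mdeg a)).
have [lm|ml] := leqP l m.
  apply: IH => // [i j a mi|i j k a mk].
    by have := ltn_ord i; rewrite ltnNge (leq_trans lm mi).
  by have := ltn_ord k; rewrite ltnNge (leq_trans lm mk).
pose o := Ordinal ml.
(* Integrating in the last variable the contraction with its coordinate field: subtracting d(al)
   removes all components containing that differential. *)
pose al j := mprim o (D o j).
pose D' i j a := D i j a - (al j (a +m i) - al i (a +m j)).
have al0 j a k : (m < k)%N -> al j (a +m k) = 0.
  move=> mk; rewrite /al mprim_shift; last by rewrite -val_eqE /= gtn_eqF.
  by rewrite -(mprim0 o a); congr (mprim o _ a); apply/funext => b; rewrite constD.
have alo i a : (m <= i)%N -> al i a = 0.
  rewrite leq_eqVlt => /orP[/eqP mi|mi]; rewrite -(mprim0 o a);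
    congr (mprim o _ a); apply/funext => b; last by rewrite aD suppD ?oppr0.
  by have -> : i = o; [apply: val_inj|rewrite D0].
have aD' i j a : D' i j a = - D' j i a by rewrite /D' (aD i j); ring.
have D'o j a : D' o j a = 0.
  by rewrite /D' {1}/al mprimK (alo o) //= subr0 subrr.
have cD' i j k a : D' j k (a +m i) + D' k i (a +m j) + D' i j (a +m k) = 0.
  rewrite -[RHS](cD i j k a) /D' (maddAC a j i) (maddAC a k j) (maddAC a k i).
  ring.
have [|||A' [A'E A'Q]] := IH D' aD' _ cD'.
- by move=> i a; rewrite /D' D0; ring.
- move=> i j a; rewrite leq_eqVlt => /orP[/eqP mi|mi].
    by have -> : i = o; [apply: val_inj|rewrite D'o].
  by rewrite /D' suppD // al0 // alo ?subrr // ltnW.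
- move=> i j k a; rewrite leq_eqVlt => /orP[/eqP mk|mk]; last first.
    by rewrite /D' constD // !(maddAC a k) !al0 // !subr0.
  (* Once the components along [o] vanish, closedness says that the remaining ones do not depend on
     the variable [o]. *)
  have -> : k = o by apply: val_inj.
  by have := cD' i j o a; rewrite D'o addr0 aD' D'o oppr0 add0r.
exists (fun j a => A' j a + al j a); split=> [i j a|Q addQ QD j a].
  rewrite -[D i j a](subrK (al j (a +m i) - al i (a +m j))) -/(D' i j a) A'E; ring.
have Qal i b : raise Q (mdeg b) (al i b) by exact: raise_mprim.
apply: additiveD (raise_additive addQ) _ _ => //; apply: A'Q => // i k b.
have QB := (addQ (mdeg b)).2; rewrite /D'.
have up i' k' : Q (mdeg b) (al i' (b +m k')).
  by have := Qal i' (b +m k'); rewrite mdegD mdeg_unit addn1.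
by apply: (QB) => //; exact: QB.
Qed.

End PoincareCoefficients.

Section Forms.
Context (K : fieldType) (v : ultranorm K).
Local Notation an_at := (an_at v).
Local Notation pd := (pd v).
Local Notation nearby := (nearby v).
Local Notation near0 f g := (nearby 0 (fun y => f y = g y)).

Definition jac l m (f : 'rV[K]_l -> 'rV[K]_m) (y : 'rV[K]_l) : 'M[K]_(l, m) :=
  \matrix_(i, k) pd i (fun z => f z 0 k) y.

(** Vectors are rows, so [jac] is the transposed Jacobian matrix and this is the matrix of the
    pulled back bilinear form. *)
Definition pull l m (f : 'rV[K]_l -> 'rV[K]_m) (W : 'rV[K]_m -> 'M[K]_m)
  (y : 'rV[K]_l) : 'M[K]_l := jac f y *m W (f y) *m (jac f y)^T.

Definition ext_d l (A : 'I_l -> 'rV[K]_l -> K) (y : 'rV[K]_l) : 'M[K]_l :=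
  \matrix_(i, j) (pd i (A j) y - pd j (A i) y).

Definition pull1 l m (f : 'rV[K]_l -> 'rV[K]_m) (A : 'I_m -> 'rV[K]_m -> K)
  (i : 'I_l) (y : 'rV[K]_l) : K := \sum_k pd i (fun z => f z 0 k) y * A k (f y).

Definition an_map l m (f : 'rV[K]_l -> 'rV[K]_m) x :=
  forall j, an_at (fun z => f z 0 j) x.

Lemma an_map_nearby l m (f : 'rV[K]_l -> 'rV[K]_m) x :
  an_map f x -> nearby x (an_map f).
Proof. by move=> anf; apply: nearby_all => j; exact: an_at_nearby. Qed.

Lemma an_map_comp l m n (f : 'rV[K]_l -> 'rV[K]_m) (g : 'rV[K]_m -> 'rV[K]_n) x :
  an_map f x -> an_map g (f x) -> an_map (g \o f) x.
Proof. by move=> anf ang j; exact: (an_at_comp anf (ang j)). Qed.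

Lemma an_map_id l (x : 'rV[K]_l) : an_map id x.
Proof. by move=> j; exact: an_at_coord. Qed.

Lemma pdD l i (f g : 'rV[K]_l -> K) x : an_at f x -> an_at g x ->
  pd i (fun y => f y + g y) x = pd i f x + pd i g x.
Proof. by move=> fx gx; apply: has_pdP; apply: has_pdD; exact: an_at_has_pd. Qed.

Lemma pdB l i (f g : 'rV[K]_l -> K) x : an_at f x -> an_at g x ->
  pd i (fun y => f y - g y) x = pd i f x - pd i g x.
Proof.
move=> fx gx; rewrite -mulN1r; apply: has_pdP.
apply: has_pd_near (has_pdD (an_at_has_pd i fx) (has_pdZ (-1) (an_at_has_pd i gx))).
by apply: nearbyT => y; rewrite mulN1r.
Qed.

Lemma pdM l i (f g : 'rV[K]_l -> K) x : an_at f x -> an_at g x ->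
  pd i (fun y => f y * g y) x = pd i f x * g x + f x * pd i g x.
Proof. by move=> fx gx; apply: has_pdP; apply: has_pdM; exact: an_at_has_pd. Qed.

Lemma pdZ l i k (f : 'rV[K]_l -> K) x : an_at f x ->
  pd i (fun y => k * f y) x = k * pd i f x.
Proof. by move=> fx; apply: has_pdP; apply: has_pdZ; exact: an_at_has_pd. Qed.

Lemma pd_sum l i (I : Type) (s : seq I) (f : I -> 'rV[K]_l -> K) x :
  (forall j, an_at (f j) x) ->
  pd i (fun y => \sum_(j <- s) f j y) x = \sum_(j <- s) pd i (f j) x.
Proof. by move=> fx; apply: has_pdP; apply: has_pd_sum => j; exact: an_at_has_pd. Qed.

Lemma pd_comp l m i (f : 'rV[K]_l -> 'rV[K]_m) (g : 'rV[K]_m -> K) x :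
  an_map f x -> an_at g (f x) ->
  pd i (fun y => g (f y)) x = \sum_k pd i (fun z => f z 0 k) x * pd k g (f x).
Proof.
by move=> fx gx; apply: has_pdP; apply: has_pd_comp => // j; exact: an_at_has_pd.
Qed.

Lemma pd_coord l (i j : 'I_l) x : pd i (fun y => y 0 j) x = (j == i)%:R.
Proof. by apply: has_pdP; exact: has_pd_coord. Qed.

Lemma jac_id l (y : 'rV[K]_l) : jac id y = 1%:M.
Proof. by apply/matrixP => i j; rewrite !mxE pd_coord eq_sym. Qed.

Lemma jac_comp l m n (f : 'rV[K]_l -> 'rV[K]_m) (g : 'rV[K]_m -> 'rV[K]_n) x :
  an_map f x -> an_map g (f x) -> jac (g \o f) x = jac f x *m jac g (f x).
Proof.
move=> fx gx; apply/matrixP => i j; rewrite !mxE /= (@pd_comp _ _ i f (fun z => g z 0 j)) //.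
by apply: eq_bigr => k _; rewrite !mxE.
Qed.

Lemma jac_near l m (f g : 'rV[K]_l -> 'rV[K]_m) x :
  nearby x (fun y => f y = g y) -> jac f x = jac g x.
Proof.
move=> fg; apply/matrixP => i j; rewrite !mxE; apply: pd_near.
by apply: nearby_imp fg => y ->.
Qed.

Lemma pull_comp l m n (f : 'rV[K]_l -> 'rV[K]_m) (g : 'rV[K]_m -> 'rV[K]_n) W x :
  an_map f x -> an_map g (f x) -> pull (g \o f) W x = pull f (pull g W) x.
Proof. by move=> fx gx; rewrite /pull jac_comp // trmx_mul !mulmxA. Qed.

(** The second derivatives of [f] cancel by their symmetry; what remains is the antisymmetrization
    of the derivatives of [A]. *)
Lemma ext_d_pull1 l m (f : 'rV[K]_l -> 'rV[K]_m) A x : an_map f x ->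
  (forall k, an_at (A k) (f x)) -> ext_d (pull1 f A) x = pull f (ext_d A) x.
Proof.
move=> fx Ax; apply/matrixP => i j.
have pdE i' j' : pd i' (pull1 f A j') x =
    \sum_k pd i' (pd j' (fun z => f z 0 k)) x * A k (f x) +
    \sum_k \sum_k' pd j' (fun z => f z 0 k) x * (pd i' (fun z => f z 0 k') x * pd k' (A k) (f x)).
  rewrite pd_sum; last first.
    move=> k; apply: an_atM; first exact: an_at_pd.
    exact: (an_at_comp fx (Ax k)).
  rewrite -big_split /=; apply: eq_bigr => k _.
  rewrite pdM; [|exact: an_at_pd|exact: (an_at_comp fx (Ax k))].
  by rewrite (pd_comp _ fx (Ax k)) mulr_sumr.
rewrite /pull [LHS]mxE !pdE [RHS]mxE.
have -> : \sum_k pd i (pd j (fun z => f z 0 k)) x * A k (f x) =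
          \sum_k pd j (pd i (fun z => f z 0 k)) x * A k (f x).
  by apply: eq_bigr => k _; rewrite pdC.
rewrite opprD addrACA subrr add0r.
have -> : \sum_k (jac f x *m ext_d A (f x)) i k * (jac f x)^T k j =
   \sum_k \sum_k' pd i (fun z => f z 0 k') x * (pd k' (A k) (f x) - pd k (A k') (f x))
                  * pd j (fun z => f z 0 k) x.
  apply: eq_bigr => k _; rewrite !mxE mulr_suml; apply: eq_bigr => k' _.
  by rewrite !mxE.
rewrite [X in _ - X]exchange_big -sumrB; apply: eq_bigr => k _.
rewrite -sumrB; apply: eq_bigr => k' _; ring.
Qed.

Lemma ext_dB l (A B : 'I_l -> 'rV[K]_l -> K) x :
  (forall j, an_at (A j) x) -> (forall j, an_at (B j) x) ->
  ext_d (fun j y => A j y - B j y) x = ext_d A x - ext_d B x.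
Proof. by move=> Ax Bx; apply/matrixP => i j; rewrite !mxE !pdB //; ring. Qed.

Lemma ext_d_closed l (A : 'I_l -> 'rV[K]_l -> K) x i j k :
  (forall j, an_at (A j) x) ->
  pd i (fun y => ext_d A y j k) x + pd j (fun y => ext_d A y k i) x +
  pd k (fun y => ext_d A y i j) x = 0.
Proof.
move=> Ax; have E i' j' k' : pd i' (fun y => ext_d A y j' k') x =
    pd i' (pd j' (A k')) x - pd i' (pd k' (A j')) x.
  rewrite -pdB; [|exact: an_at_pd|exact: an_at_pd].
  by congr (pd i' _ x); apply/funext => y; rewrite mxE.
rewrite !E (pdC j i (Ax k)) (pdC k i (Ax j)) (pdC k j (Ax i)); ring.
Qed.

(** One primitive works for every [Q] simultaneously, so integrality and order of vanishing can
    later be drawn from the same [A]. *)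
Lemma poincare l (W : 'rV[K]_l -> 'M[K]_l) :
  (forall i j, an_at (fun y => W y i j) 0) ->
  (forall i j, near0 (fun y => W y i j) (fun y => - W y j i)) ->
  (forall i, near0 (fun y => W y i i) (fun=> 0)) ->
  (forall i j k, near0 (fun y => pd i (fun y => W y j k) y +
     pd j (fun y => W y k i) y + pd k (fun y => W y i j) y) (fun=> 0)) ->
  exists A, near0 W (ext_d A) /\
    (forall j, an_at (A j) 0) /\
    forall Q, additive_family Q -> (forall i j, jet v Q (fun y => W y i j)) ->
      forall j, jet v (raise Q) (A j).
Proof.
move=> anW aW W0 cW.
have /choice[D' DP] : forall ij : 'I_l * 'I_l, exists D, hz v (fun y => W y ij.1 ij.2) D.
  by move=> [i j]; exact: hz_ex.
pose D i j := D' (i, j); have {}DP i j : hz v (fun y => W y i j) (D i j) by exact: DP (i, j).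
have [A [AE AQ]] : exists A, (forall i j a, D i j a =
       A j (madd a (munit i)) - A i (madd a (munit j))) /\
    forall Q, additive_family Q -> (forall i j a, Q (mdeg a) (D i j a)) ->
      forall j a, raise Q (mdeg a) (A j a).
  apply: poincare_coef.
  - move=> i j a; have := hz_unique (aW i j) (DP i j) (hz_near _ (hzZ (-1) (DP j i))).
    move=> ->; first by rewrite mulN1r.
    by apply: nearbyT => y; rewrite mulN1r.
  - by move=> i a; rewrite (hz_unique (W0 i) (DP i i) (hz0 v l)).
  - move=> i j k a.
    have := hzD (hzD (hz_pd i (DP j k)) (hz_pd j (DP k i))) (hz_pd k (DP i j)).
    by move=> /(hz_unique (cW i j k))/(_ (hz0 v l)) /funeqP/(_ a).
have [C [R [C0 R0 DCR]]] : exists C R : rat, [/\ 0 < C, 0 < R &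
    forall i j a, v (D i j a) <= C * R ^+ mdeg a].
  have /choice[C' /choice[R' CR]] : forall ij : 'I_l * 'I_l, exists C R : rat,
    [/\ 0 < C, 0 < R & forall a, v (D ij.1 ij.2 a) <= C * R ^+ mdeg a].
    by move=> [i j]; exact: hz_bound (DP i j).
  have [C C0 CC'] := finite_max C'; have [R R0 RR'] := finite_max R'.
  exists C, R; split=> // i j a; case: (CR (i, j)) => C'0 R'0 le; apply: le_trans (le a) _.
  apply: ler_pM; rewrite ?exprn_ge0 ?(ltW C'0) ?(ltW R'0) ?CC' //.
  by rewrite lerXn2r ?qualifE /= ?(ltW R0) ?(ltW R'0) ?RR'.
(* Geometric growth is itself an additive condition; this is what makes the formal primitive
   converge. *)
have addCR : additive_family (fun n x => v x <= C * R ^+ n).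
  move=> n; split=> [|x y]; last exact: uabsB_le.
  by rewrite uabs0 mulr_ge0 ?exprn_ge0 ?ltW.
have /choice[f fA] : forall j, exists f, hz v f (A j).
  (* C/R because the condition on order n + 1 is the bound C R^n. *)
  move=> j; apply: (@hz_realize _ _ _ _ (C / R) R); rewrite ?divr_ge0 ?ltW // => a.
  have := AQ _ addCR DCR j a; case: (mdeg a) => [|n] /=.
    by move=> ->; rewrite uabs0 mulr1 divr_ge0 ?ltW.
  by rewrite exprS mulrA divfK // gt_eqF.
exists f; split; last split.
- suff : nearby 0 (fun y => forall i j, W y i j = ext_d f y i j).
    by apply: nearby_imp => y H; apply/matrixP.
  apply: nearby_all => i; apply: nearby_all => j.
  have := hzB (hz_pd i (fA j)) (hz_pd j (fA i)).
  rewrite (_ : (fun a => _) = D i j); last by apply/funext => a; rewrite AE.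
  move=> /(hz_inj (DP i j)); apply: nearby_imp => y ->; by rewrite mxE.
- by move=> j; exact: hz_an (fA j).
- move=> Q addQ QW j; exists (A j) => //; apply: AQ => // i k a.
  exact: jet_hz (QW i k) (DP i k) a.
Qed.

End Forms.

(** * Darboux's theorem for integral germs *)

Section MatrixGerms.
Context (K : fieldType) (v : ultranorm K) (l : nat).
Local Notation an_at := (an_at v).
Local Notation pd := (pd v).
Local Notation nearby := (nearby v).
Local Notation vord := (vord v).
Local Notation intg := (intg v).

Definition mx_vord d m n (F : 'rV[K]_l -> 'M[K]_(m, n)) : Prop :=
  forall i j, vord d (fun y => F y i j).

Definition mx_intg m n (F : 'rV[K]_l -> 'M[K]_(m, n)) : Prop :=
  forall i j, intg (fun y => F y i j).

Lemma eq_jet Q (f g : 'rV[K]_l -> K) : f =1 g -> jet v Q f -> jet v Q g.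
Proof. by move=> fg; apply: jet_near; apply: nearbyT. Qed.

Lemma eq_vord d (f g : 'rV[K]_l -> K) : f =1 g -> vord d f -> vord d g.
Proof. exact: eq_jet. Qed.

Lemma intg_cst k : v k <= 1 -> intg (fun _ : 'rV[K]_l => k).
Proof.
move=> k1; have i0 : intg (fun _ : 'rV[K]_l => 0).
  by exists (fun=> 0) => [|a]; [exact: hz0|rewrite uabs0].
apply: jet_rec => [||i]; [exact: an_at_cst|by []|].
by apply: eq_jet i0 => y; rewrite (has_pdP (has_pd_cst v i k y)).
Qed.

Lemma intg_coord (i : 'I_l) : intg (fun y => y 0 i).
Proof.
apply: jet_rec => [||j]; [exact: an_at_coord|by rewrite mxE uabs0|].
apply: eq_jet (@intg_cst (i == j)%:R _) => [y|].
  by rewrite (has_pdP (has_pd_coord v j i y)).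
exact: uabs_nat.
Qed.

Lemma vord_le1 d (f : 'rV[K]_l -> K) : an_at f 0 -> f 0 = 0 -> (d <= 1)%N -> vord d f.
Proof.
move=> anf f0; case: d => [|[|d]] // _; first exact: vord0.
by apply: vordS => // i; apply: vord0; exact: an_at_pd.
Qed.

Lemma mx_vord_le d e m n (F : 'rV[K]_l -> 'M[K]_(m, n)) : (d <= e)%N ->
  mx_vord e F -> mx_vord d F.
Proof. by move=> de H i j; exact: vord_le de (H i j). Qed.

Lemma eq_mx_vord d m n (F G : 'rV[K]_l -> 'M[K]_(m, n)) : F =1 G ->
  mx_vord d F -> mx_vord d G.
Proof. by move=> FG H i j; apply: eq_vord (H i j) => y; rewrite FG. Qed.

Lemma near_mx_vord d m n (F G : 'rV[K]_l -> 'M[K]_(m, n)) :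
  nearby 0 (fun y => F y = G y) -> mx_vord d F -> mx_vord d G.
Proof. by move=> FG H i j; apply: jet_near (H i j); apply: nearby_imp FG => y ->. Qed.

Lemma mx_vordD d m n (F G : 'rV[K]_l -> 'M[K]_(m, n)) :
  mx_vord d F -> mx_vord d G -> mx_vord d (fun y => F y + G y).
Proof.
by move=> HF HG i j; apply: eq_vord (vordD (HF i j) (HG i j)) => y; rewrite mxE.
Qed.

Lemma mx_vordM d e k m n q (F : 'rV[K]_l -> 'M[K]_(m, n)) (G : 'rV[K]_l -> 'M[K]_(n, q)) :
  (k <= d + e)%N -> mx_vord d F -> mx_vord e G -> mx_vord k (fun y => F y *m G y).
Proof.
move=> kde HF HG i j.
apply: eq_vord (vord_sum (index_enum _) (fun h => vordM kde (HF i h) (HG h j))) => y.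
by rewrite mxE.
Qed.

Lemma mx_vordT d m n (F : 'rV[K]_l -> 'M[K]_(m, n)) :
  mx_vord d F -> mx_vord d (fun y => (F y)^T).
Proof. by move=> HF i j; apply: eq_vord (HF j i) => y; rewrite mxE. Qed.

Lemma mx_vord_cst m n (M : 'M[K]_(m, n)) : mx_vord 0 (fun=> M).
Proof. by move=> i j; apply: vord0; exact: an_at_cst. Qed.

Lemma mx_intgM m n q (F : 'rV[K]_l -> 'M[K]_(m, n)) (G : 'rV[K]_l -> 'M[K]_(n, q)) :
  mx_intg F -> mx_intg G -> mx_intg (fun y => F y *m G y).
Proof.
move=> HF HG i j.
apply: eq_jet (intg_sum (index_enum _) (fun h => intgM (HF i h) (HG h j))) => y.
by rewrite mxE.
Qed.

Lemma mx_intgT m n (F : 'rV[K]_l -> 'M[K]_(m, n)) :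
  mx_intg F -> mx_intg (fun y => (F y)^T).
Proof. by move=> HF i j; apply: eq_jet (HF j i) => y; rewrite mxE. Qed.

Lemma mx_intgB m n (F G : 'rV[K]_l -> 'M[K]_(m, n)) :
  mx_intg F -> mx_intg G -> mx_intg (fun y => F y - G y).
Proof.
by move=> HF HG i j; apply: eq_jet (intgB (HF i j) (HG i j)) => y; rewrite !mxE.
Qed.

Lemma mx_vord_eq0 m n (F : 'rV[K]_l -> 'M[K]_(m, n)) :
  (forall d, mx_vord d F) -> nearby 0 (fun y => F y = 0).
Proof.
move=> HF; suff : nearby 0 (fun y => forall i j, F y i j = 0).
  by apply: nearby_imp => y H; apply/matrixP => i j; rewrite H mxE.
by apply: nearby_all => i; apply: nearby_all => j; apply: vord_eq0 => d; exact: HF.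
Qed.

Lemma jac_vord d m (f : 'rV[K]_l -> 'rV[K]_m) :
  (forall j, vord d (fun y => f y 0 j)) -> mx_vord d.-1 (jac v f).
Proof.
by move=> fd i j; apply: eq_vord (vord_pd i (fd j)) => y; rewrite mxE.
Qed.

Lemma jac_intg m (f : 'rV[K]_l -> 'rV[K]_m) :
  (forall j, intg (fun y => f y 0 j)) -> mx_intg (jac v f).
Proof. by move=> fi i j; apply: eq_jet (intg_pd i (fi j)) => y; rewrite mxE. Qed.


Lemma jac_mulmxr m n (a : 'rV[K]_l -> 'rV[K]_m) (M : 'M[K]_(m, n)) y : an_map v a y ->
  jac v (fun z => a z *m M) y = jac v a y *m M.
Proof.
move=> ay; apply/matrixP => i j; rewrite !mxE.
have -> : (fun z => (a z *m M) 0 j) = (fun z => \sum_k M k j * a z 0 k).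
  by apply/funext => z; rewrite mxE; apply: eq_bigr => k _; rewrite mulrC.
rewrite pd_sum => [|k]; last exact: an_atZ.
by apply: eq_bigr => k _; rewrite pdZ // mxE mulrC.
Qed.

Lemma jacD m (f g : 'rV[K]_l -> 'rV[K]_m) y : an_map v f y -> an_map v g y ->
  jac v (fun z => f z + g z) y = jac v f y + jac v g y.
Proof.
move=> fy gy; apply/matrixP => i j; rewrite !mxE -pdD //.
by congr (pd i _ y); apply/funext => z; rewrite mxE.
Qed.

End MatrixGerms.

Section Darboux.
Context (K : fieldType) (v : ultranorm K) (l : nat).
Local Notation an_at := (an_at v).
Local Notation an_map := (an_map v).
Local Notation pd := (pd v).
Local Notation nearby := (nearby v).
Local Notation near0 f g := (nearby 0 (fun y => f y = g y)).
Local Notation vord := (vord v).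
Local Notation intg := (intg v).
Local Notation mx_vord := (mx_vord v).
Local Notation mx_intg := (mx_intg v).
Local Notation V := 'rV[K]_l.

Definition tangent_id (f : V -> V) : Prop :=
  [/\ f 0 = 0, forall j, intg (fun y => f y 0 j) &
      forall j, vord 2 (fun y => f y 0 j - y 0 j)].

Lemma tangent_id_an f : tangent_id f -> an_map f 0.
Proof. by move=> [_ fi _] j; exact: jet_an (fi j). Qed.

Lemma tangent_id_id : tangent_id id.
Proof.
split=> // j; first exact: intg_coord.
by apply: eq_vord (vord_zero v l 2) => y; rewrite subrr.
Qed.

Lemma map_limit (F : nat -> V -> V) : (forall k j, intg (fun y => F k y 0 j)) ->
  (forall k j, vord k.+1 (fun y => F k.+1 y 0 j - F k y 0 j)) ->
  exists2 G : V -> V, (forall j, intg (fun y => G y 0 j)) &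
    forall k j, vord k.+1 (fun y => G y 0 j - F k y 0 j).
Proof.
move=> Fi dF.
have /choice[g gP] : forall j, exists g, intg g /\
    forall k, vord k.+1 (fun y => g y - F k y 0 j).
  by move=> j; have [g ? ?] := intg_limit (Fi^~ j) (dF^~ j); exists g.
exists (fun y => \row_j g j y) => [j|k j].
  by apply: eq_jet (gP j).1 => y; rewrite mxE.
by apply: eq_vord ((gP j).2 k) => y; rewrite mxE.
Qed.

Lemma pull_intg (f : V -> V) (W : V -> 'M[K]_l) :
  (forall j, intg (fun y => f y 0 j)) -> f 0 = 0 -> mx_intg W -> mx_intg (pull v f W).
Proof.
move=> fi f0 Wi; apply: mx_intgM; last by apply: mx_intgT; exact: jac_intg.
apply: mx_intgM; first exact: jac_intg.
by move=> i j; exact: (intg_comp fi f0 (Wi i j)).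
Qed.

(** Needed to pass to the limit of the iteration; one order is lost to the Jacobians. *)
Lemma pull_vord_diff d (f g : V -> V) (W : V -> 'M[K]_l) :
  (forall j, intg (fun y => f y 0 j)) -> f 0 = 0 ->
  (forall j, intg (fun y => g y 0 j)) -> g 0 = 0 -> mx_intg W ->
  (forall j, vord d.+1 (fun y => f y 0 j - g y 0 j)) ->
  mx_vord d (fun y => pull v f W y - pull v g W y).
Proof.
move=> fi f0 gi g0 Wi fg.
have v0 m n (F : V -> 'M[K]_(m, n)) : mx_intg F -> mx_vord 0 F.
  by move=> Fi i j; apply: vord0; exact: jet_an (Fi i j).
have Jf := v0 _ _ _ (jac_intg fi); have Jg := v0 _ _ _ (jac_intg gi).
have anf j := jet_an (fi j); have ang j := jet_an (gi j).
have Wf : mx_vord 0 (W \o f).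
  by apply: v0 => i j; exact: (intg_comp fi f0 (Wi i j)).
have Wg : mx_vord 0 (W \o g).
  by apply: v0 => i j; exact: (intg_comp gi g0 (Wi i j)).
have Jfg : mx_vord d (fun y => jac v f y - jac v g y).
  move=> i j; have := vord_pd i (fg j); apply: jet_near.
  have := nearby_and (an_at_nearby (anf j)) (an_at_nearby (ang j)).
  by apply: nearby_imp => y [fy gy]; rewrite pdB // !mxE.
have Wfg : mx_vord d (fun y => W (f y) - W (g y)).
  move=> i j; apply: eq_vord (@vord_comp_diff _ v _ _ d d 0 f g (fun y => W y i j)
    anf f0 ang g0 (jet_an (Wi i j)) _ _ _) => [y|||k]; first by rewrite !mxE.
  - by rewrite addn0.
  - by move=> k; apply: vord_le (fg k).
  - by apply: vord0; apply: an_at_pd; exact: jet_an (Wi i j).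
pose D y := jac v f y - jac v g y.
(* Telescoping: the three factors of the pull-back are exchanged one at a time. *)
apply: (@eq_mx_vord _ _ _ _ _ _ (fun y => D y *m W (f y) *m (jac v f y)^T +
   (jac v g y *m (W (f y) - W (g y)) *m (jac v f y)^T +
    jac v g y *m W (g y) *m (D y)^T))) => [y|].
  have DT : (D y)^T = (jac v f y)^T - (jac v g y)^T by rewrite /D linearB.
  rewrite DT /pull /D !(mulmxBl, mulmxBr).
  by rewrite addrA subrKA addrA subrK.
apply: mx_vordD; last apply: mx_vordD.
- apply: (@mx_vordM _ _ _ d 0); rewrite ?addn0 //; last exact: mx_vordT.
  by apply: (@mx_vordM _ _ _ d 0); rewrite ?addn0.
- apply: (@mx_vordM _ _ _ d 0); rewrite ?addn0 //; last exact: mx_vordT.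
  exact: (@mx_vordM _ _ _ 0 d).
- apply: (@mx_vordM _ _ _ 0 d) => //; last exact: mx_vordT.
  exact: (@mx_vordM _ _ _ 0 0).
Qed.

(** * Moser's iteration towards a common constant form *)

Section Iteration.
Context (J Ji : 'M[K]_l) (W0 W1 : V -> 'M[K]_l) (A0 A1 : 'I_l -> V -> K).
Hypothesis JT : J^T = - J.
Hypothesis JK : Ji *m J = 1%:M.
Hypothesis Ji_le1 : forall i j, v (Ji i j) <= 1.
Hypothesis W0i : mx_intg W0.
Hypothesis W1i : mx_intg W1.
Hypothesis W00 : W0 0 = J.
Hypothesis W10 : W1 0 = J.
Hypothesis A0an : forall j, an_at (A0 j) 0.
Hypothesis A1an : forall j, an_at (A1 j) 0.
Hypothesis dA0 : near0 W0 (ext_d v A0).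
Hypothesis dA1 : near0 W1 (ext_d v A1).

Definition matches d (f : V -> V) : Prop :=
  tangent_id f /\ mx_vord d (fun y => pull v f W1 y - W0 y).

(** The pull-back of [A1] minus [A0] is a potential. It certifies closedness only, as no size or
    order of vanishing is known for it. *)
Lemma error_primitive f : tangent_id f ->
  exists B, (forall j, an_at (B j) 0) /\
    near0 (fun y => pull v f W1 y - W0 y) (ext_d v B).
Proof.
move=> fid; have anf := tangent_id_an fid; have [f0 fi _] := fid.
have A1f k : nearby 0 (fun y => an_at (A1 k) (f y)).
  by apply: nearby_comp => //; rewrite f0; exact: an_at_nearby.
have pan y j : an_map f y -> (forall k, an_at (A1 k) (f y)) -> an_at (pull1 v f A1 j) y.
  move=> fy A1y; apply: an_at_sum => k; apply: an_atM; first exact: an_at_pd.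
  exact: (an_at_comp fy (A1y k)).
exists (fun j y => pull1 v f A1 j y - A0 j y); split=> [j|].
  by apply: an_atB => //; apply: pan => // k; rewrite f0.
have dA1f : nearby 0 (fun y => W1 (f y) = ext_d v A1 (f y)).
  by apply: (nearby_comp (P := fun z => W1 z = ext_d v A1 z)) => //; rewrite f0.
have := nearby_and (nearby_and (nearby_and dA0 dA1f) (an_map_nearby anf))
  (nearby_and (nearby_all A1f) (nearby_all (fun j => an_at_nearby (A0an j)))).
apply: nearby_imp => y [[[E0 E1] fy] [A1y A0y]].
rewrite ext_dB //; last by move=> j; exact: pan.
by rewrite ext_d_pull1 // /pull E1 E0.
Qed.

(** The Poincare lemma applied to the error itself, with [Q] taken once as integrality and once as
    vanishing below order [d]. *)
Lemma error_potential d f : matches d f ->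
  exists al : 'I_l -> V -> K, [/\ near0 (fun y => pull v f W1 y - W0 y) (ext_d v al),
    forall j, intg (al j) & forall j, vord d.+1 (al j)].
Proof.
move=> [fid fd]; have [B [Ban dB]] := error_primitive fid; have [f0 fi _] := fid.
have Bn := nearby_all (fun j => an_at_nearby (Ban j)).
have [||||al [dal [_ alQ]]] := @poincare _ v l (fun y => pull v f W1 y - W0 y).
- by move=> i j; exact: jet_an (fd i j).
- by move=> i j; apply: nearby_imp dB => y ->; rewrite !mxE opprB.
- by move=> i; apply: nearby_imp dB => y ->; rewrite !mxE subrr.
- move=> i j k; have := nearby_and (nearby_near dB) Bn.
  apply: nearby_imp => y [dBy By]; rewrite -[RHS](ext_d_closed i j k By).
  have E i' j' k' : pd i' (fun y => (pull v f W1 y - W0 y) j' k') y =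
      pd i' (fun y => ext_d v B y j' k') y.
    by apply: pd_near; apply: nearby_imp dBy => z ->.
  by rewrite !E.
exists al; split=> // j.
  apply: (@jet_imp _ _ _ (raise (fun _ x => v x <= 1))) => [[|n] x //= ->|].
    by rewrite uabs0.
  apply: alQ => [n|]; first by rewrite uabs0; split=> // x y; exact: uabsB_le.
  by apply: mx_intgB W0i; exact: pull_intg.
apply: (@jet_imp _ _ _ (raise (fun n x => (n < d)%N -> x = 0))) => [[|n] x //=|].
apply: alQ => // n; split=> // x y x0 y0 nd; by rewrite x0 // y0 // subr0.
Qed.

Lemma matches_step d f : (0 < d)%N -> matches d f ->
  exists2 g, matches d.+1 g & forall j, vord d.+1 (fun y => g y 0 j - f y 0 j).
Proof.
move=> d0 fm; have [al [dal ali ald]] := error_potential fm.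
have [[f0 fi fid] fd] := fm.
(* The Jacobian [X] of [xi] cancels the error: [error + X J + J X^T = 0]. *)
pose a y := \row_j al j y; pose xi y := a y *m (- Ji); pose eta y := y + xi y.
have ai : mx_intg a by move=> i j; apply: eq_jet (ali j) => y; rewrite mxE.
have ad : mx_vord d.+1 a by move=> i j; apply: eq_vord (ald j) => y; rewrite mxE.
have Jii : mx_intg (fun _ : V => - Ji).
  by move=> i j; apply: intg_cst; rewrite mxE uabsN.
have xii : mx_intg xi by apply: mx_intgM.
have xid : mx_vord d.+1 xi.
  by apply: (@mx_vordM _ _ _ d.+1 0); rewrite ?addn0 //; exact: mx_vord_cst.
have xi0 : xi 0 = 0 by apply/rowP => j; rewrite (jet_val (xid 0 j)) // mxE.
have eta0 : eta 0 = 0 by rewrite /eta xi0 addr0.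
have etai j : intg (fun y => eta y 0 j).
  by apply: eq_jet (intgD (intg_coord v j) (xii 0 j)) => y; rewrite [RHS]mxE.
have etad j : vord d.+1 (fun y => eta y 0 j - y 0 j).
  by apply: eq_vord (xid 0 j) => y; rewrite [eta y 0 j]mxE addrC addKr.
have aneta j := jet_an (etai j).
have anxi : an_map xi 0 by move=> j; exact: jet_an (xii 0 j).
have ana : an_map a 0 by move=> j; exact: jet_an (ai 0 j).
have anf : an_map f 0 by move=> j; exact: jet_an (fi j).
have gfd j : vord d.+1 (fun y => f (eta y) 0 j - f y 0 j).
  apply: (@vord_comp_diff _ v _ _ d.+1 d.+1 0 eta id (fun y => f y 0 j)) => //.
  - exact: an_map_id.
  - by rewrite addn0.
  - by move=> k; apply: vord0; apply: an_at_pd.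
exists (f \o eta) => //; split.
  split=> /= [|j|j]; first by rewrite eta0.
    exact: (intg_comp etai eta0 (fi j)).
  apply: eq_vord (vordD (vord_le _ (gfd j)) (fid j)) => //= y.
  by rewrite addrA subrK.
pose B := pull v f W1; pose X := jac v xi.
have Bi : mx_intg B by apply: pull_intg.
have B0 : B 0 = J.
  apply/matrixP => i j; apply/eqP; rewrite -subr_eq0 -W00; apply/eqP.
  by have := jet_val (fd i j); rewrite !mxE; apply.
have Betai i j : intg (fun y => B (eta y) i j) by exact: (intg_comp etai eta0 (Bi i j)).
(* Expansion of (1 + X) B(eta) (1 + X)^T - W0 after the first order part has cancelled; each of the
   four terms has order at least d + 1. *)
apply: (@near_mx_vord _ _ _ _ _ _ (fun y => (B (eta y) - B y) + (X y *m (B (eta y) - J)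
  + ((B (eta y) - J) *m (X y)^T + X y *m B (eta y) *m (X y)^T)))).
  have anfe : nearby 0 (fun y => an_map f (eta y)).
    by apply: nearby_comp => //; rewrite eta0; exact: an_map_nearby.
  have := nearby_and (nearby_and dal (an_map_nearby anxi))
    (nearby_and (an_map_nearby ana) anfe).
  apply: nearby_imp => y [[dy xiy] [ay fy]].
  have etay : an_map eta y.
    move=> j; apply: an_at_near (an_atD (an_at_coord v j y) (xiy j)).
    by apply: nearbyT => z; rewrite [RHS]mxE.
  rewrite pull_comp // -/B /pull.
  have -> : jac v eta y = 1%:M + X y.
    by rewrite /eta jacD //; [rewrite jac_id|exact: an_map_id].
  have XE : X y = - (jac v a y *m Ji) by rewrite /X jac_mulmxr // mulmxN.
  have XJ : X y *m J = - jac v a y by rewrite XE mulNmx -mulmxA JK mulmx1.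
  have JJi : J *m Ji^T = - 1%:M.
    by rewrite -[J]trmxK JT -trmx_mul mulmxN JK linearN /= trmx1.
  have JX : J *m (X y)^T = (jac v a y)^T.
    rewrite XE linearN /= trmx_mul mulmxN mulmxA JJi mulNmx mul1mx opprK //.
  (* The error is jac a minus its transpose, while X J = - jac a and J X^T is the transpose of jac
     a. *)
  have lin : B y - W0 y + X y *m J + J *m (X y)^T = 0.
    rewrite /B dy XJ JX; apply/matrixP => i j; rewrite !mxE.
    have al_row k : (fun z => a z 0 k) = al k by apply/funext => z; rewrite mxE.
    rewrite !al_row; ring.
  have E : W0 y = B y + X y *m J + J *m (X y)^T.
    apply/eqP; rewrite eq_sym -subr_eq0; apply/eqP; rewrite -[RHS]lin.
    move: (B y) (W0 y) (X y *m J) (J *m (X y)^T) => b w p q.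
    by apply/matrixP => i j; rewrite !mxE; ring.
  have T1 : (1%:M + X y)^T = 1%:M + (X y)^T by rewrite linearD /= trmx1.
  rewrite E T1 !(mulmxDl, mulmxDr, mulmxBl, mulmxBr) !mul1mx !mulmx1.
  move: (B (eta y)) => P; rewrite mulNmx mulmxN.
  move: (X y *m P *m (X y)^T) (P *m (X y)^T) (X y *m P) (X y *m J) (J *m (X y)^T) (B y).
  by move=> a1 a2 a3 a4 a5 a6; apply/matrixP => i j; rewrite !mxE; ring.
have Xd : mx_vord d X.
  exact: (@jac_vord _ v _ d.+1 _ xi (xid 0)).
have Bev : mx_vord 0 (B \o eta) by move=> i j; apply: vord0; exact: jet_an (Betai i j).
have BJ : mx_vord 1 (fun y => B (eta y) - J).
  move=> i j; apply: vord_le1 => //; last by rewrite eta0 B0 subrr mxE.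
  apply: an_at_near (an_atB (jet_an (Betai i j)) (an_at_cst v (J i j) 0)).
  by apply: nearbyT => y; rewrite !mxE.
apply: mx_vordD; last apply: mx_vordD; last apply: mx_vordD.
- move=> i j; apply: eq_vord (@vord_comp_diff _ v _ _ d.+1 d.+1 0 eta id
    (fun y => B y i j) aneta eta0 _ _ _ _ _ _) => [y||||||] //=.
  + by rewrite !mxE.
  + exact: an_map_id.
  + exact: jet_an (Bi i j).
  + by rewrite addn0.
  + by move=> k; apply: vord0; apply: an_at_pd; exact: jet_an (Bi i j).
- by apply: (mx_vordM _ Xd BJ); rewrite addn1.
- by apply: (mx_vordM _ BJ (mx_vordT Xd)); rewrite add1n.
(* Two factors of order [d] give 2d >= d + 1 since [d] is positive; this is why the iteration starts
   from order 1. *)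
- apply: (mx_vordM _ (mx_vordM (leqnn _) Xd Bev) (mx_vordT Xd)).
  by rewrite addn0 -addn1 leq_add2l.
Qed.

Lemma matches_id : matches 1 id.
Proof.
split; first exact: tangent_id_id.
apply: (@eq_mx_vord _ _ _ _ _ _ (fun y => W1 y - W0 y)) => [y|i j].
  by rewrite /pull jac_id trmx1 mulmx1 mul1mx.
apply: vord_le1 => //; last by rewrite W00 W10 subrr mxE.
apply: an_at_near (an_atB (jet_an (W1i i j)) (jet_an (W0i i j))).
by apply: nearbyT => y; rewrite !mxE.
Qed.

Lemma formal_darboux : exists2 f, tangent_id f & near0 (pull v f W1) W0.
Proof.
(* The improvement step is made a total function, returning [f] itself where the hypothesis fails,
   in order to be iterated. *)
have /choice[N NP] : forall kf : nat * (V -> V), exists g, matches kf.1.+1 kf.2 ->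
    matches kf.1.+2 g /\ forall j, vord kf.1.+2 (fun y => g y 0 j - kf.2 y 0 j).
  move=> [k f]; have [fm|nfm] := pselect (matches k.+1 f); last by exists f.
  by have [g ? ?] := matches_step (ltn0Sn k) fm; exists g.
pose F := fix F k : V -> V := if k is k'.+1 then N (k', F k') else id.
have Fm k : matches k.+1 (F k).
  elim: k => [|k IH]; first exact: matches_id.
  by have := NP (k, F k) IH; case.
have dF k j : vord k.+2 (fun y => F k.+1 y 0 j - F k y 0 j).
  by have := NP (k, F k) (Fm k); case.
have Fi k j : intg (fun y => F k y 0 j) by case: (Fm k) => -[].
have F0 k : F k 0 = 0 by case: (Fm k) => -[].
have [G Gi dG] := map_limit Fi (fun k j => vord_le (leqnSn _) (dF k j)).
have G0 : G 0 = 0.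
  apply/rowP => j; have := jet_val (dG 0%N j) (ltn0Sn 0) => /eqP.
  by rewrite F0 mxE subr0 => /eqP.
exists G.
  split=> // j; have [_ _ F2] := (Fm 1%N).1.
  by apply: eq_vord (vordD (dG 1%N j) (F2 j)) => y; rewrite addrA subrK.
(* [G] and [F d] agree below order d + 1, so their pull-backs agree below order [d], where that of
   [F d] has no error. *)
have Z : nearby 0 (fun y => pull v G W1 y - W0 y = 0).
  apply: mx_vord_eq0 => d.
  apply: (@eq_mx_vord _ _ _ _ _ _ (fun y => (pull v G W1 y - pull v (F d) W1 y)
      + (pull v (F d) W1 y - W0 y))) => [y|]; first by rewrite addrA subrK.
  apply: mx_vordD; first exact: pull_vord_diff.
  exact: mx_vord_le (Fm d).2.
by apply: nearby_imp Z => y /eqP; rewrite subr_eq0 => /eqP.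
Qed.

End Iteration.

(** The map being iterated is a contraction for the order of vanishing: xi = f - id has a gradient
    vanishing at 0, so each pass gains one order. *)
Lemma tangent_id_rinv f : tangent_id f ->
  exists2 g, tangent_id g & near0 (f \o g) id.
Proof.
move=> [f0 fi fd].
pose xi j y := f y 0 j - y 0 j.
have xii j : intg (xi j) by apply: intgB => //; exact: intg_coord.
pose G := fix G k : V -> V := if k is k'.+1 then (fun y : V => \row_j (y 0 j - xi j (G k' y))) else id.
have xi0 j : xi j 0 = 0 by rewrite /xi f0 !mxE subrr.
have G0 k : G k 0 = 0.
  elim: k => //= k IH; apply/rowP => j; by rewrite !mxE IH xi0 subr0.
have Gi k j : intg (fun y => G k y 0 j).
  elim: k j => [|k IH] j; first exact: intg_coord.
  apply: eq_jet (intgB (intg_coord v j) (intg_comp IH (G0 k) (xii j))) => y.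
  by rewrite /= mxE.
have anG k j := jet_an (Gi k j).
have dxi n d e k k' j : (n <= d + e)%N -> (e <= 1)%N ->
    (forall i, vord d (fun y => G k y 0 i - G k' y 0 i)) ->
    vord n (fun y => xi j (G k y) - xi j (G k' y)).
  move=> nde e1 dG; apply: (vord_comp_diff (anG k) (G0 k) (anG k') (G0 k') _ nde dG).
    exact: jet_an (xii j).
  by move=> i; apply: vord_le e1 _; exact: (vord_pd i (fd j)).
have dG k j : vord k.+2 (fun y => G k.+1 y 0 j - G k y 0 j).
  elim: k j => [|k IH] j.
    apply: eq_vord (vordB (vord_zero v l 2) (fd j)) => y /=.
    by rewrite mxE /xi; ring.
  apply: eq_vord (vordB (vord_zero v l k.+3) (dxi k.+3 k.+2 1%N k.+1 k j _ _ IH)) => [y||] //.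
    by rewrite /= !mxE; ring.
  by rewrite addn1.
have [g gi dg] := map_limit Gi (fun k j => vord_le (leqnSn _) (dG k j)).
have g0 : g 0 = 0.
  apply/rowP => j; have := jet_val (dg 0%N j) (ltn0Sn 0) => /eqP.
  by rewrite G0 mxE subr0 => /eqP.
exists g.
  split=> // j.
  have := vordD (dg 1%N j) (dG 0%N j); apply: eq_vord => y /=; ring.
have Z : nearby 0 (fun y => f (g y) - y = 0).
  apply: mx_vord_eq0 => d i j; rewrite (ord1 i).
  have h : vord d (fun y => xi j (g y) - xi j (G d y)).
    apply: (@vord_comp_diff _ v _ _ d d 0) => //.
    - by move=> k; exact: jet_an (gi k).
    - exact: jet_an (xii j).
    - by rewrite addn0.
    - by move=> k; apply: vord_le (dg d k).
    - by move=> k; apply: vord0; apply: an_at_pd; exact: jet_an (xii j).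
  have h' : vord d (fun y => g y 0 j - G d.+1 y 0 j).
    by apply: vord_le (dg d.+1 j); rewrite ltnW // ltnW.
  apply: eq_vord (vordD h' h) => y; rewrite /= !mxE /xi; ring.
by apply: nearby_imp Z => y /eqP; rewrite subr_eq0 => /eqP.
Qed.

(** The right inverse [g] has a right inverse [h] of its own; near 0 then h = f g h = f, so [g] is
    also a left inverse. *)
Lemma tangent_id_inv f : tangent_id f ->
  exists2 g, tangent_id g & near0 (f \o g) id /\ near0 (g \o f) id.
Proof.
move=> fid; have [g gid fg] := tangent_id_rinv fid.
have [h hid gh] := tangent_id_rinv gid.
exists g => //; split=> //.
have [h0 _ _] := hid; have anh := tangent_id_an hid.
have fgh : nearby 0 (fun y => f (g (h y)) = h y).
  by apply: (nearby_comp (P := fun z => f (g z) = z)) => //; rewrite h0.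
have := nearby_and fgh gh; apply: nearby_imp => y [E1 E2] /=.
by move: E1; rewrite /= in E2; rewrite E2 => ->.
Qed.

End Darboux.

(** * Normal form of skew-symmetric matrices *)

Section SkewNormalForm.
Context (K : fieldType).
Hypothesis two_neq0 : 2%:R != 0 :> K.

(** The matrix with rows (0, 1) and (-1, 0). *)
Definition J2 : 'M[K]_2 := \matrix_(i, j) ((j : nat)%:R - (i : nat)%:R).

Lemma J2T : J2^T = - J2.
Proof. by apply/matrixP => i j; rewrite !mxE opprB. Qed.

Lemma J2J2 : J2 *m J2 = - 1%:M.
Proof.
apply/matrixP => i j; rewrite !mxE big_ord_recl big_ord1 !mxE.
by case: i => -[|[|i]] // ?; case: j => -[|[|j]] // ?; rewrite /= ?addn0 ?mulr0n ?mulr1n; ring.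
Qed.

Lemma skew_congr l (P A : 'M[K]_l) : A^T = - A -> (P *m A *m P^T)^T = - (P *m A *m P^T).
Proof. by move=> AT; rewrite !trmx_mul trmxK AT mulNmx mulmxN mulmxA. Qed.

Lemma skew_diag l (A : 'M[K]_l) i : A^T = - A -> A i i = 0.
Proof.
move=> /matrixP/(_ i i); rewrite !mxE => /eqP; rewrite -addr_eq0 -mulr2n.
by rewrite -mulr_natl mulf_eq0 (negbTE two_neq0) => /eqP.
Qed.

(** Invertibility provides a nonzero entry in the first row; it is off the diagonal by skew
    symmetry, and a transposition brings it into the second column. *)
Lemma skew_pivot l (A : 'M[K]_(2 + l)) : A^T = - A -> A \in unitmx ->
  exists2 P, P \in unitmx & exists2 a, a != 0 & ulsubmx (P *m A *m P^T) = a *: J2.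
Proof.
move=> AT uA.
pose o0 : 'I_(2 + l) := lshift l ord0; pose o1 : 'I_(2 + l) := lshift l (inord 1).
have [j Aj] : exists j, A o0 j != 0.
  apply/existsP; apply: contraLR uA; rewrite negb_exists => /forallP A0.
  rewrite unitmxE (expand_det_row A o0) big1 ?unitr0 // => j _.
  by have := A0 j; rewrite negbK => /eqP ->; rewrite mul0r.
have j0 : j != o0 by apply: contraNneq Aj => ->; rewrite skew_diag.
pose s := tperm o1 j; exists (perm_mx s); first exact: unitmx_perm.
exists (A o0 j) => //.
have E i k : (perm_mx s *m A *m (perm_mx s)^T) i k = A (s i) (s k).
  by rewrite tr_perm_mx -row_permE -[s in X in perm_mx X]invgK -col_permE !mxE invgK.
have s0 : s o0 = o0 by rewrite tpermD // eq_sym // -val_eqE /= inordK.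
have s1 : s o1 = j by rewrite tpermL.
have AC i k : A i k = - A k i by have /matrixP/(_ k i) := AT; rewrite !mxE.
have lE (i : 'I_2) : lshift l i = if i == ord0 then o0 else o1.
  by case: eqP => [->//|i0]; congr lshift; apply: val_inj; rewrite /= inordK //;
    case: i i0 => -[|[|i]] // ? [] ; apply: val_inj.
have ulE (B : 'M[K]_(2 + l)) i k : ulsubmx B i k = B (lshift l i) (lshift l k).
  by rewrite !mxE.
apply/matrixP => i k; rewrite ulE E !lE !mxE.
case: i => -[|[|i]] // li; case: k => -[|[|k]] // lk; rewrite -?val_eqE /= ?s0 ?s1.
- by rewrite skew_diag // subrr mulr0.
- by rewrite subr0 mulr1.
- by rewrite sub0r mulrN mulr1 AC.
- by rewrite skew_diag // subrr mulr0.
Qed.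

Lemma skew_split l (A : 'M[K]_(2 + l)) : A^T = - A -> A \in unitmx ->
  exists2 P, P \in unitmx & exists D : 'M[K]_l, [/\ D^T = - D, D \in unitmx &
    P *m A *m P^T = block_mx J2 0 0 D].
Proof.
move=> AT uA; have [P0 uP0 [a a0 ulE]] := skew_pivot AT uA.
set B := P0 *m A *m P0^T in ulE.
have BT : B^T = - B by exact: skew_congr.
have uB : B \in unitmx by rewrite !unitmx_mul unitmx_tr uP0 uA.
pose Y := ursubmx B.
have dlE : dlsubmx B = - Y^T.
  by rewrite /Y trmx_ursub BT; apply/matrixP => i j; rewrite !mxE opprK.
pose D0 := drsubmx B.
have BE : B = block_mx (a *: J2) Y (- Y^T) D0 by rewrite -ulE -dlE submxK.
(* A diagonal congruence multiplies [J2] by its determinant; putting all of a^-1 into one entry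
   avoids a square root. *)
pose E : 'M[K]_2 := \matrix_(i, j) (if i == j then if i == ord0 then a^-1 else 1 else 0).
(* The inverse of a J2 is - a^-1 J2, so [L] clears the off-diagonal blocks and leaves the Schur
   complement [D]. *)
pose L : 'M[K]_(2 + l) := block_mx 1%:M 0 (- a^-1 *: (Y^T *m J2)) 1%:M.
pose M : 'M[K]_(2 + l) := block_mx E 0 0 1%:M.
have EJ : E *m (a *: J2) *m E^T = J2.
  apply/matrixP => i j; rewrite !mxE !big_ord_recl !big_ord0 !mxE !big_ord_recl !big_ord0 !mxE.
  case: i => -[|[|i]] // li; case: j => -[|[|j]] // lj; rewrite -?val_eqE /= /bump /= ?addn0;
    by field.
have uE : E \in unitmx.
  apply: contraT => nuE; have := congr1 determinant EJ.
  rewrite !det_mulmx; move: nuE; rewrite unitmxE unitfE negbK => /eqP ->.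
  rewrite !mul0r => d0; have := congr1 determinant J2J2; rewrite det_mulmx -d0 mul0r.
  rewrite -scalemx1 -scaleN1r scalerA mulr1 detZ det1 mulr1 => /eqP.
  by rewrite eq_sym expf_eq0 /= oppr_eq0 oner_eq0.
have uL : L \in unitmx by rewrite unitmxE det_lblock !det1 mulr1 unitr1.
have uM : M \in unitmx by rewrite unitmxE det_lblock det1 mulr1 -unitmxE.
exists (M *m L *m P0); first by rewrite !unitmx_mul uM uL.
set D := - a^-1 *: (Y^T *m J2) *m Y + D0.
have LB : L *m B *m L^T = block_mx (a *: J2) 0 0 D.
  rewrite BE /L tr_block_mx !trmx0 !trmx1 linearZ /= trmx_mul trmxK J2T.
  rewrite !mulmx_block !mul1mx !mul0mx !mulmx0 !mulmx1 !addr0.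
  have -> : - a^-1 *: (Y^T *m J2) *m (a *: J2) + - Y^T = 0.
    rewrite -scalemxAl -scalemxAr scalerA -mulmxA J2J2 mulmxN mulmx1 mulNr mulVf //.
    by rewrite scaleN1r opprK subrr.
  rewrite mul0mx add0r; congr block_mx.
  rewrite mulNmx scalerN scaleNr opprK -scalemxAr -scalemxAl scalerA mulVf // scale1r.
  by rewrite mulmxA J2J2 mulNmx mul1mx addNr.
have PE : (M *m L *m P0) *m A *m (M *m L *m P0)^T = block_mx J2 0 0 D.
  transitivity (M *m (L *m B *m L^T) *m M^T); first by rewrite /B !trmx_mul !mulmxA.
  rewrite LB /M tr_block_mx !trmx0 trmx1 !mulmx_block.
  by rewrite !(mulmx0, mul0mx, mul1mx, mulmx1, addr0, add0r, trmx0, trmx1) EJ.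
exists D; split=> //.
- have := skew_congr (M *m L *m P0) AT; rewrite PE tr_block_mx opp_block_mx.
  by case/eq_block_mx.
- have : (M *m L *m P0) *m A *m (M *m L *m P0)^T \in unitmx.
    by rewrite !unitmx_mul unitmx_tr !unitmx_mul uM uL uP0 uA.
  by rewrite PE !unitmxE det_lblock unitrM => /andP[].
Qed.

(** [J] and [Ji] are chosen before [A]: depending on the size alone, they serve both symplectic
    forms, and their entries have absolute value at most 1. *)
Lemma skew_normal_form l : exists J Ji : 'M[K]_l, forall A : 'M[K]_l,
  A^T = - A -> A \in unitmx ->
  [/\ forall i j, J i j \in [:: 0; 1; -1], forall i j, Ji i j \in [:: 0; 1; -1],
      J^T = - J, Ji *m J = 1%:M & exists2 P, P \in unitmx & P *m A *m P^T = J].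
Proof.
elim/ltn_ind: l => -[|[|l]] IH.
- exists 0, 0 => A _ _; split; try by move=> -[].
  + by apply/matrixP => -[].
  + by apply/matrixP => -[].
  + by exists 1%:M; [exact: unitmx1|apply/matrixP => -[]].
(* In size 1 a skew-symmetric matrix is 0, hence never invertible, and placeholders suffice. *)
- exists 0, 0 => A AT; rewrite unitmxE det_mx11 skew_diag // unitr0 //.
have [J [Ji H]] := IH l (leqnSn l.+1).
exists (block_mx J2 0 0 J : 'M_(2 + l)), (block_mx (- J2) 0 0 Ji : 'M_(2 + l)) => A AT uA.
have [P uP [D [DT uD PE]]] := @skew_split l A AT uA.
have [Jm Jim JT JK [Q uQ QE]] := H D DT uD.
have J2m i j : J2 i j \in [:: 0; 1; -1] /\ (- J2) i j \in [:: 0; 1; -1].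
  rewrite !mxE; case: i => -[|[|i]] // li; case: j => -[|[|j]] // lj;
    by rewrite /= ?subr0 ?sub0r ?subrr ?oppr0 ?opprK !inE !eqxx ?orbT.
have z : (0 : K) \in [:: 0; 1; -1] by rewrite inE eqxx.
split.
- by move=> i j; rewrite !mxE; case: splitP => i' _; rewrite mxE; case: splitP => j' _;
    rewrite ?[(0 : 'M[K]_(_, _)) _ _]mxE //; case: (J2m i' j').
- by move=> i j; rewrite !mxE; case: splitP => i' _; rewrite mxE; case: splitP => j' _;
    rewrite ?[(0 : 'M[K]_(_, _)) _ _]mxE //; case: (J2m i' j').
- by rewrite [LHS](tr_block_mx J2 0 0 J) [RHS](opp_block_mx J2 0 0 J) J2T JT !trmx0 !oppr0.
- rewrite [LHS](mulmx_block (- J2) 0 0 Ji J2 0 0 J) mulNmx J2J2 opprK JK.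
  by rewrite !mulmx0 !mul0mx !addr0 add0r -scalar_mx_block.
- pose N : 'M[K]_(2 + l) := block_mx 1%:M 0 0 Q.
  have uN : N \in unitmx by rewrite unitmxE det_lblock det1 mul1r -unitmxE.
  exists (N *m P); first by rewrite unitmx_mul uN.
  transitivity (N *m (P *m A *m P^T) *m N^T); first by rewrite trmx_mul !mulmxA.
  rewrite PE /N tr_block_mx !mulmx_block.
  by rewrite !(mulmx0, mul0mx, mul1mx, mulmx1, addr0, add0r, trmx0, trmx1) QE.
Qed.

End SkewNormalForm.

(** * The field of p-adic numbers *)

Section QpUltranorm.
Context (p : nat) (pP : prime p).
Local Notation abs := (padic_abs p).
Local Notation QQp := (Qp pP).
Local Open Scope quotient_scope.

Lemma Qp_abs_pi_le (u : cauchy_seq pP) (e : rat) N :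
  (forall i, (N <= i)%N -> abs (u i) <= e) -> Qp_abs (\pi_QQp u) <= e.
Proof.
move=> ue; apply/ler_addgt0Pr => d d0; have [N' HN] := Qp_abs_pi u d0.
have := HN (maxn N N') (leq_maxr _ _); have := ue (maxn N N') (leq_maxl _ _).
rewrite ltr_norml => ue' /andP[]; lra.
Qed.

Lemma Qp_abs_pi_eq (u : cauchy_seq pP) (c : rat) N :
  (forall i, (N <= i)%N -> abs (u i) = c) -> Qp_abs (\pi_QQp u) = c.
Proof.
move=> uc; apply/eqP; rewrite -subr_eq0 -normr_le0; apply/ler_addgt0Pr => d d0.
have [N' HN] := Qp_abs_pi u d0; rewrite add0r ltW // distrC.
by have := HN (maxn N N') (leq_maxr _ _); rewrite uc ?leq_maxl.
Qed.

(** A Cauchy sequence that is not null has eventually constant absolute value, so multiplicativity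
    can be checked on late terms of representatives. *)
Lemma Qp_abs_eventually (x : QQp) : x != 0 ->
  exists N, forall i, (N <= i)%N -> abs (repr x i) = Qp_abs x.
Proof.
rewrite Qp_repr0 => /asboolPn u0.
have [N [c [c0 uN]]] := padic_cauchy_away pP (cauchy_seqP (repr x)) u0.
by exists N => i iN; rewrite uN // -[in RHS](reprK x) (Qp_abs_pi_eq uN).
Qed.

Lemma Qp_absM (x y : QQp) : Qp_abs (x * y) = Qp_abs x * Qp_abs y.
Proof.
have [->|x0] := eqVneq x 0; first by rewrite mul0r Qp_abs0 mul0r.
have [->|y0] := eqVneq y 0; first by rewrite mulr0 Qp_abs0 mulr0.
have [N xN] := Qp_abs_eventually x0; have [M yM] := Qp_abs_eventually y0.
rewrite -{1}[x]reprK -{1}[y]reprK -rmorphM /=.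
apply: (@Qp_abs_pi_eq _ _ (maxn N M)) => i; rewrite geq_max => /andP[iN iM].
by rewrite -(xN i iN) -(yM i iM) -padic_absM.
Qed.

Lemma Qp_abs_eq0E (x : QQp) : (Qp_abs x == 0) = (x == 0).
Proof.
apply/eqP/eqP => [/Qp_abs_eq0//|->]; exact: Qp_abs0.
Qed.

Lemma cst_cauchy (q : rat) : (fun _ : nat => q) \in cauchy_pred pP.
Proof.
by apply/asboolP => e e0; exists 0%N => i j _ _; rewrite subrr padic_abs0.
Qed.

Definition Qp_of_rat (q : rat) : QQp := \pi_QQp (CauchySeq (cst_cauchy q)).

Lemma Qp_abs_rat q : Qp_abs (Qp_of_rat q) = abs q.
Proof. exact: (@Qp_abs_pi_eq _ _ 0%N). Qed.

Lemma Qp_of_nat n : Qp_of_rat n%:R = n%:R.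
Proof.
rewrite /Qp_of_rat -(rmorph_nat \pi_QQp); congr (\pi_QQp _); apply/val_inj => /=.
elim: n => [|n IH]; first by [].
by apply/funext => i; rewrite -!natr1; have /funeqP/(_ i) := IH => ->.
Qed.

Lemma Qp_abs_nat n : Qp_abs (n%:R : QQp) = abs n%:R.
Proof. by rewrite -Qp_of_nat Qp_abs_rat. Qed.

Lemma Qp_ratB (u : cauchy_seq pP) (q : rat) (e : rat) N :
  (forall i, (N <= i)%N -> abs (u i - q) <= e) -> Qp_abs (\pi_QQp u - Qp_of_rat q) <= e.
Proof. by move=> ue; rewrite /Qp_of_rat -rmorphB /=; exact: (@Qp_abs_pi_le _ _ N). Qed.

Lemma Qp_dense (x : QQp) (e : rat) : 0 < e -> exists q, Qp_abs (x - Qp_of_rat q) <= e.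
Proof.
move=> e0; have [N HN] := cauchy_seqP (repr x) e0; exists (repr x N).
rewrite -{1}[x]reprK; apply: (@Qp_ratB _ _ _ N) => i iN.
by rewrite ltW // HN.
Qed.

Lemma Qp_of_ratB q r : Qp_of_rat q - Qp_of_rat r = Qp_of_rat (q - r).
Proof. by rewrite /Qp_of_rat -rmorphB; congr (\pi_QQp _); apply/val_inj. Qed.

Lemma Qp_absBC (x y : QQp) : Qp_abs (x - y) = Qp_abs (y - x).
Proof. by rewrite -Qp_absN opprB. Qed.

(** Rationals [q k] within 1/(k+1) of [u k] form a Cauchy sequence, whose class is the limit. *)
Lemma Qp_complete (u : nat -> QQp) :
  (forall e : rat, 0 < e -> exists N, forall i j, (N <= i)%N -> (N <= j)%N ->
    Qp_abs (u i - u j) < e) ->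
  exists s, forall e : rat, 0 < e -> exists N, forall i, (N <= i)%N -> Qp_abs (s - u i) < e.
Proof.
move=> uC; have k0 k : 0 < k.+1%:R^-1 :> rat by rewrite invr_gt0 ltr0Sn.
have [q qP] := choice (fun k => Qp_dense (u k) (k0 k)).
have van (d : rat) : 0 < d -> exists N, forall k, (N <= k)%N -> k.+1%:R^-1 < d.
  move=> d0; exists (Num.bound d^-1) => k Nk.
  have dN : d^-1 < (Num.bound d^-1)%:R by rewrite archi_boundP // invr_ge0 ltW.
  rewrite invf_plt ?posrE //; apply: lt_le_trans dN _.
  by rewrite ler_nat (leq_trans Nk).
have max_lt (x y : QQp) (e : rat) : Qp_abs x < e -> Qp_abs y < e -> Qp_abs (x + y) < e.
  by move=> xe ye; apply: le_lt_trans (Qp_absD x y) _; rewrite gt_max xe.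
have qC : q \in cauchy_pred pP.
  apply/asboolP => e e0; have [N HN] := uC e e0; have [M HM] := van e e0.
  exists (maxn N M) => i j; rewrite !geq_max => /andP[iN iM] /andP[jN jM].
  rewrite -Qp_abs_rat -Qp_of_ratB.
  have -> : Qp_of_rat (q i) - Qp_of_rat (q j) =
    (u i - u j) + ((Qp_of_rat (q i) - u i) + (u j - Qp_of_rat (q j))).
    by ring.
  apply: (max_lt); first exact: HN.
  apply: (max_lt); first by rewrite Qp_absBC (le_lt_trans (qP i)) ?HM.
  by rewrite (le_lt_trans (qP j)) ?HM.
exists (\pi_QQp (CauchySeq qC)) => e e0.
have e2 : 0 < e / 2 by rewrite divr_gt0.
have [N HN] := cauchy_seqP (CauchySeq qC) e2; have [M HM] := van e e0.
exists (maxn N M) => i; rewrite geq_max => /andP[iN iM].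
rewrite -(subrK (Qp_of_rat (q i)) (\pi_QQp _)) -addrA; apply: (max_lt).
  apply: (@le_lt_trans _ _ (e / 2)); last by rewrite ltr_pdivrMr // ltr_pMr // ltr1n.
  by apply: (@Qp_ratB _ _ _ N) => j jN; rewrite ltW // HN.
by rewrite Qp_absBC (le_lt_trans (qP i)) ?HM.
Qed.

Lemma padic_abs_nat n : (0 < n)%N -> abs n%:R = p%:R ^- logn p n.
Proof.
move=> n0; have n0' : (n%:Z) != 0 by rewrite eqz_nat -lt0n.
have := padic_abs_frac p n0' (oner_neq0 int).
by rewrite divr1 logn1 sub0r -exprnN => <-.
Qed.

(** Legendre's formula with a crude estimate; any linear bound on the valuation of n! suffices for
    [uabs_fact]. *)
Lemma logn_fact_le n : (logn p n`! <= n)%N.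
Proof.
rewrite logn_fact //.
(* Induction on the number of terms: the tail is the same sum for m/p, and 2 (m/p) <= m because p >=
   2. *)
have H N m : (\sum_(1 <= k < N.+1) m %/ p ^ k <= m)%N.
  elim: N m => [|N IH] m; first by rewrite big_geq.
  rewrite big_nat_recl // expn1.
  under eq_bigr => k _ do rewrite expnS divnMA.
  apply: (@leq_trans (m %/ p + m %/ p)); first by rewrite leq_add2l IH.
  rewrite addnn -muln2; apply: leq_trans (leq_trunc_div m p).
  by rewrite leq_mul2l prime_gt1 ?orbT.
exact: H.
Qed.

Lemma Qp_small (e : rat) : 0 < e -> exists2 t : QQp, t != 0 & Qp_abs t < e.
Proof.
move=> e0; have q1 : 0 <= (p%:R^-1 : rat) < 1.
  by rewrite invr_ge0 ler0n /= invf_lt1 ?ltr1n ?prime_gt1 // ltr0n prime_gt0.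
have [N /(_ N (leqnn N)) HN] := expr_vanish q1 e0.
have aE : Qp_abs ((p ^ N)%:R : QQp) = p%:R^-1 ^+ N.
  by rewrite Qp_abs_nat padic_abs_nat ?expn_gt0 ?prime_gt0 // pfactorK // exprVn.
exists (p ^ N)%:R; last by rewrite aE.
by rewrite -Qp_abs_eq0E aE gt_eqF // exprn_gt0 // invr_gt0 ltr0n prime_gt0.
Qed.

Lemma Qp_fact : exists B : rat, forall n, 1 <= B ^+ n * Qp_abs (n`!%:R : QQp).
Proof.
exists p%:R => n; rewrite Qp_abs_nat padic_abs_nat ?fact_gt0 //.
rewrite ler_pdivlMr ?exprn_gt0 ?ltr0n ?prime_gt0 // mul1r.
by rewrite ler_weXn2l ?logn_fact_le // ler1n prime_gt0.
Qed.

Definition Qp_norm : ultranorm QQp := Ultranorm (@Qp_abs_ge0 p pP) Qp_abs_eq0E Qp_absM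
  (@Qp_absD p pP) Qp_complete Qp_small Qp_fact.

End QpUltranorm.

(** * Darboux's theorem near a point *)

Section LocalDarboux.
Context (K : fieldType) (v : ultranorm K) (l : nat).
Local Notation V := 'rV[K]_l.
Local Notation an_at := (an_at v).
Local Notation an_map := (an_map v).
Local Notation pd := (pd v).
Local Notation nearby := (nearby v).
Local Notation near0 f g := (nearby 0 (fun y => f y = g y)).

Definition affine (c : V) (M : 'M[K]_l) (y : V) : V := c + y *m M.

Lemma affine_an c M x : an_map (affine c M) x.
Proof.
move=> j; apply: (@an_at_near _ v _ (fun z => c 0 j + \sum_k M k j * z 0 k)).
  apply: nearbyT => z; rewrite !mxE; congr (_ + _); apply: eq_bigr => k _.
  by rewrite mulrC.
apply: an_atD; first exact: an_at_cst.
by apply: an_at_sum => k; apply: an_atZ; exact: an_at_coord.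
Qed.

Lemma affine_jac c M x : jac v (affine c M) x = M.
Proof.
apply/matrixP => i j; rewrite mxE.
have -> : (fun z : V => affine c M z 0 j) = (fun z => c 0 j + \sum_k M k j * z 0 k).
  apply/funext => z; rewrite !mxE; congr (_ + _); apply: eq_bigr => k _.
  by rewrite mulrC.
have anZ k : an_at (fun z : V => M k j * z 0 k) x.
  by apply: an_atZ; exact: an_at_coord.
rewrite pdD; [|exact: an_at_cst|exact: an_at_sum].
rewrite (has_pdP (has_pd_cst _ _ _ _)) add0r pd_sum //.
rewrite (bigD1 i) //= big1 ?addr0 => [|k ki].
  by rewrite pdZ ?pd_coord ?eqxx ?mulr1 //; exact: an_at_coord.
by rewrite pdZ ?pd_coord ?(negbTE ki) ?mulr0 //; exact: an_at_coord.
Qed.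

Lemma scale_congr t (P M : 'M[K]_l) :
  (t *: P) *m M *m (t *: P)^T = t ^+ 2 *: (P *m M *m P^T).
Proof. by rewrite linearZ /= -!scalemxAl -scalemxAr scalerA -expr2. Qed.

Lemma ext_dZ k (A : 'I_l -> V -> K) x : (forall j, an_at (A j) x) ->
  ext_d v (fun j y => k * A j y) x = k *: ext_d v A x.
Proof. by move=> Ax; apply/matrixP => i j; rewrite !mxE !pdZ // mulrBr. Qed.

Lemma pullZ k (f : V -> V) (W : V -> 'M[K]_l) y :
  pull v f (fun z => k *: W z) y = k *: pull v f W y.
Proof. by rewrite /pull -scalemxAr -scalemxAl. Qed.

(** The homothety multiplies derivatives of order n by t^n, which beats geometric growth in all
    positive orders; order 0 is unaffected and needs the hypothesis on [g 0]. *)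
Lemma intg_rescale (g : V -> K) : an_at g 0 -> v (g 0) <= 1 ->
  exists2 r : rat, 0 < r & forall t, v t <= r -> intg v (fun y => g (t *: y)).
Proof.
move=> ang g0; have [D gD] := hz_ex ang; have [C [R [C0 R0 DCR]]] := hz_bound gD.
have [r [E [c [r0 cs cg cD]]]] := gD.
(* In order n + 1 the bound is (|t| R)^n (|t| C R), with both factors at most 1; |t| <= 1 preserves
   the disc of convergence. *)
exists (Num.min 1 (Num.min R^-1 (C * R)^-1)).
  by rewrite !lt_min !invr_gt0 R0 mulr_gt0.
move=> t; rewrite !le_min => /and3P[t1 tR tCR].
exists (fun a => t ^+ mdeg a * D a); last first.
  move=> a; rewrite uabsM uabsX; case E': (mdeg a) => [|n].
    by rewrite mul1r (mdeg_eq0 E') -(hz_val gD).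
  have t0 := uabs_ge0 v t.
  apply: (@le_trans _ _ (v t ^+ n.+1 * (C * R ^+ n.+1))).
    by rewrite ler_wpM2l ?exprn_ge0 // -E'.
  have -> : v t ^+ n.+1 * (C * R ^+ n.+1) = (v t * R) ^+ n * (v t * (C * R)).
    by rewrite exprMn !exprSr; ring.
  apply: mulr_ile1.
  - by rewrite exprn_ge0 // mulr_ge0 // ltW.
  - by rewrite !mulr_ge0 // ltW.
  - by rewrite exprn_ile1 ?mulr_ge0 ?(ltW R0) // -ler_pdivlMr // mul1r.
  - by rewrite -ler_pdivlMr ?mulr_gt0 // mul1r.
exists r, E, (fun a => t ^+ mdeg a * c a); split=> //.
- have le a : v (t ^+ mdeg a * c a) * r ^+ mdeg a <= v (c a) * r ^+ mdeg a.
    rewrite ler_wpM2r ?exprn_ge0 ?(ltW r0) // uabsM uabsX ler_piMl ?uabs_ge0 //.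
    by rewrite exprn_ile1 ?uabs_ge0.
  split=> [a|e /cs.2[A HA]]; first exact: le_trans (le a) (cs.1 a).
  by exists A => a /HA; exact: le_lt_trans.
- move=> x xr; have tx : disc v r (t *: x).
    by move=> i; rewrite mxE uabsM (le_trans _ (xr i)) // ler_piMl ?uabs_ge0.
  apply: eq_usum (cg _ tx) => a; rewrite -mulrA [in RHS]mulrCA; congr (_ * _).
  rewrite /mono /mdeg expr_sum -big_split /=; apply: eq_bigr => i _.
  by rewrite mxE exprMn.
- by move=> a; rewrite cD mulrCA.
Qed.

Lemma mx_intg_rescale m n (F : V -> 'M[K]_(m, n)) :
  (forall i j, an_at (fun y => F y i j) 0) -> (forall i j, v (F 0 i j) <= 1) ->
  exists2 r : rat, 0 < r & forall t, v t <= r -> mx_intg v (fun y => F (t *: y)).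
Proof.
move=> anF F0.
have /choice[r rP] : forall i, exists r : rat, 0 < r /\ forall t, v t <= r ->
    forall j, intg v (fun y => F (t *: y) i j).
  move=> i; have /choice[r rP] : forall j, exists r : rat, 0 < r /\ forall t, v t <= r ->
      intg v (fun y => F (t *: y) i j).
    by move=> j; have [r r0 H] := intg_rescale (anF i j) (F0 i j); exists r.
  have [s s0 sr] := finite_min (fun j => (rP j).1).
  by exists s; split=> // t ts j; apply: (rP j).2; exact: le_trans (sr j).
have [s s0 sr] := finite_min (fun j => (rP j).1).
by exists s => // t ts i j; apply: (rP i).2; exact: le_trans (sr i).
Qed.

Definition germ_symplectic (W : V -> 'M[K]_l) (x : V) : Prop :=
  [/\ forall i j, an_at (fun y => W y i j) x,
      nearby x (fun y => (W y)^T = - W y),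
      forall i j k, nearby x (fun y => pd i (fun y => W y j k) y +
        pd j (fun y => W y k i) y + pd k (fun y => W y i j) y = 0) &
      W x \in unitmx].

Lemma two_neq0 : 2%:R != 0 :> K.
Proof. exact: (natS_neq0 v 1). Qed.

Lemma germ_potential W x : germ_symplectic W x ->
  exists A : 'I_l -> V -> K, (forall j, an_at (A j) 0) /\
    near0 (fun h => W (x + h)) (ext_d v A).
Proof.
move=> [anW TW cW _].
have sh (P : V -> Prop) : nearby x P -> nearby 0 (fun h => P (x + h)).
  by move=> [r r0 H]; exists r => // h hr; rewrite add0r; exact: H.
have [||||A [WA [Aan _]]] := @poincare _ v l (fun h => W (x + h)).
- move=> i j; have [r [C [r0 H]]] := anW i j; exists r, C; split=> //.
  by apply: eq_an H => h _; rewrite add0r.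
- move=> i j; apply: nearby_imp (sh _ TW) => h /matrixP/(_ j i).
  by rewrite !mxE => ->; rewrite ?opprK.
- by move=> i; apply: nearby_imp (sh _ TW) => h; exact: (skew_diag two_neq0 i).
- move=> i j k; apply: nearby_imp (sh _ (cW i j k)) => h.
  by rewrite -!(pd_shift v _ _ x h).
by exists A.
Qed.

(** Pulling back by y -> x + t y P multiplies the form by t^2 in addition to the congruence by [P].
    [W'] is the pull-back divided by t^2: it stays exact and its value at 0 is independent of
    [t]. *)
Lemma germ_normalize W x (P J : 'M[K]_l) t : germ_symplectic W x ->
  P *m W x *m P^T = J -> t != 0 ->
  let W' y := P *m W (x + y *m (t *: P)) *m P^T in
  exists A : 'I_l -> V -> K, [/\ W' 0 = J, forall j, an_at (A j) 0 &
    near0 W' (ext_d v A)].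
Proof.
move=> Wx PJ t0 W'; have [A [Aan dA]] := germ_potential Wx.
pose T := affine 0 (t *: P).
have T0 : T 0 = 0 by rewrite /T /affine mul0mx addr0.
have Tan y : an_map T y by exact: affine_an.
have pan y : (forall k, an_at (A k) (T y)) -> forall j, an_at (pull1 v T A j) y.
  move=> Ay j; apply: an_at_sum => k; apply: an_atM; first exact: an_at_pd (Tan y k).
  exact: (an_at_comp (Tan y) (Ay k)).
exists (fun j y => t ^- 2 * pull1 v T A j y); split.
- by rewrite /W' mul0mx addr0.
- by move=> j; apply: an_atZ; apply: pan => k; rewrite T0.
have Tn (Q : V -> Prop) : nearby 0 Q -> nearby 0 (fun y => Q (T y)).
  by move=> H; apply: (nearby_comp (Tan 0)); rewrite T0.
have := nearby_and (Tn _ dA) (Tn _ (nearby_all (fun k => an_at_nearby (Aan k)))).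
apply: nearby_imp => y [dy Ay].
rewrite ext_dZ; last exact: pan.
rewrite ext_d_pull1 // /pull -dy affine_jac /W' /T /affine add0r.
by rewrite scale_congr scalerA mulVf ?scale1r // expf_neq0.
Qed.

Lemma local_darboux W0 W1 x : germ_symplectic W0 x -> germ_symplectic W1 x ->
  exists f g : V -> V, [/\ f x = x, g x = x, an_map f x, an_map g x &
    [/\ nearby x (fun y => g (f y) = y), nearby x (fun y => f (g y) = y) &
        nearby x (fun y => pull v f W1 y = W0 y)]].
Proof.
move=> W0x W1x.
have [J [Ji JP]] := skew_normal_form two_neq0 l.
have norm W : germ_symplectic W x -> [/\ forall i j, J i j \in [:: 0; 1; -1],
    forall i j, Ji i j \in [:: 0; 1; -1], J^T = - J, Ji *m J = 1%:M &
    exists2 P, P \in unitmx & P *m W x *m P^T = J].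
  by move=> [_ /nearby_self TW _ uW]; exact: JP.
have [Je Jie JT JK [P0 uP0 P0J]] := norm _ W0x.
have [_ _ _ _ [P1 uP1 P1J]] := norm _ W1x.
have small (c : K) : c \in [:: 0; 1; -1] -> v c <= 1.
  by rewrite !inE => /or3P[]/eqP->; rewrite ?uabs0 ?uabsN ?uabs1.
have resc W P : germ_symplectic W x -> P *m W x *m P^T = J ->
    exists2 r : rat, 0 < r & forall t, v t <= r ->
      mx_intg v (fun y => P *m W (x + y *m (t *: P)) *m P^T).
  move=> [anW _ _ _] PJ.
  have anWP i j : an_at (fun y => W (affine x P y) i j) 0.
    have anW' := anW i j.
    apply: (an_at_comp (affine_an x P (0 : V)) (g := fun y => W y i j)).
    by rewrite /affine mul0mx addr0.
  have [||r r0 rP] := @mx_intg_rescale _ _ (fun y => P *m W (affine x P y) *m P^T).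
  - move=> i j; apply: an_at_near (an_at_sum (index_enum _) (fun k => an_atM
      (an_at_sum (index_enum _) (fun h => an_atZ (P i h) (anWP h k)))
      (an_at_cst v (P^T k j) 0))).
    apply: nearbyT => y; rewrite [in RHS]mxE; apply: eq_bigr => k _.
    by rewrite [in RHS]mxE.
  - by move=> i j; rewrite /affine mul0mx addr0 PJ; exact: small.
  exists r => // t /rP H i j; apply: eq_jet (H i j) => y.
  by rewrite /affine -scalemxAl -scalemxAr.
have [r0 r00 H0] := resc _ _ W0x P0J; have [r1 r10 H1] := resc _ _ W1x P1J.
(* One [t] for both forms, so that the factors t^2 cancel in the final pull-back. *)
have [t t0] : exists2 t, t != 0 & v t < Num.min r0 r1.
  by apply: uabs_small; rewrite lt_min r00.
rewrite lt_min => /andP[/ltW/H0 {}H0 /ltW/H1 {}H1].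
have [A0 [E00 A0an dA0]] := germ_normalize W0x P0J t0.
have [A1 [E10 A1an dA1]] := germ_normalize W1x P1J t0.
have [f fid fW] := formal_darboux JT JK (fun i j => small _ (Jie i j)) H0 H1 E00 E10
  A0an A1an dA0 dA1.
have [g gid [fg gf]] := tangent_id_inv fid.
have [f0 _ _] := fid; have [g0 _ _] := gid.
have anf := tangent_id_an fid; have ang := tangent_id_an gid.
(* [L P] leads from normalized coordinates to the original ones and [S P] is its inverse; the germ
   is conjugated with [P0] at the source and [P1] at the target. *)
pose L P := affine x (t *: P).
pose S P := affine (- (x *m invmx (t *: P))) (invmx (t *: P)).
have tu P : P \in unitmx -> t *: P \in unitmx by move=> uP; rewrite unitmxZ ?unitfE.
have LS P y : P \in unitmx -> L P (S P y) = y.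
  move=> /tu uP; rewrite /L /S /affine mulmxDl mulNmx !mulmxKV // addrA subrr add0r //.
have SL P y : P \in unitmx -> S P (L P y) = y.
  by move=> /tu uP; rewrite /L /S /affine mulmxDl mulmxK // addrA addNr add0r.
have L0 P : L P 0 = x by rewrite /L /affine mul0mx addr0.
have Sx P : S P x = 0 by rewrite /S /affine addNr.
have Lan P y : an_map (L P) y by exact: affine_an.
have San P y : an_map (S P) y by exact: affine_an.
have Sn P (Q : V -> Prop) : nearby 0 Q -> nearby x (fun y => Q (S P y)).
  by move=> HQ; apply: (nearby_comp (San P x)); rewrite Sx.
have pullL W P y : pull v (L P) W y = t ^+ 2 *: (P *m W (L P y) *m P^T).
  by rewrite /pull affine_jac scale_congr.
have anfS : an_map (f \o S P0) x by apply: an_map_comp => //; rewrite Sx.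
have angS : an_map (g \o S P1) x by apply: an_map_comp => //; rewrite Sx.
exists (L P1 \o (f \o S P0)), (L P0 \o (g \o S P1)); split=> /=.
- by rewrite Sx f0 L0.
- by rewrite Sx g0 L0.
- exact: an_map_comp.
- exact: an_map_comp.
split.
- by apply: nearby_imp (Sn P0 _ gf) => y /= E; rewrite SL // E LS.
- by apply: nearby_imp (Sn P1 _ fg) => y /= E; rewrite SL // E LS.
have := nearby_and (Sn P0 _ (nearby_and fW (an_map_nearby anf))) (an_map_nearby anfS).
apply: nearby_imp => y [[fWy fy] fSy].
rewrite pull_comp // pull_comp //.
have -> : pull v (L P1) W1 = (fun z => t ^+ 2 *: (P1 *m W1 (L P1 z) *m P1^T)).
  by apply/funext => z; exact: pullL.
have E : pull v f (fun z => t ^+ 2 *: (P1 *m W1 (L P1 z) *m P1^T)) (S P0 y) =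
    t ^+ 2 *: (P0 *m W0 y *m P0^T).
  by rewrite pullZ; congr (_ *: _); rewrite -[in RHS](LS P0 y).
rewrite {1}/pull E affine_jac -scalemxAr -scalemxAl.
have uP := tu _ _ uP0.
have -> : t ^+ 2 *: (invmx (t *: P0) *m (P0 *m W0 y *m P0^T) *m (invmx (t *: P0))^T) =
  invmx (t *: P0) *m ((t *: P0) *m W0 y *m (t *: P0)^T) *m (invmx (t *: P0))^T.
  by rewrite scale_congr -scalemxAr -scalemxAl.
by rewrite !mulmxA mulVmx // mul1mx -mulmxA -trmx_mul mulVmx // trmx1 mulmx1.
Qed.

End LocalDarboux.

(** * Analytic functions over the p-adic numbers *)

Section Bridge.
Context (p : nat) (pP : prime p).
Local Notation K := (Qp pP).
Local Notation v := (Qp_norm pP).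
Local Open Scope classical_set_scope.

Lemma mx_ballE a b (x y : 'M[K]_(a, b)) (e : rat) :
  ball x e y <-> 0 < e /\ forall i j, v (x i j - y i j) < e.
Proof. by []. Qed.

Lemma nbhs_nearby l (x : 'rV[K]_l) (P : set 'rV[K]_l) : nbhs x P <-> nearby v x P.
Proof.
split=> [/nbhs_ballP[e /= e0 eP]|[r r0 rP]].
  have e2 : 0 < e / 2 by rewrite divr_gt0.
  exists (e / 2) => // h hr; apply: eP; apply/mx_ballE; split=> // i j.
  rewrite (ord1 i) mxE opprD addrA subrr sub0r uabsN; apply: le_lt_trans (hr j) _.
  by rewrite ltr_pdivrMr // ltr_pMr // ltr1n.
apply/nbhs_ballP; exists r => //= y /mx_ballE[_ xy].
by rewrite -(subrK x y) addrC; apply: rP => j; rewrite !mxE uabsBC ltW.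
Qed.

Lemma open_nearby l (U : set 'rV[K]_l) : open U <-> forall x, U x -> nearby v x U.
Proof.
rewrite openE; split=> [oU x /oU|oU x /oU]; first by move/nbhs_nearby.
by move=> H; apply/nbhs_nearby.
Qed.

Lemma partial_sumE (I : choiceType) a b (F : I -> 'M[K]_(a, b)) (A : {fset I}) i j :
  partial_sum F A i j = \sum_(k <- A) F k i j.
Proof. by rewrite /partial_sum summxE big_seq_fsetE. Qed.

Lemma cvg_usum (I : choiceType) a b (F : I -> 'M[K]_(a, b)) (s : 'M[K]_(a, b)) :
  (partial_sum F @ totally --> s) <-> forall i j, usum v (fun k => F k i j) (s i j).
Proof.
split=> [Fs i j e e0|Fs].
  have /Fs[A _ AF] : nbhs s (ball s e) by exact: nbhsx_ballx.
  have AB B : (A `<=` B)%fset -> v (s i j - \sum_(k <- B) F k i j) < e.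
    by move=> /AF/mx_ballE[_ /(_ i j)]; rewrite partial_sumE.
  exists A; split=> [k kA|]; last exact: AB.
  (* A single term is the difference of two partial sums past [A], hence small. *)
  have kE : F k i j = (s i j - \sum_(h <- A) F h i j) -
      (s i j - \sum_(h <- (k |` A)%fset) F h i j).
    by rewrite big_fsetU1 //=; ring.
  by rewrite kE uabsB_lt // AB // fsubsetUr.
move=> P /nbhs_ballP[e /= e0 eP].
have /choice[A HA] : forall ij : 'I_a * 'I_b, exists A : {fset I}, forall B,
    (A `<=` B)%fset -> v (s ij.1 ij.2 - \sum_(k <- B) F k ij.1 ij.2) < e.
  by move=> [i j]; have [A [_ H]] := usum_sup (Fs i j) e0; exists A.
exists (\bigcup_(ij <- enum {: 'I_a * 'I_b}) A ij)%fset => // B /= AB; apply: eP.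
apply/mx_ballE; split=> // i j; rewrite partial_sumE; apply: (HA (i, j)).
apply: fsubset_trans AB; apply: bigfcup_sup => //; exact: mem_enum.
Qed.

Lemma vanishing_bounded (I : choiceType) (w : I -> rat) : vanishing w ->
  exists C, forall i, w i <= C.
Proof.
move=> /(_ 1 ltr01)[A HA]; exists (1 + \sum_(i <- A) `|w i|) => i.
have s0 (s : seq I) : 0 <= \sum_(j <- s) `|w j| by apply: sumr_ge0.
case: (boolP (i \in A)) => [iA|/HA/ltW wi]; last by rewrite (le_trans wi) // lerDl s0.
rewrite (big_fsetD1 i) //= addrCA (le_trans (ler_norm _)) // lerDl.
by rewrite addr_ge0 // s0.
Qed.

(** Provides radii in the value group, so that a series can be evaluated at a point on the boundary
    of the disc. *)
Lemma uabs_between (x : K) (r : rat) : 0 < r -> v x < r ->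
  exists2 t : K, t != 0 & v x <= v t < r.
Proof.
move=> r0 xr; have [x0|x0] := eqVneq x 0; last by exists x; rewrite ?lexx.
by have [t t0 tr] := uabs_small v r0; exists t; rewrite // x0 uabs0 uabs_ge0.
Qed.

(** A power series given on an open ball around [x0] is restricted to a closed disc of radius |t| <
    r that still contains [x], then recentred at [x]. *)
Lemma analytic_on_at l a b (U : set 'rV[K]_l) (f : 'rV[K]_l -> 'M[K]_(a, b)) :
  analytic_on U f -> forall x, U x ->
  nearby v x U /\ forall i j, an_at v (fun y => f y i j) x.
Proof.
move=> Uf x /Uf[x0 [r [/mx_ballE[r0 x0x] rU [c cf]]]]; split.
  have [s s0 sr] := finite_min (fun _ : 'I_1 => (divr_gt0 r0 (ltr0Sn _ 1) : 0 < r / 2)).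
  exists s => // h hs; apply: rU; apply/mx_ballE; split=> // i j.
  rewrite mxE opprD addrA (ord1 i) uabsB_lt //.
  apply: le_lt_trans (hs j) _; apply: le_lt_trans (sr ord0) _.
  by rewrite ltr_pdivrMr // ltr_pMr // ltr1n.
have [t [t0 tr xt]] : exists t : K, [/\ t != 0, v t < r & forall i, v (x0 0 i - x 0 i) <= v t].
  suff [t t0 [tr tx]] : exists2 t : K, t != 0 & v t < r /\ forall i, i \in enum 'I_l ->
      v (x0 0 i - x 0 i) <= v t.
    by exists t; split=> // i; apply: tx; rewrite mem_enum.
  elim: (enum _) => [|i s [t t0 [tr IH]]].
    by have [t t0 tr] := uabs_small v r0; exists t.
  have [u u0 /andP[xu ur]] := uabs_between r0 (x0x 0 i).
  have [tu|/ltW ut] := lerP (v t) (v u).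
    exists u => //; split=> // j; rewrite inE => /orP[/eqP->//|/IH jt].
    exact: le_trans jt tu.
  exists t => //; split=> // j; rewrite inE => /orP[/eqP->|/IH//].
  exact: le_trans xu ut.
have vt : 0 < v t by rewrite uabs_gt0.
have inball h : disc v (v t) h -> ball x0 r (x0 + h).
  move=> ht; apply/mx_ballE; split=> // i j.
  by rewrite mxE opprD addrA subrr sub0r uabsN (ord1 i) (le_lt_trans (ht j)).
move=> i j; pose d k := c k i j.
have df h : disc v (v t) h -> usum v (fun k => d k * mono k h) (f (x0 + h) i j).
  move=> /inball /cf /cvg_usum/(_ i j); apply: eq_usum => k.
  by rewrite mxE [x0 + h]addrC addrK mulrC.
have dv : vanishing (fun k => v (d k) * v t ^+ mdeg k).
  (* Convergence at the point with all coordinates [t] is exactly the decay of the coefficients at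
     radius |t|. *)
  have tt : disc v (v t) (const_mx t : 'rV[K]_l) by move=> k; rewrite mxE.
  move=> e e0; have [A HA] := usum_van (df _ tt) e0; exists A => k /HA.
  rewrite uabsM /mono; under eq_bigr do rewrite mxE.
  by rewrite uabs_prod; under eq_bigr do rewrite uabsX; rewrite -expr_sum.
have [C dC] := vanishing_bounded dv.
have xx : disc v (v t) (x - x0) by move=> k; rewrite !mxE uabsBC.
exists (v t), C; split=> //.
have anf : an v (v t) C (fun h => f (x0 + h) i j) by exists d.
apply: eq_an (an_recenter vt xx anf) => h _.
by rewrite addrA [x0 + (x - x0)]addrC subrK.
Qed.

Lemma at_analytic_on l a b (U : set 'rV[K]_l) (f : 'rV[K]_l -> 'M[K]_(a, b)) :
  (forall x, U x -> nearby v x U /\ forall i j, an_at v (fun y => f y i j) x) ->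
  analytic_on U f.
Proof.
move=> H x /H[[r r0 rU] fx].
have /choice[s sP] : forall i, exists s : rat, 0 < s /\ forall j, exists C,
    an v s C (fun h => f (x + h) i j).
  move=> i; have [s [C [s0 anf]]] := an_at_all (fx i).
  by exists s; split=> // j; exists C.
have [s' s'0 s's] := finite_min (fun i => (sP i).1).
pose t := Num.min r s'.
have t0 : 0 < t by rewrite lt_min r0.
have tr : t <= r by rewrite ge_min lexx.
have ts i : 0 <= t <= s i by rewrite (ltW t0) (le_trans _ (s's i)) // ge_min lexx orbT.
have /choice[c cP] : forall ij : 'I_a * 'I_b, exists c,
    expands v t c (fun h => f (x + h) ij.1 ij.2).
  by move=> [i j]; have [C anf] := (sP i).2 j; have [c _ ?] := an_restrict (ts i) anf; exists c.
have ballD y : ball x t y -> disc v t (y - x).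
  by move=> /mx_ballE[_ xy] j; rewrite !mxE uabsBC ltW.
exists x, t; split; first exact: ballxx.
  move=> y /ballD yt; rewrite -(subrK x y) addrC; apply: rU; exact: disc_le yt.
exists (fun k => \matrix_(i, j) c (i, j) k) => y /ballD yt.
apply/cvg_usum => i j; have := cP (i, j) _ yt; rewrite /= [x + _]addrC subrK.
by apply: eq_usum => k; rewrite !mxE mulrC.
Qed.

(** Properness of the punctured filter, together with the Hausdorff property, is what identifies the
    value of [lim] in [partial]. *)
Lemma Qp_dnbhs_proper : ProperFilter (0 : K)^'.
Proof.
apply: Build_ProperFilter_ex => P /nbhs_ballP[e /= e0 eP].
have [t t0 te] := uabs_small v e0; exists t; apply: eP => //.
by change (v (0 - t) < e); rewrite sub0r uabsN.
Qed.

Lemma Qp_mx_hausdorff a b : hausdorff_space 'M[K]_(a, b).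
Proof.
move=> P Q PQ; apply/matrixP => i j; apply/eqP; rewrite -subr_eq0.
rewrite -(uabs_eq0 v) eq_le uabs_ge0 andbT; apply/ler_addgt0Pr => e e0; rewrite add0r.
have [R [/mx_ballE[_ PR] /mx_ballE[_ QR]]] :=
  PQ _ _ (nbhsx_ballx P e e0) (nbhsx_ballx Q e e0).
have -> : P i j - Q i j = (P i j - R i j) - (Q i j - R i j) by ring.
by rewrite ltW // uabsB_lt.
Qed.

Lemma partialE l a b i (f : 'rV[K]_l -> 'M[K]_(a, b)) x :
  (forall j k, an_at v (fun y => f y j k) x) ->
  partial i f x = \matrix_(j, k) pd v i (fun y => f y j k) x.
Proof.
move=> fx; set D := \matrix_(_, _) _.
have PF := Qp_dnbhs_proper; apply: cvg_lim; first exact: Qp_mx_hausdorff.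
move=> P /nbhs_ballP[e /= e0 eP].
have /choice[C /choice[r Cr]] : forall jk : 'I_a * 'I_b, exists C r : rat, 0 < r /\
    forall t, v t <= r -> v (f (x + t *: axis K i) jk.1 jk.2 - f x jk.1 jk.2 -
       t * D jk.1 jk.2) <= C * v t ^+ 2.
  by move=> [j k]; have := an_at_has_pd i (fx j k); rewrite /= mxE.
have [C' C'0 CC'] := finite_max C.
have [r' r'0 r'r] := finite_min (fun jk => (Cr jk).1).
(* The difference quotient is off by at most C' |t|, which is below [e] as soon as |t| < e / C'. *)
have m0 : 0 < Num.min r' (e / C') by rewrite lt_min r'0 divr_gt0.
rewrite /nbhs /= /nbhs /=; apply/nbhs_ballP; exists (Num.min r' (e / C')) => //= t.
move=> bt; have {bt} : v (0 - t) < Num.min r' (e / C') by exact: bt.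
rewrite sub0r uabsN lt_min => /andP[/ltW tr te] t0.
apply: eP; apply/mx_ballE; split=> // j k.
have vt : 0 < v t by rewrite uabs_gt0.
have -> : D j k - (t^-1 *: (f (x + t *: delta_mx 0 i) - f x)) j k =
   - (t^-1 * (f (x + t *: axis K i) j k - f x j k - t * D j k)).
  have E (g h : 'M[K]_(a, b)) : (t^-1 *: (g - h)) j k = t^-1 * (g j k - h j k).
    by rewrite !mxE.
  rewrite E -{1}(mulKf t0 (D j k)) -/(axis K i); ring.
rewrite uabsN uabsM uabsV mulrC ltr_pdivrMr //.
apply: le_lt_trans ((Cr (j, k)).2 t (le_trans tr (r'r _))) _.
apply: (@le_lt_trans _ _ (C' * v t ^+ 2)); first exact: quad_le (ltW vt) (CC' _).
by rewrite expr2 mulrA ltr_pM2r // mulrC -ltr_pdivlMr.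
Qed.

Lemma partial_entry l a b i (f : 'rV[K]_l -> 'M[K]_(a, b)) x j k :
  (forall j k, an_at v (fun y => f y j k) x) ->
  partial i f x j k = pd v i (fun y => f y j k) x.
Proof. by move=> fx; rewrite (partialE i fx) mxE. Qed.

Lemma jacobianE l1 l2 (f : 'rV[K]_l1 -> 'rV[K]_l2) x : an_map v f x ->
  jacobian f x = jac v f x.
Proof.
move=> fx; have fx' j k : an_at v (fun y => f y j k) x by rewrite (ord1 j); exact: fx.
by apply/matrixP => i j; rewrite [LHS]mxE [RHS]mxE (partial_entry i 0 j fx').
Qed.

End Bridge.

(** * Manifolds *)

Lemma mulmx_congr (R : comNzRingType) l (u u' : 'rV[R]_l) (A F W : 'M[R]_l) :
  u *m A *m F *m W *m (u' *m A *m F)^T = (u *m A) *m (F *m W *m F^T) *m (u' *m A)^T.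
Proof. by rewrite !trmx_mul !mulmxA. Qed.

Section Manifold.
Context (p : nat) (pP : prime p) (l : nat) (M : manifold pP l).
Local Notation K := (Qp pP).
Local Notation v := (Qp_norm pP).
Local Notation V := 'rV[K]_l.
Local Open Scope classical_set_scope.
Implicit Types (phi chi : chart pP l M) (m : M) (w : two_form M).

Lemma chart_at_atlas m : atlas (chart_at m).
Proof. by rewrite /chart_at; case: cid2. Qed.

Lemma dom_chart_at m : dom (chart_at m) m.
Proof. by rewrite /chart_at; case: cid2. Qed.

Lemma chartK phi m : dom phi m -> coord_inv phi (phi m) = m.
Proof. by move=> pm; apply: coordK; rewrite inE. Qed.

Lemma chart_invK phi x : cod phi x -> phi (coord_inv phi x) = x.
Proof. by move=> px; apply: coord_invK; rewrite inE. Qed.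

Lemma cod_nearby phi x : cod phi x -> nearby v x (cod phi).
Proof. by move=> px; apply: (open_nearby _).1 px; exact: cod_open. Qed.

Lemma transition_an phi chi m : atlas phi -> atlas chi -> dom phi m -> dom chi m ->
  an_map v (chi \o coord_inv phi) (phi m) /\
  nearby v (phi m) (fun y => cod phi y /\ dom chi (coord_inv phi y)).
Proof.
move=> aphi achi pm cm.
have im : (phi @` (dom phi `&` dom chi)) (phi m) by exists m.
have [near_im an_im] := analytic_on_at (atlas_compat aphi achi) im; split.
  by move=> j; exact: an_im.
apply: nearby_imp near_im => _ [q [pq cq] <-]; split; first exact: coord_fun.
by rewrite chartK.
Qed.

Lemma jac_transitionK phi chi m : atlas phi -> atlas chi -> dom phi m -> dom chi m ->
  jac v (chi \o coord_inv phi) (phi m) *m jac v (phi \o coord_inv chi) (chi m) = 1%:M.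
Proof.
move=> aphi achi pm cm.
have [an1 near1] := transition_an aphi achi pm cm.
have [an2 _] := transition_an achi aphi cm pm.
have chiE : (chi \o coord_inv phi) (phi m) = chi m by rewrite /= chartK.
rewrite -chiE in an2 *; rewrite -(jac_comp an1 an2) -(jac_id v (phi m)).
apply: jac_near; apply: nearby_imp near1 => y [py cy].
by rewrite /= chartK // chart_invK.
Qed.

Lemma chart_open phi (U : set V) : open U -> open (dom phi `&` phi @^-1` U).
Proof.
move=> oU; have oD := @dom_open _ _ _ _ phi.
have ctsphi : {in dom phi, continuous phi}.
  by rewrite -continuous_open_subspace //; exact: coord_cts.
exact: (continuous_inP phi oD).1 ctsphi U oU.
Qed.

Section Bilinear.
Context (w : two_form M) (m : M).

Lemma formDl (u u' x : V) k : w m (k *: u + u') x = k * w m u x + w m u' x.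
Proof. exact: (form_linearl w x k u u'). Qed.

Lemma formDr (u u' x : V) k : w m x (k *: u + u') = k * w m x u + w m x u'.
Proof. exact: (form_linearr w x k u u'). Qed.

Lemma form0l (x : V) : w m (0 : V) x = 0.
Proof. by have := formDl 0 0 x (-1); rewrite scaler0 addr0 mulN1r addNr. Qed.

Lemma form0r (x : V) : w m x (0 : V) = 0.
Proof. by have := formDr 0 0 x (-1); rewrite scaler0 addr0 mulN1r addNr. Qed.

Lemma form_suml (I : Type) (s : seq I) (c : I -> K) (F : I -> V) (x : V) :
  w m (\sum_(i <- s) c i *: F i : V) x = \sum_(i <- s) c i * w m (F i) x.
Proof.
by elim: s => [|i s IH]; rewrite ?big_nil ?form0l // !big_cons formDl IH.
Qed.

Lemma form_sumr (I : Type) (s : seq I) (c : I -> K) (F : I -> V) (x : V) :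
  w m x (\sum_(i <- s) c i *: F i : V) = \sum_(i <- s) c i * w m x (F i).
Proof.
by elim: s => [|i s IH]; rewrite ?big_nil ?form0r // !big_cons formDr IH.
Qed.

Lemma form_skew (x y : V) : w m x y = - w m y x.
Proof.
have := @form_alt _ _ _ _ w m (1 *: x + y : V); rewrite formDl !formDr !form_alt !mul1r.
by rewrite add0r addr0 => /eqP; rewrite addr_eq0 => /eqP.
Qed.

Lemma form_mulmx (A : 'M[K]_l) (u u' : V) :
  w m (u *m A : V) (u' *m A : V) =
  (u *m (\matrix_(i, j) w m (delta_mx 0 i *m A : V) (delta_mx 0 j *m A : V))
     *m u'^T) 0 0.
Proof.
have E (x : V) : x *m A = \sum_i x 0 i *: (delta_mx 0 i *m A).
  by rewrite {1}[x]row_sum_delta mulmx_suml; apply: eq_bigr => i _; rewrite scalemxAl.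
rewrite (E u) (E u') form_sumr mxE; apply: eq_bigr => j _.
rewrite form_suml !mxE mulrC mulr_suml mulr_suml; apply: eq_bigr => i _.
by rewrite !mxE.
Qed.

End Bilinear.

Lemma form_chart w phi x (u u' : V) :
  w (coord_inv phi x) (tangent_of_chart phi x u) (tangent_of_chart phi x u') =
  (u *m form_mx w phi x *m u'^T) 0 0.
Proof. exact: form_mulmx. Qed.

Lemma form_mx_skew w phi x : (form_mx w phi x)^T = - form_mx w phi x.
Proof. by apply/matrixP => i j; rewrite !mxE; exact: form_skew. Qed.

Lemma form_mx_symplectic w m : symplectic w ->
  germ_symplectic v (form_mx w (chart_at m)) (chart_at m m).
Proof.
move=> [anw cw ndw]; set phi := chart_at m.
have aphi : atlas phi := chart_at_atlas m; have pm : dom phi m := dom_chart_at m.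
have codm : cod phi (phi m) := coord_fun pm.
have an_mx x : cod phi x -> forall i j, an_at v (fun y => form_mx w phi y i j) x.
  by move=> px; case: (analytic_on_at (anw phi aphi) px).
split.
- exact: an_mx.
- by apply: nearbyT => y; exact: form_mx_skew.
- move=> i j k; apply: nearby_imp (cod_nearby codm) => y py.
  have E a b c := esym (partial_entry a b c (an_mx y py)).
  transitivity (dform_coef w phi y i j k); last exact: cw.
  exact: congr2 (congr2 +%R (E i j k) (E j k i)) (E k i j).
rewrite unitmxE unitfE; apply/negP => /det0P[u u0 uW].
have [u' wu] : exists u' : tangent m, w m (u : V) u' <> 0.
  by apply: ndw => /eqP; rewrite (negbTE u0).
(* The chart representing tangent vectors at [m] is [phi] itself, so the kernel vector [u] is a
   tangent vector with the same coordinates. *)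
apply: wu; have T1 : jac v (chart_at m \o coord_inv phi) (phi m) = 1%:M.
  rewrite -(jac_id v (phi m)); apply: jac_near.
  by apply: nearby_imp (cod_nearby codm) => y py; rewrite /= chart_invK.
have := form_chart w phi (phi m) u u'; rewrite uW mul0mx mxE /tangent_of_chart.
rewrite chartK // jacobianE; last by case: (transition_an aphi aphi pm pm).
by rewrite T1 !mulmx1.
Qed.

Lemma conj_analytic phi (f : V -> V) (U : set V) : atlas phi -> open U ->
  (forall y, U y -> an_map v f y /\ cod phi (f y)) ->
  analytic_map (dom phi `&` phi @^-1` U) (coord_inv phi \o f \o phi).
Proof.
move=> aphi oU Uf; split=> [|a b aa ab]; first exact: chart_open.
apply: at_analytic_on => _ [m [[am [pm Um]] bm] <-].
have [antau ntau] := transition_an aa aphi am pm.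
set tau := phi \o coord_inv a in antau ntau.
have tauE : tau (a m) = phi m by rewrite /tau /= chartK.
have [anf codf] := Uf _ Um.
pose q := coord_inv phi (f (phi m)).
have pq : dom phi q by exact: coord_inv_fun.
have phiq : phi q = f (phi m) by rewrite /q chart_invK.
have [anb nb] := transition_an aphi ab pq bm.
rewrite phiq in anb nb.
have ftauE : (f \o tau) (a m) = f (phi m) := congr1 f tauE.
rewrite -tauE in anf; have anftau := an_map_comp antau anf.
rewrite -ftauE in anb nb.
split.
  have nU : nearby v (a m) (fun y => U (tau y)).
    by apply: (nearby_comp antau); rewrite tauE; exact: (open_nearby U).1.
  have nbf : nearby v (a m) (fun y => dom b (coord_inv phi (f (tau y)))).
    apply: (nearby_comp (f := f \o tau) (P := fun z => dom b (coord_inv phi z)) anftau).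
    by apply: nearby_imp nb => z [].
  apply: nearby_imp (nearby_and ntau (nearby_and nU nbf)) => y [[ay py] [Uy by_]].
  exists (coord_inv a y); last exact: chart_invK.
  by split; [split; [exact: coord_inv_fun|split]|].
by move=> i j; rewrite (ord1 i); exact: (an_map_comp anftau anb j).
Qed.

(** Tangent vectors at [m] and at its image live in the chosen charts there, not in [phi]; chain
    rule and inverse transitions reduce the claim to matrices in [phi]. *)
Lemma pullback_chart phi (f : V -> V) w w' m : atlas phi -> dom phi m ->
  an_map v f (phi m) -> cod phi (f (phi m)) ->
  pull v f (form_mx w' phi) (phi m) = form_mx w phi (phi m) ->
  forall u u' : tangent m,
    pullback (coord_inv phi \o f \o phi) w' u u' = w m u u'.
Proof.
move=> aphi pm anf codf fW u u'.
pose q := coord_inv phi (f (phi m)).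
have pq : dom phi q by exact: coord_inv_fun.
have phiq : phi q = f (phi m) by rewrite /q chart_invK.
set c := chart_at m; set c' := chart_at q.
have ac : atlas c := chart_at_atlas m; have ac' : atlas c' := chart_at_atlas q.
have cm : dom c m := dom_chart_at m; have cq : dom c' q := dom_chart_at q.
have [an1 _] := transition_an ac aphi cm pm.
have [an2 _] := transition_an aphi ac' pq cq; rewrite phiq in an2.
have [an3 _] := transition_an aphi ac pm cm.
have E1 : (phi \o coord_inv c) (c m) = phi m by rewrite /= chartK.
have E2 : (f \o (phi \o coord_inv c)) (c m) = f (phi m) := congr1 f E1.
have anf1 := anf; rewrite -E1 in anf1; have an4 := an_map_comp an1 anf1.
have an5 := an2; rewrite -E2 in an5; have an6 := an_map_comp an4 an5.
pose A := jac v (phi \o coord_inv c) (c m).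
pose F := jac v f (phi m).
have JE : jacobian (c' \o (coord_inv phi \o f \o phi) \o coord_inv c) (c m) =
    A *m F *m jacobian (c' \o coord_inv phi) (f (phi m)).
  rewrite (jacobianE an2); apply: etrans (jacobianE an6) _.
  by rewrite (jac_comp an4 an5) (jac_comp an1 anf1) E1 E2.
have TE (x : tangent m) : tangent_map (coord_inv phi \o f \o phi) x =
    tangent_of_chart phi (f (phi m)) ((x : V) *m A *m F).
  by rewrite /tangent_map JE /tangent_of_chart !mulmxA.
rewrite /pullback !TE.
rewrite [LHS](form_chart w' phi (f (phi m)) (u *m A *m F) (u' *m A *m F)).
have {}fW : F *m form_mx w' phi (f (phi m)) *m F^T = form_mx w phi (phi m) := fW.
rewrite mulmx_congr fW.
rewrite -form_chart /tangent_of_chart chartK // (jacobianE an3).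
by rewrite -!mulmxA (jac_transitionK ac aphi cm pm) !mulmx1.
Qed.

Lemma darboux (w0 w1 : two_form M) m : symplectic w0 -> symplectic w1 ->
  exists U0 U1 : set M,
    [/\ open U0, U0 m, open U1 & U1 m] /\
    exists psi : M -> M,
      analytic_diffeo U0 U1 psi /\
      forall x : M, U0 x -> forall u u' : tangent x, pullback psi w1 u u' = w0 x u u'.
Proof.
move=> /(form_mx_symplectic m) s0 /(form_mx_symplectic m) s1.
set phi := chart_at m in s0 s1; set x := phi m in s0 s1.
have aphi : atlas phi := chart_at_atlas m; have pm : dom phi m := dom_chart_at m.
have codx : cod phi x := coord_fun pm.
have [f [g [fx gx anf ang [gf fg fW]]]] := local_darboux s0 s1.
pose P y := (cod phi y /\ an_map v f y /\ an_map v g y) /\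
  (g (f y) = y /\ f (g y) = y /\ pull v f (form_mx w1 phi) y = form_mx w0 phi y).
have nP : nearby v x P.
  apply: nearby_and; first apply: nearby_and; [exact: cod_nearby| |].
    by apply: nearby_and; exact: an_map_nearby.
  by apply: nearby_and => //; exact: nearby_and.
(* The interior of [P], which is open and still contains [x]. *)
pose N : set V := fun y => nearby v y P.
have NP y : N y -> P y by exact: nearby_self.
have oN : open N by apply/open_nearby => y Ny; exact: nearby_near.
have oV (h : V -> V) : (forall y, N y -> an_map v h y) -> open [set y | N y /\ N (h y)].
  move=> anh; apply/open_nearby => y [Ny Nhy]; apply: nearby_and.
    exact: (open_nearby N).1.
  by apply: (nearby_comp (anh y Ny)); exact: (open_nearby N).1.
(* Both maps must exchange the two sets: for [y] in [V0], [g (f y) = y] lies in [N], so [f y] is in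
   [V1], and symmetrically for [g]. *)
pose V0 := [set y | N y /\ N (f y)]; pose V1 := [set y | N y /\ N (g y)].
have oV0 : open V0 by apply: oV => y /NP[[_ []]].
have oV1 : open V1 by apply: oV => y /NP[[_ []]].
have fV0 y : V0 y -> V1 (f y).
  by move=> [Ny Nfy]; have [_ [E _]] := NP _ Ny; split; [exact: Nfy|rewrite E].
have gV1 y : V1 y -> V0 (g y).
  by move=> [Ny Ngy]; have [_ [_ [E _]]] := NP _ Ny; split; [exact: Ngy|rewrite E].
have codN y : N y -> cod phi y by move=> /NP[[]].
have V0x : V0 x by split; [exact: nP|rewrite fx; exact: nP].
have V1x : V1 x by split; [exact: nP|rewrite gx; exact: nP].
have fcod y : V0 y -> cod phi (f y) by move=> [_ /codN].
have gcod y : V1 y -> cod phi (g y) by move=> [_ /codN].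
have gfK q : dom phi q -> V0 (phi q) ->
    coord_inv phi (g (phi (coord_inv phi (f (phi q))))) = q.
  move=> pq Vq; rewrite (chart_invK (fcod _ Vq)).
  by have [_ [E _]] := NP _ Vq.1; rewrite E (chartK pq).
have fgK q : dom phi q -> V1 (phi q) ->
    coord_inv phi (f (phi (coord_inv phi (g (phi q))))) = q.
  move=> pq Vq; rewrite (chart_invK (gcod _ Vq)).
  by have [_ [_ [E _]]] := NP _ Vq.1; rewrite E (chartK pq).
have V0P y : V0 y -> an_map v f y /\ cod phi (f y).
  by move=> Vy; have [[_ [anfy _]] _] := NP _ Vy.1; split; [exact: anfy|exact: fcod].
have V1P y : V1 y -> an_map v g y /\ cod phi (g y).
  by move=> Vy; have [[_ [_ angy]] _] := NP _ Vy.1; split; [exact: angy|exact: gcod].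
exists (dom phi `&` phi @^-1` V0), (dom phi `&` phi @^-1` V1); split.
  split; [exact: chart_open oV0|exact: (conj pm V0x)|
    exact: chart_open oV1|exact: (conj pm V1x)].
exists (coord_inv phi \o f \o phi); split; last first.
  move=> q [pq Vq]; have [[_ [anfq _]] [_ [_ fWq]]] := NP _ Vq.1.
  exact: (pullback_chart aphi pq anfq (fcod _ Vq) fWq).
split.
- split.
  + move=> q [pq Vq]; split; first exact: (coord_inv_fun (fcod _ Vq)).
    by rewrite /preimage /= (chart_invK (fcod _ Vq)); exact: fV0.
  + move=> q q' /set_mem[pq Vq] /set_mem[pq' Vq'] E.
    apply: etrans (esym (gfK q pq Vq)) (etrans _ (gfK q' pq' Vq')).
    exact: (congr1 (fun z => coord_inv phi (g (phi z))) E).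
  + move=> q [pq Vq]; exists (coord_inv phi (g (phi q))); last exact: fgK.
    split; first exact: (coord_inv_fun (gcod _ Vq)).
    by rewrite /preimage /= (chart_invK (gcod _ Vq)); exact: gV1.
- exact: conj_analytic aphi oV0 V0P.
- exists (coord_inv phi \o g \o phi); split.
    by move=> q /set_mem[pq Vq]; exact: gfK.
  exact: conj_analytic aphi oV1 V1P.
Qed.

End Manifold.


Local Open Scope classical_set_scope.

Theorem theorem4p1 (n : nat) (n_gt0 : (0 < n)%N) (p : nat) (pP : prime p)
    (M : manifold pP (2 * n)) (w0 w1 : two_form M)
    (w0_sympl : symplectic w0) (w1_sympl : symplectic w1) (m : M) :
  exists U0 U1 : set M,
    [/\ open U0, U0 m, open U1 & U1 m] /\
    exists psi : M -> M,
      analytic_diffeo U0 U1 psi /\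
      forall x : M, U0 x -> forall u v : tangent x,
        pullback psi w1 u v = w0 x u v.
Proof. exact: darboux. Qed.
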